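(* Let $\mu$ be a probability measure on $\mathbb{R}$ with finite moments of all orders, let $c\in\mathbb{R}$, and let $c\mu$ denote the pushforward of $\mu$ under $x\mapsto cx$. Then for every integer $N\ge0$, $$D_N(c\mu)=c^{(N+1)(N+2)}D_N(\mu).$$ For fixed $p>0$ and integer $N\geq0$, $$\lim_{q\to\infty}q^{(N+1)(N+2)}D_N(\beta_{p,q})=D_N(\gamma_p),$$ where $\gamma_p$ is the gamma distribution with shape $p$ and unit scale. If $D_N(\gamma_p)<0$, then $\beta_{p,q}$ is not freely infinitely divisible for all sufficiently large $q$.
   Context: For $p,q>0$, $\beta_{p,q}$ denotes the beta distribution on $[0,1]$ with density $x^{p-1}(1-x)^{q-1}/B(p,q)$ on $(0,1)$, where $B$ is the Euler beta function. The gamma distribution $\gamma_p$ has density $x^{p-1}e^{-x}/\Gamma(p)$ on $(0,\infty)$. For a probability measure $\mu$ on $\mathbb{R}$ with finite moments $m_n(\mu)=\int x^n\,\mu(\mathrm{d}x)$, the free cumulants $\kappa_n(\mu)$, $n\ge 1$, are determined by $m_n(\mu)=\sum_{\pi\in NC(n)}\prod_{V\in\pi}\kappa_{|V|}(\mu)$ for all $n\geq 1$, where $NC(n)$ is the set of noncrossing partitions of $\{1,\dots,n\}$ and the product is over the blocks $V$ of $\pi$. For $N\ge0$, $H_N(\mu)=[\kappa_{i+j+2}(\mu)]_{i,j=0}^{N}$ and $D_N(\mu)=\det H_N(\mu)$. A probability measure $\mu$ on $\mathbb{R}$ is freely infinitely divisible if for every $n\in\mathbb{N}$, $n\ge1$,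 there is a probability measure $\mu_n$ on $\mathbb{R}$ such that $\mu$ is the $n$-fold free additive convolution power $\mu_n^{\boxplus n}$. *)

(* Defs.v *)
From HB Require Import structures.
From mathcomp Require Import all_boot all_order all_algebra.
From mathcomp Require Import all_classical all_reals all_analysis.
From mathcomp Require Import measurable_realfun complex.

Set Implicit Arguments.
Unset Strict Implicit.
Unset Printing Implicit Defensive.

Import Order.TTheory GRing.Theory Num.Theory.
Import numFieldNormedType.Exports.

Local Open Scope ring_scope.
Local Open Scope complex_scope.

Notation Rmeasure R :=
  {measure set (measurableTypeR R%type) -> \bar R%type}.
Notation Rprobability R :=
  (probability (measurableTypeR R%type) R%type).

Definition moment (R : realType) (mu : Rmeasure R) (n : nat) : R :=
  \int[mu]_x (x ^+ n).

Definition noncrossing (n : nat) (P : {set {set 'I_n}}) : bool :=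
  [forall V in P, forall W in P,
    [forall a in V, forall b in W, forall c in V, forall d in W,
      [&& (a < b)%N, (b < c)%N & (c < d)%N] ==> (V == W)]].

Definition NC (n : nat) : {set {set {set 'I_n}}} :=
  [set P | finset.partition P [set: 'I_n] & noncrossing P].

(* The first n free cumulants k_1, ..., k_n of a moment sequence m.  Isolating *)
(* the one-block partition, whose contribution is k_n, turns the               *)
(* moment-cumulant formula into the recursion                                  *)
(*   k_n = m_n - \sum_(P in NC(n), P != 1_n) \prod_(V in P) k_|V|.             *)
Fixpoint cumulant_seq (R : realType) (m : nat -> R) (n : nat) : seq R :=
  if n is n'.+1 then
    let s := cumulant_seq m n' in
    rcons s (m n - \sum_(P in NC n | P != [set [set: 'I_n]])
                     \prod_(V in P) s`_(#|V|.-1))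
  else [::].

(* Meaningful for n >= 1. *)
Definition free_cumulant (R : realType) (mu : Rmeasure R) (n : nat) : R :=
  (cumulant_seq (moment mu) n)`_n.-1.

Section moment_cumulant.
Variables (R : realType) (mu : Rmeasure R).
Local Notation k := (free_cumulant mu).
Local Notation s := (cumulant_seq (moment mu)).

Let size_s n : size (s n) = n.
Proof. by elim: n => //= n IHn; rewrite size_rcons IHn. Qed.

Let nth_s n i : (0 < i <= n)%N -> (s n)`_i.-1 = k i.
Proof.
elim: n => [|n IHn]; first by case: i.
move=> /andP[i0]; rewrite leq_eqVlt => /predU1P[->//|]; rewrite ltnS => le_in.
by rewrite -IHn ?i0//= nth_rcons size_s prednK// le_in.
Qed.

Let one_block_NC n : (0 < n)%N -> [set [set: 'I_n]] \in NC n.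
Proof.
move=> n0; rewrite inE; apply/andP; split; last first.
  apply/forall_inP => V /set1P->; apply/forall_inP => W /set1P->.
  by do 4!(apply/forall_inP => ? _); apply/implyP.
rewrite /finset.partition /finset.cover big_set1 eqxx finset.trivIset1 inE eq_sym -card_gt0.
by rewrite cardsT card_ord n0.
Qed.

Let block_card n (P : {set {set 'I_n}}) V : P \in NC n ->
  P != [set [set: 'I_n]] -> V \in P -> (0 < #|V| < n)%N.
Proof.
rewrite inE => /andP[/and3P[/eqP cP tP n0] _] P1 VP.
have V0 U : U \in P -> (0 < #|U|)%N.
  by move=> UP; rewrite card_gt0; apply: contraNneq n0 => <-.
rewrite V0//= ltn_neqAle -[X in (_ <= X)%N](card_ord n) max_card andbT.
apply: contraNneq P1 => cV.
have VT : V = [set: 'I_n].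
  by apply/eqP; rewrite eqEcard finset.subsetT cardsT card_ord cV leqnn.
rewrite finset.eqEsubset finset.sub1set -VT VP andbT.
apply/fintype.subsetP => U UP.
rewrite inE; apply/eqP/esym; apply: contraTeq (V0 _ UP) => VU.
have := finset.trivIsetP tP _ _ VP UP VU.
by rewrite -finset.setI_eq0 VT finset.setTI => /eqP->; rewrite cards0.
Qed.

Lemma moment_cumulant n : (0 < n)%N ->
  moment mu n = \sum_(P in NC n) \prod_(V in P) k #|V|.
Proof.
move=> n0; rewrite (bigD1 [set [set: 'I_n]]) ?one_block_NC//= big_set1.
rewrite cardsT card_ord -[moment mu n](subrK
  (\sum_(P in NC n | P != [set [set: 'I_n]]) \prod_(V in P) k #|V|)).
congr (_ + _); rewrite /free_cumulant.
case: n n0 => // n _ /=; rewrite nth_rcons size_s ltnn eqxx.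
congr (_ - _); apply: eq_bigr => P /andP[PNC P1]; apply: eq_bigr => V VP.
by apply/esym/nth_s; exact: block_card PNC P1 VP.
Qed.

Lemma moment_cumulant_unique (k' : nat -> R) :
    (forall n, (0 < n)%N ->
      moment mu n = \sum_(P in NC n) \prod_(V in P) k' #|V|) ->
  forall n, (0 < n)%N -> k' n = k n.
Proof.
move=> mk'; elim/ltn_ind => n IHn n0.
have := moment_cumulant n0; rewrite (mk' _ n0).
rewrite !(bigD1 [set [set: 'I_n]] (one_block_NC n0))/= !big_set1.
rewrite cardsT card_ord [in RHS](eq_bigr (fun P : {set {set 'I_n}} =>
  \prod_(V in P) k' #|V|)) => [/addIr//|P /andP[PNC P1]].
apply: eq_bigr => V /(block_card PNC P1)/andP[V0 Vn].
by rewrite IHn.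
Qed.

End moment_cumulant.

Local Open Scope classical_set_scope.

Definition finite_moments (R : realType) (mu : Rmeasure R) : Prop :=
  forall n, mu.-integrable setT (fun x => (x ^+ n)%:E).

Definition homothety (R : realType) (c : R) :
  measurableTypeR R -> measurableTypeR R := fun x => c * x.

Lemma measurable_homothety (R : realType) (c : R) :
  measurable_fun setT (homothety c).
Proof. exact: measurable_funM. Qed.

HB.instance Definition _ (R : realType) (c : R) :=
  isMeasurableFun.Build _ _ _ _ (homothety c) (measurable_homothety c).

(* [distribution] is the pushforward, as a probability measure. *)
Definition dilation (R : realType) (c : R) (mu : Rprobability R) :
  Rprobability R := distribution mu (homothety c).

Definition hankel (R : realType) (mu : Rmeasure R) (N : nat) : 'M[R]_N.+1 :=
  \matrix_(i < N.+1, j < N.+1) free_cumulant mu (i + j + 2).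

Definition hankel_det (R : realType) (mu : Rmeasure R) (N : nat) : R :=
  \det (hankel mu N).

Section density_measure.
Variables (R : realType) (f : R -> R).
Hypotheses (f0 : forall x, 0 <= f x) (mf : measurable_fun setT f).

Lemma density_semi_sigma_additive : semi_sigma_additive
  (fun A : set (measurableTypeR R) =>
    (\int[lebesgue_measure]_(x in A) (f x)%:E)%E).
Proof.
move=> /= F mF tF mUF; apply: cvg_toP.
  apply: ereal_nondecreasing_is_cvgn => m n mn.
  apply: lee_sum_nneg_natr => // i _ _; apply: integral_ge0 => x _.
  by rewrite lee_fin.
rewrite ge0_integral_bigcup//=.
- by apply/measurable_funTS/measurableT_comp.
- by move=> x _; rewrite lee_fin.
Qed.

End density_measure.

Section beta.
Variables (R : realType) (p q : R).

Definition euler_beta : R :=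
  \int[lebesgue_measure]_(x in `]0, 1[) (x `^ (p - 1) * (1 - x) `^ (q - 1)).

Definition beta_density : R -> R :=
  (fun x => x `^ (p - 1) * (1 - x) `^ (q - 1) / euler_beta) \_ `]0, 1[.

Lemma beta_density_ge0 x : 0 <= beta_density x.
Proof.
apply: restrict_ge0 => {}x _; rewrite divr_ge0 ?mulr_ge0 ?powR_ge0//.
by apply: Rintegral_ge0 => y _; rewrite mulr_ge0 ?powR_ge0.
Qed.

Lemma measurable_beta_density : measurable_fun setT beta_density.
Proof.
apply/measurable_restrict => //; apply: measurable_funTS.
apply: measurable_funM => //; apply: measurable_funM => //.
apply: (measurableT_comp (measurable_powR (q - 1))).
exact: measurable_funB.
Qed.

(* A measure for all real p and q, so that q -> +oo makes sense; it is a     *)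
(* probability measure only for p, q > 0, and likewise for gamma_dist.       *)
Definition beta_dist (A : set (measurableTypeR R)) : \bar R :=
  (\int[lebesgue_measure]_(x in A) (beta_density x)%:E)%E.

Let beta_dist0 : beta_dist set0 = 0%E.
Proof. by rewrite /beta_dist integral_set0. Qed.

Let beta_dist_ge0 A : (0 <= beta_dist A)%E.
Proof. by apply: integral_ge0 => x _; rewrite lee_fin beta_density_ge0. Qed.

Let beta_dist_semi_sigma_additive : semi_sigma_additive beta_dist.
Proof.
exact: (density_semi_sigma_additive beta_density_ge0 measurable_beta_density).
Qed.

HB.instance Definition _ := isMeasure.Build _ _ _ beta_dist
  beta_dist0 beta_dist_ge0 beta_dist_semi_sigma_additive.

End beta.

Section gamma.
Variables (R : realType) (p : R).

Definition euler_gamma : R :=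
  \int[lebesgue_measure]_(x in `]0, +oo[) (x `^ (p - 1) * expR (- x)).

Definition gamma_density : R -> R :=
  (fun x => x `^ (p - 1) * expR (- x) / euler_gamma) \_ `]0, +oo[.

Lemma gamma_density_ge0 x : 0 <= gamma_density x.
Proof.
apply: restrict_ge0 => {}x _; rewrite divr_ge0 ?mulr_ge0 ?powR_ge0 ?expR_ge0//.
by apply: Rintegral_ge0 => y _; rewrite mulr_ge0 ?powR_ge0 ?expR_ge0.
Qed.

Lemma measurable_gamma_density : measurable_fun setT gamma_density.
Proof.
apply/measurable_restrict => //; apply: measurable_funTS.
apply: measurable_funM => //; apply: measurable_funM => //.
exact: measurableT_comp.
Qed.

Definition gamma_dist (A : set (measurableTypeR R)) : \bar R :=
  (\int[lebesgue_measure]_(x in A) (gamma_density x)%:E)%E.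

Let gamma_dist0 : gamma_dist set0 = 0%E.
Proof. by rewrite /gamma_dist integral_set0. Qed.

Let gamma_dist_ge0 A : (0 <= gamma_dist A)%E.
Proof. by apply: integral_ge0 => x _; rewrite lee_fin gamma_density_ge0. Qed.

Let gamma_dist_semi_sigma_additive : semi_sigma_additive gamma_dist.
Proof.
exact: (density_semi_sigma_additive gamma_density_ge0 measurable_gamma_density).
Qed.

HB.instance Definition _ := isMeasure.Build _ _ _ gamma_dist
  gamma_dist0 gamma_dist_ge0 gamma_dist_semi_sigma_additive.

End gamma.

(* Free additive convolution of arbitrary probability measures on the line is *)
(* defined analytically, following Bercovici and Voiculescu: it is the        *)
(* operation that linearizes the Voiculescu transform.                        *)

Definition cauchy_transform (R : realType) (mu : Rmeasure R) (z : R[i]) : R[i] :=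
  (\int[mu]_x (complex.Re ((z - x%:C)^-1)))
    +i* (\int[mu]_x (complex.Im ((z - x%:C)^-1))).

Definition F_transform (R : realType) (mu : Rmeasure R) (z : R[i]) : R[i] :=
  (cauchy_transform mu z)^-1.

Definition truncated_cone (R : realType) (a b : R) : set R[i] :=
  [set z | b < complex.Im z /\ `|complex.Re z| < a * complex.Im z].

(* phi(z) = F^-1(z) - z on some truncated cone, where F^-1 is the right        *)
(* inverse of F with values in a truncated cone on which F is injective.  Two  *)
(* such functions coincide on some truncated cone, and the values of phi       *)
(* outside truncated cones are irrelevant.                                     *)
Definition voiculescu_transform (R : realType) (mu : Rmeasure R)
    (phi : R[i] -> R[i]) : Prop :=
  exists a b a' b' : R, [/\ [/\ 0 < a, 0 < b, 0 < a' & 0 < b'],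
    {in truncated_cone a b &, injective (F_transform mu)} &
    forall z, truncated_cone a' b' z ->
      truncated_cone a b (z + phi z) /\ F_transform mu (z + phi z) = z].

(* rho = mu [+] nu *)
Definition free_convolution (R : realType) (mu nu rho : Rmeasure R) : Prop :=
  exists phi psi : R[i] -> R[i],
    [/\ voiculescu_transform mu phi, voiculescu_transform nu psi &
        voiculescu_transform rho (fun z => phi z + psi z)].

(* rho is the n-fold free convolution power of nu; the 0-fold power is the    *)
(* Dirac mass at 0, the neutral element of the free convolution.              *)
Fixpoint free_convolution_power (R : realType) (nu : Rprobability R) (n : nat)
    (rho : Rmeasure R) : Prop :=
  if n is n'.+1 then
    exists2 sigma : Rprobability R,
      free_convolution_power nu n' sigma & free_convolution sigma nu rho
  else forall A, measurable A -> rho A = \d_(0 : measurableTypeR R) A.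

Definition freely_infinitely_divisible (R : realType) (mu : Rmeasure R) : Prop :=
  forall n, (1 <= n)%N ->
    exists nu : Rprobability R, free_convolution_power nu n mu.

(* Main.v *)
(* If [mu] is freely infinitely divisible, then for every [n >= 1] it is a free
   convolution power [nu_n ^ n] of a probability measure [nu_n], whose Voiculescu transform
   is that of [mu] divided by [n].  All moments of [mu] being finite, its Cauchy
   transform has an asymptotic expansion to all orders at infinity, and inverting it
   yields an expansion of the Cauchy transform of [nu_n], whose coefficients are the
   moments attached to the free cumulants [kappa_j / n].  By the Hamburger-Nevanlinna
   theorem they are the moments of [nu_n], so the matrix of the moments of order [i + j + 2]
   of [nu_n] is positive semidefinite; multiplied by [n], it tends to the Hankel matrix
   of the free cumulants of [mu], whose determinant is thus nonnegative.

   The limit statement follows from homogeneity and continuity of the free cumulants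
   in the moments, as [q ^ n m_n(beta_{p,q})] is the product of the
   [q (p + i) / (p + q + i)], which tends to that of the [p + i], namely [m_n(gamma_p)]. *)

(* The link between the combinatorial definition of free cumulants and Cauchy transforms is the
   functional equation [C(X M(X)) = M(X)] of the cumulant series [C] and the moment series [M]. It
   is extracted from noncrossing partitions by removing the elements of the block of the minimum one
   at a time, a recursion in two indices: the length of an interval and the number of elements
   already removed.

   A Voiculescu transform is only determined near infinity, on cones that its definition leaves
   unspecified, and each factor of a convolution power brings new transforms. Identities are
   therefore stated along the filter [cone_infty], and all series are polynomials truncated at order
   [K] with explicit error bounds.

   Nothing is known beforehand about the moments of a free convolution root. The expansion along the
   imaginary axis bounds integrals damped by a kernel that increases to 1, so monotone convergence
   makes the even moments finite one after the other; the odd ones are dominated by even ones. *)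
Require Import Defs.
From mathcomp Require Import all_boot all_order all_algebra.
From mathcomp Require Import zify.

Set Implicit Arguments.
Unset Strict Implicit.
Unset Printing Implicit Defensive.

Import GRing.Theory.

Local Open Scope ring_scope.

(** * Noncrossing partitions *)

(* [lia] is slow on boolean hypotheses about sets, so they are cleared first. *)
Ltac order_lia := repeat match goal with H : ?T |- _ => lazymatch T with
  | is_true (leq _ _) => fail | is_true (andb (leq _ _) (leq _ _)) => fail
  | @eq nat _ _ => fail | _ => clear H end end; lia.

Section NoncrossingIntervals.
Variable N : nat.
Implicit Types (D V W : {set 'I_N}) (P : {set {set 'I_N}}).

(** Partitions of a subset [D] of one fixed ordinal type: the recursion below cuts intervals into
    smaller ones, and staying inside ['I_N] avoids renumbering. That [N] is immaterial is recovered
    in [interval_sum_shift]. *)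
Definition is_ncpart D P :=
  [/\ forall V, V \in P -> V != set0 /\ V \subset D,
      forall y, y \in D -> exists2 V, V \in P & y \in V,
      forall V W y, V \in P -> W \in P -> y \in V -> y \in W -> V = W &
      forall V W a b c d, V \in P -> W \in P -> a \in V -> b \in W ->
        c \in V -> d \in W -> (a < b)%N -> (b < c)%N -> (c < d)%N -> V = W].

Definition ncpart D := [set P | finset.partition P D & noncrossing P].

Lemma ncpartP D P : reflect (is_ncpart D P) (P \in ncpart D).
Proof.
rewrite inE; apply: (iffP andP) => [[/and3P[/eqP cP /finset.trivIsetP tP n0] nc]|].
  split=> [V VP|y|V W y VP WP yV yW|V W a b c d VP WP aV bW cV dW ab bc cd].
  - by split; [apply: contraNneq n0 => <-|rewrite -cP finset.bigcup_sup].
  - by rewrite -cP => /finset.bigcupP[V VP yV]; exists V.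
  - apply/eqP; apply: contraTT yV => /(tP _ _ VP WP)/disjoint_setI0/setP/(_ y).
    by rewrite !inE yW andbT => ->.
  - move: nc => /forall_inP/(_ V VP)/forall_inP/(_ W WP)/forall_inP/(_ a aV).
    move=> /forall_inP/(_ b bW)/forall_inP/(_ c cV)/forall_inP/(_ d dW).
    by rewrite ab bc cd => /eqP.
move=> [ne cov tr nc]; split; last first.
  apply/forall_inP => V VP; apply/forall_inP => W WP; apply/forall_inP => a aV.
  apply/forall_inP => b bW; apply/forall_inP => c cV; apply/forall_inP => d dW.
  by apply/implyP => /and3P[ab bc cd]; apply/eqP/(nc V W a b c d).
apply/and3P; split.
- rewrite eqEsubset; apply/andP; split.
    by apply/finset.bigcupsP => V /ne[].
  by apply/subsetP => y /cov[V VP yV]; apply/finset.bigcupP; exists V.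
- apply/finset.trivIsetP => V W VP WP; apply: contraNT => /pred0Pn[y /andP[yV yW]].
  by rewrite (tr V W y).
- by apply/negP => /ne[]; rewrite eqxx.
Qed.

Definition itv a b : {set 'I_N} := [set i : 'I_N | (a <= i < b)%N].

(** The block containing [a], as a union so as to be total: it is empty when no block contains [a].
    The argument is a natural number because [a] may be the right end of an interval, possibly
    [N]. *)
Definition blk P (a : nat) :=
  \bigcup_(V in P | [exists i in V, val i == a]) V.

Lemma blkE D P (V : {set 'I_N}) (i : 'I_N) : is_ncpart D P -> V \in P -> i \in V ->
  blk P i = V.
Proof.
move=> [_ _ tr _] VP iV; apply/setP => y; apply/finset.bigcupP/idP.
  move=> [W /andP[WP /existsP[j /andP[jW /eqP/val_inj ji]]] yW].
  by rewrite (tr V W i) // -ji.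
move=> yV; exists V => //; rewrite VP; apply/existsP; exists i.
by rewrite iV eqxx.
Qed.

Lemma blk0 D P a : is_ncpart D P -> (forall i : 'I_N, val i = a -> i \notin D) ->
  blk P a = set0.
Proof.
move=> [ne _ _ _] nD; apply: big1 => V /andP[VP /existsP[i /andP[iV /eqP ia]]].
have [_ /subsetP/(_ i iV)] := ne _ VP.
by rewrite (negPf (nD _ ia)).
Qed.

Lemma itvn a : itv a a = set0.
Proof. by apply/setP => i; rewrite !inE; case: leqP => //=; rewrite ltnNge => ->. Qed.

Lemma ncpart0 P : is_ncpart set0 P -> P = set0.
Proof.
move=> [ne _ _ _]; apply/setP => V; rewrite inE; apply/negP => /ne[].
by rewrite subset0 => /negPf ->.
Qed.

Lemma is_ncpart0 : is_ncpart set0 set0.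
Proof. by split=> [V|y|V W y|V W a b c d]; rewrite inE. Qed.

Lemma blkn0 D P a : is_ncpart D P -> blk P a != set0 ->
  exists2 i : 'I_N, val i = a & i \in blk P a /\ blk P a \in P.
Proof.
move=> ncP /set0Pn[y /finset.bigcupP[V /andP[VP /existsP[i /andP[iV /eqP ia]]] yV]].
by exists i => //; rewrite -ia (blkE ncP VP iV).
Qed.

(* Splitting the block V_0 of the minimum [x = a] of [a, b) at its second element [j]
   ([j = b] when V_0 = {x}): noncrossing partitions of [a+1, j) and of [j, b) are
   glued by adding [x] to the block of [j]. *)
Definition glue (x : 'I_N) j (PP : {set {set 'I_N}} * {set {set 'I_N}}) :=
  (x |: blk PP.2 j) |: (PP.1 :|: PP.2 :\ blk PP.2 j).

Definition unglue (x : 'I_N) j P :=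
  ([set V in P | V \subset itv x.+1 j],
   [set V :\ x | V in P & ~~ (V \subset itv x.+1 j)] :\ set0).

Section Glue.
Variables (x : 'I_N) (j b : nat).
Hypothesis xj : (x < j)%N.
Hypothesis jb : (j <= b)%N.
Hypothesis bN : (b <= N)%N.

(** The value [j = b] encodes that [x] is alone in its block, since a partition of [itv x b] has no
    element beyond [b]. *)
Definition second P := 
  [/\ forall y, y \in blk P x -> y != x -> (j <= y)%N &
      (j < b)%N -> exists2 y, y \in blk P x & val y = j].

Let A := itv x.+1 j.
Let B := itv j b.
Let xA : x \notin A. Proof. by rewrite inE ltnn. Qed.
Let xB : x \notin B. Proof. by rewrite inE leqNgt xj. Qed.
Let AB y : y \in A -> y \in B -> False.
Proof. by rewrite !inE => /andP[_ yj] /andP[]; rewrite leqNgt yj. Qed.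

Lemma mem_itvS y : (y \in itv x b) = [|| y == x, y \in A | y \in B].
Proof.
rewrite !inE -val_eqE /=; order_lia.
Qed.

Section Gluing.
Variables P1 P2 : {set {set 'I_N}}.
Hypotheses (nc1 : is_ncpart A P1) (nc2 : is_ncpart B P2).
Let W := blk P2 j.
Let G := glue x j (P1, P2).

Let P1A V y : V \in P1 -> y \in V -> (x < y < j)%N.
Proof.
case: nc1 => ne _ _ _ /ne[_ /subsetP VA] /VA; by rewrite inE.
Qed.

Let P2B V y : V \in P2 -> y \in V -> (j <= y < b)%N.
Proof.
case: nc2 => ne _ _ _ /ne[_ /subsetP VA] /VA; by rewrite inE.
Qed.

Let WP y : y \in W -> W \in P2 /\ exists2 i : 'I_N, val i = j & i \in W.
Proof.
move=> yW; have [|i ij [iW WP2]] := @blkn0 _ _ j nc2.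
  by apply/set0Pn; exists y.
by split => //; exists i.
Qed.

Let xW : x \notin W.
Proof.
apply/negP => /[dup] xW /WP[WP2 _]; have := P2B WP2 xW; order_lia.
Qed.

Let gluePV V : V \in G -> [\/ V = x |: W, V \in P1 | V \in P2 /\ V != W].
Proof.
rewrite /G /glue inE in_set1 in_setU in_setD1 /=.
case/or3P => [/eqP->|->|/andP[VW VP]]; [exact: Or31|exact: Or32|exact: Or33].
Qed.

Let xWG : x |: W \in G. Proof. by rewrite setU11. Qed.
Let P1G V : V \in P1 -> V \in G.
Proof. by move=> VP; rewrite /G /glue !in_setU VP orbT. Qed.
Let P2G V : V \in P2 -> V != W -> V \in G.
Proof. by move=> VP VW; rewrite /G /glue !in_setU in_setD1 VP VW !orbT. Qed.

(** Blocks of [P1] and [P2] lie in separate intervals, so only the enlarged block [x |: W] could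
    create a new crossing, with a block of [P2]. *)
Lemma glue_is_ncpart : is_ncpart (itv x b) G.
Proof.
case: (nc1) => ne1 cov1 tr1 cr1; case: (nc2) => ne2 cov2 tr2 cr2.
split.
- move=> V /gluePV[->|VP|[VP _]].
  + split; first by apply/set0Pn; exists x; rewrite setU11.
    apply/subsetP => y /setU1P[->|/[dup] yW /WP[WP2 _]].
      by rewrite mem_itvS eqxx.
    by have := P2B WP2 yW; rewrite inE; order_lia.
  + split; first by case: (ne1 _ VP).
    by apply/subsetP => y /(P1A VP); rewrite inE; order_lia.
  + split; first by case: (ne2 _ VP).
    by apply/subsetP => y /(P2B VP); rewrite inE; order_lia.
- move=> y; rewrite mem_itvS => /or3P[/eqP->|/cov1[V VP yV]|/cov2[V VP yV]].
  + by exists (x |: W); rewrite ?xWG ?setU11.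
  + by exists V => //; apply: P1G.
  + have [VW|VW] := eqVneq V W; last by exists V => //; apply: P2G.
    by exists (x |: W) => //; rewrite -VW inE yV orbT.
- have aux V y : V \in P1 \/ V \in P2 /\ V != W -> y \in V -> y \in x |: W -> False.
    move=> [VP|[VP VW]] yV /setU1P[yx|yW].
    + have := P1A VP yV; rewrite yx; order_lia.
    + have := P1A VP yV; have [WP2 _] := WP yW; have := P2B WP2 yW; order_lia.
    + have := P2B VP yV; rewrite yx; order_lia.
    + by have [WP2 _] := WP yW; move/eqP: VW; apply; apply: tr2 yV yW.
  move=> V V' y /gluePV[->|VP|[VP VW]] /gluePV[->|VP'|[VP' VW']] // yV yV'.
  + by case: (aux V' y) => //; left.
  + by case: (aux V' y) => //; right.
  + by case: (aux V y) => //; left.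
  + exact: tr1 yV yV'.
  + have := P1A VP yV; have := P2B VP' yV'; order_lia.
  + by case: (aux V y) => //; right.
  + have := P2B VP yV; have := P1A VP' yV'; order_lia.
  + exact: tr2 yV yV'.
- move=> V V' i k l m /gluePV[->|VP|[VP VW]] /gluePV[->|VP'|[VP' VW']] //.
  + move=> _ /(P1A VP') ? /setU1P[->|/[dup] lW /WP[WP2 _]] /(P1A VP') ?; first order_lia.
    have := P2B WP2 lW; order_lia.
  + move=> iW /[dup] kV' /(P2B VP') kB /setU1P[->|lW] mV' ik kl lm; first order_lia.
    (* The point [i] may be [x], which [P2] does not see. It is replaced by [j], which lies in [W]
       and is the least point of [[j, b)]: either [j < k] and the crossing is one of [P2], or
       [k = j] and the blocks meet. *)
    have [WP2 [i0 i0j i0W]] := WP lW.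
    have [i0k|ki0] := ltnP i0 k; last first.
      have ki : k = i0 by apply: val_inj => /=; move: kB ki0 i0j; rewrite /=; order_lia.
      by move/eqP: VW'; case; apply: (tr2 _ _ k) => //; rewrite ki.
    by move/eqP: VW'; case; apply/esym; apply: (cr2 W V' i0 k l m).
  + move=> /(P1A VP) ? kW /(P1A VP) ? _ ik kl _.
    case/setU1P: kW => [ekx|kW]; first by move: ik; rewrite ekx; order_lia.
    have [WP2 _] := WP kW; have := P2B WP2 kW; order_lia.
  + exact: cr1.
  + by move=> /(P1A VP) ? /(P2B VP') ? /(P1A VP) ?; order_lia.
  + move=> /[dup] iV /(P2B VP) ? kW lV mW ik kl lm.
    have {}kW : k \in W by case/setU1P: kW => // ekx; move: ik; rewrite ekx; order_lia.
    have {}mW : m \in W by case/setU1P: mW => // emx; move: lm kl ik; rewrite emx; order_lia.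
    have [WP2 _] := WP kW.
    by move/eqP: VW; case; apply: (cr2 V W i k l m).
  + by move=> /(P2B VP) ? /(P1A VP') ? _ _; order_lia.
  + exact: cr2.
Qed.

Lemma blk_glue : blk G x = x |: W.
Proof. by rewrite (blkE glue_is_ncpart xWG) // setU11. Qed.

Lemma glue_second : second G.
Proof.
split; rewrite blk_glue.
  move=> y /setU1P[->|/[dup] yW /WP[WP2 _] _]; first by rewrite eqxx.
  by have := P2B WP2 yW; order_lia.
move=> jltb; have [_ cov2 _ _] := nc2.
have jN : (j < N)%N by order_lia.
have [|V VP jV] := cov2 (Ordinal jN).
  by rewrite inE /=; order_lia.
exists (Ordinal jN) => //; rewrite inE; apply/orP; right.
by rewrite /W (blkE (i := Ordinal jN) nc2 VP jV).
Qed.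

Lemma glueK : unglue x j G = (P1, P2).
Proof.
have [ne1 cov1 _ _] := nc1; have [ne2 cov2 tr2 _] := nc2.
congr pair; apply/setP => V; apply/idP/idP.
- rewrite inE => /andP[/gluePV[->|//|[VP _]]].
    by move=> /subsetP/(_ x); rewrite setU11 (negPf xA) => /(_ isT).
  move=> /subsetP VA; have [/set0Pn[y yV] _] := ne2 _ VP.
  by case: (AB (VA _ yV)); case: (ne2 _ VP) => _ /subsetP; apply.
- by move=> VP; rewrite inE P1G //; case: (ne1 _ VP).
- rewrite in_setD1 => /andP[V0 /imsetP[U]]; rewrite inE => /andP[UG UA] VU.
  have [UE|UP|[UP UW]] := gluePV UG.
  + move: V0; rewrite VU UE setU1K // => /set0Pn[y /WP[]//].
  + by case: (ne1 _ UP); rewrite (negPf UA).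
  + suff -> : V = U by [].
    apply/setP => y; rewrite VU in_setD1; case: eqP => //= ->.
    by apply/esym/negP => /(P2B UP); order_lia.
- move=> VP; have [V0 VB] := ne2 _ VP; rewrite in_setD1 V0 /=.
  apply/imsetP; have [VW|VW] := eqVneq V W.
    exists (x |: W); last by rewrite setU1K.
    rewrite inE xWG; apply/negP => /subsetP/(_ x); rewrite setU11 (negPf xA).
    by move/(_ isT).
  exists V.
    rewrite inE P2G //=; apply/negP => /subsetP VA.
    have /set0Pn[y yV] := V0; apply: (AB (VA _ yV)).
    by move/subsetP: VB; apply.
  apply/setP => y; rewrite in_setD1; case: eqP => //= ->.
  by apply/negP => /(P2B VP); order_lia.
Qed.

End Gluing.

Section Ungluing.
Variable P : {set {set 'I_N}}.
Hypotheses (ncP : is_ncpart (itv x b) P) (secP : second P).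
Let V0 := blk P x.
Let P1 := (unglue x j P).1.
Let P2 := (unglue x j P).2.

Let xb : x \in itv x b. Proof. by rewrite mem_itvS eqxx. Qed.

Let V0P : V0 \in P /\ x \in V0.
Proof. by have [_ /(_ x xb)[V VP xV] _ _] := ncP; rewrite /V0 (blkE ncP VP xV). Qed.

(** A block avoiding [x] with a point [y] in [A] and a point [z] in [B] would either contain [j],
    hence be [V0], or cross [V0] at [x < y < j < z]. This is where noncrossing makes the two sides
    independent. *)
Let PA V : V \in P -> [\/ V = V0, V \subset A | V \subset B /\ x \notin V].
Proof.
move=> VP; have [ne _ tr cr] := ncP.
have [V0P' xV0] := V0P.
have [xV|xV] := boolP (x \in V); first by apply: Or31; apply: (tr _ _ x).
have VxS y : y \in V -> (y \in A) || (y \in B).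
  move=> yV; have [_ /subsetP/(_ y yV)] := ne _ VP.
  by rewrite mem_itvS => /or3P[/eqP yx|->//|->]; [rewrite -yx yV in xV|rewrite orbT].
have [VA|/subsetPn[z zV zA]] := boolP (V \subset A); first exact: Or32.
apply: Or33; split=> //; apply/subsetP => y yV.
have := VxS _ yV; have := VxS _ zV; rewrite (negPf zA) /= => zB /orP[yA|//].
have [jltb|] := ltnP j b; last by move: zB; rewrite inE; order_lia.
have [s1 /(_ jltb)[i iV0 ij]] := secP.
move: zB yA; rewrite !inE => zB yA.
have [iz|] := ltnP i z; last first.
  rewrite leq_eqVlt => /orP[/eqP/val_inj zi|]; last by rewrite /= in ij *; order_lia.
  by rewrite zi in zV; rewrite (tr V V0 i) ?xV0 in xV.
rewrite /= in ij.
have yi : (y < i)%N by order_lia.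
have xy : (x < y)%N by order_lia.
by rewrite -(cr V0 V x y i z) ?xV0 in xV.
Qed.

Let V0x : V0 :\ x \subset B.
Proof.
apply/subsetP => y /setD1P[yx yV0]; have [V0P' _] := V0P.
have [ne _ _ _] := ncP; have [_ /subsetP/(_ y yV0)] := ne _ V0P'.
rewrite mem_itvS => /or3P[/eqP yx'|yA|//]; first by rewrite yx' eqxx in yx.
by have [/(_ y yV0 yx)] := secP; move: yA; rewrite inE; order_lia.
Qed.

Let P1P V : V \in P1 -> V \in P /\ V \subset A.
Proof. by rewrite inE => /andP. Qed.

Let P2P V : V \in P2 -> V != set0 /\
  exists2 U, U \in P /\ ~~ (U \subset A) & V = U :\ x /\ (U = V0 \/ U = V /\ U != V0).
Proof.
rewrite in_setD1 => /andP[Vn0 /imsetP[U]]; rewrite inE => /andP[UP UA] VU.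
split=> //; exists U => //; split=> //.
have [->|UA'|[UB xU]] := PA UP; [by left|by rewrite UA' in UA|right].
split; last by apply: contraNneq xU => ->; case: V0P.
by rewrite VU; apply/setP => y; rewrite in_setD1; case: eqP => // ->; rewrite (negPf xU).
Qed.

Lemma unglue1_is_ncpart : is_ncpart A P1.
Proof.
have [ne cov tr cr] := ncP; split.
- by move=> V /P1P[VP VA]; case: (ne _ VP).
- move=> y yA; have [|V VP yV] := cov y; first by rewrite mem_itvS yA orbT.
  exists V => //; rewrite inE VP /=; have [VE|//|[/subsetP/(_ _ yV) yB _]] := PA VP.
    have := V0x; move=> /subsetP/(_ y); rewrite in_setD1 -VE yV andbT.
    case: eqP => [yx|_ /(_ isT) yB]; last by case: (AB yA yB).
    by move: yA; rewrite yx (negPf xA).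
  by case: (AB yA yB).
- by move=> V W y /P1P[VP _] /P1P[WP _]; apply: tr.
- by move=> V W i k l m /P1P[VP _] /P1P[WP _]; apply: cr.
Qed.

Lemma unglue2_is_ncpart : is_ncpart B P2.
Proof.
have [ne cov tr cr] := ncP; split.
- move=> V /P2P[Vn0 [U [UP UA] [VU [UE|[UV UV0]]]]]; split=> //.
    by rewrite VU UE V0x.
  have [/eqP|UA'|[UB _]] := PA UP; first by rewrite (negPf UV0).
    by rewrite UA' in UA.
  by rewrite -UV.
- move=> y yB; have [|V VP yV] := cov y; first by rewrite mem_itvS yB !orbT.
  have yx : y != x by apply: contraTneq yB => ->.
  have yVx : y \in V :\ x by rewrite in_setD1 yx.
  exists (V :\ x) => //; rewrite in_setD1; apply/andP; split.
    by apply/set0Pn; exists y.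
  apply/imsetP; exists V => //; rewrite inE VP; apply/negP => /subsetP/(_ _ yV) yA.
  exact: AB yA yB.
- move=> V W y /P2P[_ [V' [VP _] [-> _]]] /P2P[_ [W' [WP _] [-> _]]].
  by move=> /setD1P[_ yV] /setD1P[_ yW]; rewrite (tr V' W' y).
- move=> V W i k l m /P2P[_ [V' [VP _] [-> _]]] /P2P[_ [W' [WP _] [-> _]]].
  move=> /setD1P[_ iV] /setD1P[_ kW] /setD1P[_ lV] /setD1P[_ mW] ik kl lm.
  by rewrite (cr V' W' i k l m).
Qed.

Lemma unglueK : glue x j (P1, P2) = P.
Proof.
have [ne cov tr cr] := ncP; have [V0P' xV0] := V0P.
have E : blk P2 j = V0 :\ x.
  have V0A : ~~ (V0 \subset A) by apply/negP => /subsetP/(_ _ xV0); rewrite (negPf xA).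
  have [jltb|jb'] := ltnP j b.
    have [_ /(_ jltb)[i iV0 ij]] := secP.
    have iV : i \in V0 :\ x.
      rewrite in_setD1 iV0 andbT; apply/eqP => ix.
      by move: ij; rewrite ix => /= xj'; move: xj; rewrite xj' ltnn.
    rewrite -ij (blkE unglue2_is_ncpart _ iV) // in_setD1; apply/andP; split.
      by apply/set0Pn; exists i.
    by apply/imsetP; exists V0 => //; rewrite inE V0P'.
  rewrite (blk0 unglue2_is_ncpart); last first.
    by move=> i ij; rewrite inE ij; order_lia.
  apply/esym/eqP; rewrite -subset0; apply: subset_trans V0x _.
  by apply/subsetP => y; rewrite inE; order_lia.
apply/setP => V; rewrite /glue /= E setD1K // !in_setU in_set1 in_setD1.
apply/or3P/idP.
  case=> [/eqP ->//|/P1P[]//|/andP[VV /P2P[_ [U [UP _] [VU [UE|[<-//]]]]]]].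
  by rewrite VU UE eqxx in VV.
move=> VP; have [->|VA|[VB xV]] := PA VP; first exact: Or31.
  by apply: Or32; rewrite inE VP.
have [Vn0 _] := ne _ VP; have /set0Pn[y yV] := Vn0.
have VE : V = V :\ x.
  by apply/setP => z; rewrite in_setD1; case: eqP => // ->; rewrite (negPf xV).
apply: Or33; apply/andP; split.
  apply: contraNneq xV => VV0; rewrite (tr V V0 y) //.
  by move: yV; rewrite VV0 in_setD1 => /andP[].
rewrite in_setD1 Vn0 /=; apply/imsetP; exists V => //; rewrite inE VP.
apply/negP => /subsetP/(_ _ yV) yA; apply: (AB yA).
by move/subsetP: VB; apply.
Qed.
End Ungluing.

End Glue.

(** An unsuccessful [find] returns the length of the list, so [cut] is [b] exactly in the convention
    of [second] for a singleton block. *)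
Definition cut (x : 'I_N) b P :=
  (x.+1 + find (fun i => [exists y in blk P x, val y == i])
            (iota x.+1 (b - x.+1)))%N.

Lemma cut_itv (x : 'I_N) b P : (x < b)%N -> (x < cut x b P <= b)%N.
Proof.
move=> xb; rewrite /cut; have := find_size
  (fun i => [exists y in blk P x, val y == i]) (iota x.+1 (b - x.+1)).
rewrite size_iota; lia.
Qed.

Lemma cut_second (x : 'I_N) b P : (x < b)%N -> is_ncpart (itv x b) P ->
  second x (cut x b P) b P.
Proof.
move=> xb ncP; rewrite /cut; set p := fun i => _; set s := iota _ _.
have [ne cov _ _] := ncP.
have xI : x \in itv x b by rewrite inE leqnn.
have [V VP xV] := cov _ xI.
split=> [y yV yx|].
- have [yVP /subsetP/(_ y)] : blk P x != set0 /\ blk P x \subset itv x b.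
    by rewrite (blkE ncP VP xV); apply: ne.
  rewrite yV inE => /(_ isT) /andP[xy yb].
  rewrite leqNgt; apply/negP => yf.
  have {}yx : (x < y)%N by rewrite ltn_neqAle xy eq_sym andbT.
  have := @before_find _ 0%N p s (y - x.+1).
  rewrite /s nth_iota; last by order_lia.
  rewrite -/s subnKC // => /(_ _)/negbT/negP; apply; first by rewrite -(ltn_add2l x.+1) subnKC.
  by apply/existsP; exists y; rewrite yV eqxx.
- move=> fb; have hp : has p s.
    by rewrite has_find size_iota; order_lia.
  have := nth_find 0%N hp; rewrite nth_iota; last first.
    by move: hp; rewrite has_find size_iota.
  by move=> /existsP[y /andP[yV /eqP yE]]; exists y.
Qed.

Lemma second_cut (x : 'I_N) j b P : (x < j <= b)%N -> is_ncpart (itv x b) P ->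
  second x j b P -> cut x b P = j.
Proof.
move=> /andP[xj jb] ncP [s1 s2]; have xb := leq_trans xj jb.
have /andP[xc cb] := cut_itv P xb; have [c1 c2] := cut_second xb ncP.
apply/eqP; rewrite eqn_leq; apply/andP; split; rewrite leqNgt; apply/negP => lt.
- have [|y yV yj] := s2; first exact: leq_trans cb.
  have := c1 y yV; rewrite -val_eqE /= in yj *; rewrite yj.
  by move=> /(_ _); rewrite leqNgt lt; case: eqP => [|_ /(_ isT)//]; move: xj; order_lia.
- have [|y yV yj] := c2; first exact: leq_trans jb.
  have := s1 y yV; rewrite -val_eqE /= in yj *; rewrite yj.
  by move=> /(_ _); rewrite leqNgt lt; case: eqP => [|_ /(_ isT)//]; move: xc; order_lia.
Qed.

Variables (R : comNzRingType) (k : nat -> R).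
Hypothesis k0 : k 0%N = 1.

(** The parameter [s] counts points already removed from the block of [a] that still contribute to
    its size. On an empty interval the weight is [k s]. *)
Definition block_weight s a P :=
  k (s + #|blk P a|) * \prod_(V in P | V != blk P a) k #|V|.

Definition interval_sum a b s := \sum_(P in ncpart (itv a b)) block_weight s a P.

Lemma block_weight0 D a P : is_ncpart D P ->
  block_weight 0 a P = \prod_(V in P) k #|V|.
Proof.
move=> ncP; rewrite /block_weight add0n; have [b0|bn0] := eqVneq (blk P a) set0.
  rewrite b0 cards0 k0 mul1r; apply: eq_bigl => V; apply: andb_idr.
  by case: ncP => ne _ _ _ /ne[].
have [_ _ [_ bP]] := blkn0 ncP bn0.
by rewrite [RHS](bigD1 (blk P a)).
Qed.

Lemma interval_sumnn a s : interval_sum a a s = k s.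
Proof.
rewrite /interval_sum itvn (big_pred1 set0) => [|P]; last first.
  by apply/ncpartP/eqP => [/ncpart0|->]; last exact: is_ncpart0.
rewrite /block_weight [blk _ _]big1 => [|V]; last by rewrite inE.
by rewrite big1 => [|V]; rewrite ?inE // cards0 addn0 mulr1.
Qed.

Lemma block_weight_glue (x : 'I_N) j b s P1 P2 : (x < j)%N -> (j <= b)%N -> (b <= N)%N ->
  P1 \in ncpart (itv x.+1 j) -> P2 \in ncpart (itv j b) ->
  block_weight s x (glue x j (P1, P2)) = block_weight 0 x.+1 P1 * block_weight s.+1 j P2.
Proof.
move=> xj jb bN /ncpartP nc1 /ncpartP nc2; rewrite (block_weight0 _ nc1).
rewrite /block_weight (blk_glue xj jb bN nc1 nc2) /=.
have [ne1 cov1 tr1 _] := nc1; have [ne2 cov2 tr2 _] := nc2.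
have xP1 V : V \in P1 -> x \notin V.
  by move=> /ne1[_ /subsetP VA]; apply/negP => /VA; rewrite inE ltnn.
have xP2 V : V \in P2 -> x \notin V.
  by move=> /ne2[_ /subsetP VA]; apply/negP => /VA; rewrite inE leqNgt xj.
have xW : x \notin blk P2 j.
  by apply/negP => /bigcupP[V /andP[VP _]]; apply/negP/xP2.
rewrite cardsU1 xW mulrCA addSnnS; congr (_ * _).
have E V : (V \in glue x j (P1, P2)) && (V != x |: blk P2 j) =
    (V \in P1) || (V \in P2 :\ blk P2 j).
  rewrite /glue /= in_setU1 in_setU; case: eqVneq => //= [->|_]; last by rewrite andbT.
  apply/esym/negP => /orP[/xP1|/setD1P[_ /xP2]]; by rewrite setU11.
rewrite (eq_bigl _ _ E) (eq_bigl (mem [predU P1 & P2 :\ blk P2 j])); last first.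
  by move=> V; rewrite !inE.
rewrite bigU /=; last first.
  rewrite -setI_eq0; apply/eqP/setP => V; rewrite in_setI in_set0.
  apply/negP => /andP[VP1 /setD1P[_ VP2]].
  have [/set0Pn[y yV] /subsetP VA] := ne1 _ VP1; have [_ /subsetP VB] := ne2 _ VP2.
  by have := VA _ yV; have := VB _ yV; rewrite !inE; order_lia.
by congr (_ * _); apply: eq_bigl => V; rewrite in_setD1 andbC.
Qed.

(** Partitions are sorted by the second element [j] of the block of [x]. The points strictly between
    [x] and [j] form a partition of their own, and the block of [x] continues as that of [j], with
    [x] now recorded in the counter [s]. *)
Lemma interval_sum_rec (x : 'I_N) b s : (x < b <= N)%N ->
  interval_sum x b s =
  \sum_(x.+1 <= j < b.+1) interval_sum x.+1 j 0 * interval_sum j b s.+1.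
Proof.
move=> /andP[xb bN]; transitivity (\sum_(x.+1 <= j < b.+1)
    \sum_(P in ncpart (itv x b) | cut x b P == j) block_weight s x P).
  rewrite (exchange_big_dep (fun P => P \in ncpart (itv x b))) //=; last first.
    by move=> ? ? _ /andP[].
  apply: eq_bigr => P PD; under eq_bigl do rewrite PD /= eq_sym.
  by rewrite big_nat1_eq ltnS cut_itv.
apply: eq_big_nat => j /andP[xj jb]; rewrite ltnS in jb.
rewrite big_distrlr /= pair_big /=.
rewrite (reindex_onto (glue x j) (unglue x j)) /=; last first.
  move=> P /andP[/ncpartP ncP /eqP cP]; rewrite [unglue _ _ _]surjective_pairing.
  by apply: (unglueK xj jb bN) => //; rewrite -cP; apply: cut_second.
apply: eq_big => [[P1 P2] /=|[P1 P2] /= ].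
  apply/idP/idP => [|/andP[/ncpartP nc1 /ncpartP nc2]].
    move=> /andP[/andP[/ncpartP ncG /eqP cG] /eqP].
    have sG : second x j b (glue x j (P1, P2)) by rewrite -[X in second _ X]cG; exact: cut_second.
    move=> gE; have := unglue1_is_ncpart xj jb bN ncG sG; rewrite gE /=.
    have := unglue2_is_ncpart xj jb bN ncG sG; rewrite gE /=.
    by move=> /ncpartP-> /ncpartP->.
  rewrite (glueK xj jb bN nc1 nc2) eqxx andbT.
  have ncG := glue_is_ncpart xj jb bN nc1 nc2.
  have sG := glue_second xj jb bN nc1 nc2.
  by apply/andP; split; [apply/ncpartP|apply/eqP/second_cut => //; rewrite xj].
move=> /andP[/andP[/ncpartP ncG /eqP cG] /eqP].
have sG : second x j b (glue x j (P1, P2)) by rewrite -[X in second _ X]cG; exact: cut_second.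
move=> gE; have := unglue1_is_ncpart xj jb bN ncG sG; rewrite gE /=.
have := unglue2_is_ncpart xj jb bN ncG sG; rewrite gE /=.
by move=> /ncpartP nc2 /ncpartP nc1; apply: (block_weight_glue _ xj jb bN).
Qed.

End NoncrossingIntervals.

(** * The moment recursion and the functional equation of the series *)

Section MomentRecursion.
Variables (R : comNzRingType) (k : nat -> R).
Hypothesis k0 : k 0%N = 1.

Lemma interval_sum_recE N (x : 'I_N) b s : (x < b <= N)%N ->
  interval_sum N k x b s = \sum_(i < b - x)
    interval_sum N k x.+1 (x.+1 + i) 0 * interval_sum N k (x.+1 + i) b s.+1.
Proof.
move=> /[dup] /andP[xb bN] xbN; rewrite interval_sum_rec //.
rewrite -[x.+1 in LHS]add0n big_addn big_mkord subSS.
by apply: eq_bigr => i _; rewrite add0n addnC.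
Qed.

(** The recursion and its initial values involve only the length of the interval, neither its
    position nor the ambient [N]. *)
Lemma interval_sum_shift n N a b N' a' b' s :
  b = (a + n)%N -> b' = (a' + n)%N -> (b <= N)%N -> (b' <= N')%N ->
  interval_sum N k a b s = interval_sum N' k a' b' s.
Proof.
elim/ltn_ind: n N a b N' a' b' s => -[|n] IHn N a b N' a' b' s -> -> bN bN'.
  by rewrite !addn0 !interval_sumnn.
have aN : (a < N)%N by lia.
have aN' : (a' < N')%N by lia.
have := @interval_sum_recE N (Ordinal aN) (a + n.+1) s; rewrite /= => ->; last by lia.
have := @interval_sum_recE N' (Ordinal aN') (a' + n.+1) s; rewrite /= => ->; last by lia.
rewrite !addKn; apply: eq_bigr => i _; have := ltn_ord i => iN; congr (_ * _).
  by apply: (IHn i); lia.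
by apply: (IHn (n - i)%N); lia.
Qed.

Definition nc_sum n s := interval_sum n k 0 n s.

Lemma nc_sum0 s : nc_sum 0 s = k s.
Proof. exact: interval_sumnn. Qed.

(** Together with [nc_sum0], this says [T_s = k_s + X T_0 T_(s+1)] for the generating series [T_s]
    of the numbers [nc_sum n s], and [T_0] is the moment series. *)
Lemma nc_sumS n s :
  nc_sum n.+1 s = \sum_(i < n.+1) nc_sum i 0 * nc_sum (n - i) s.+1.
Proof.
have := @interval_sum_recE n.+1 ord0 n.+1 s; rewrite /nc_sum /= => ->; last by lia.
rewrite subn0; apply: eq_bigr => i _; have := ltn_ord i => iN; congr (_ * _).
  by apply: (interval_sum_shift (n := i)); lia.
by apply: (interval_sum_shift (n := (n - i)%N)); lia.
Qed.

Lemma nc_sumE n : nc_sum n 0 = \sum_(P in NC n) \prod_(V in P) k #|V|.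
Proof.
have iT : itv n 0 n = [set: 'I_n] by apply/setP => i; rewrite !inE ltn_ord.
rewrite /nc_sum /interval_sum iT; apply: eq_bigr => P /ncpartP.
exact: block_weight0.
Qed.

End MomentRecursion.

Lemma eq_coef_mod_Xn (R : comNzRingType) (p q : {poly R}) K :
  (forall i, (i < K)%N -> p`_i = q`_i) -> exists Q, p = q + 'X^K * Q.
Proof.
move=> pq; exists (drop_poly K (p - q)).
rewrite -[p in LHS](subrK q) addrC; congr (_ + _).
rewrite -[LHS](poly_take_drop K) mulrC -[RHS]add0r; congr (_ + _).
apply/polyP => i; rewrite coef_take_poly coef0; case: ifP => // iK.
by rewrite coefB pq // subrr.
Qed.

(* Truncated form of the functional equation [C(X M(X)) = M(X)] between the
   cumulant series [C] and the moment series [M]. *)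
Lemma moment_cumulant_series (R : comNzRingType) (k : nat -> R) K : k 0%N = 1 ->
  let M := \poly_(n < K) \sum_(P in NC n) \prod_(V in P) k #|V| in
  exists Q : {poly R},
    \sum_(s < K) k s *: ('X * M) ^+ s = M + 'X^K * Q.
Proof.
move=> k0 M; pose T s : {poly R} := \poly_(n < K) nc_sum k n s.
have ME : M = T 0%N.
  by apply/polyP => n; rewrite !coef_poly; case: ifP => // _; rewrite nc_sumE.
have step s : exists Q, (k s)%:P + 'X * M * T s.+1 = T s + 'X^K * Q.
  apply: eq_coef_mod_Xn => -[|n] nK; rewrite coefD coefC -mulrA coefXM coef_poly nK.
    by rewrite /= addr0 nc_sum0.
  rewrite /= add0r coefM nc_sumS //; apply: eq_bigr => i _.
  have iK : (i < K)%N by have := ltn_ord i; lia.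
  have niK : (n - i < K)%N by lia.
  by rewrite ME !coef_poly iK niK.
(* Iterating [T_s = k_s + X M T_(s+1)] from [s = 0] produces the powers of [X M] one by one. After
   [K] steps the remaining term carries the factor [X^K] and joins the error. *)
have telescope m : exists Q, \sum_(s < m) k s *: ('X * M) ^+ s + ('X * M) ^+ m * T m
    = M + 'X^K * Q.
  elim: m => [|m [Q IHm]]; first by exists 0; rewrite big_ord0 add0r mul1r mulr0 addr0.
  have [Q' stepm] := step m; exists (Q + ('X * M) ^+ m * Q').
  rewrite big_ord_recr /= mulrDr addrA -IHm -mul_polyC.
  rewrite [in RHS]mulrCA -!addrA; congr (_ + _); rewrite -mulrDr -stepm.
  by rewrite mulrDr [_%:P * _]mulrC exprSr !mulrA.
have [Q QE] := telescope K; exists (Q - M ^+ K * T K).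
by rewrite mulrBr addrA -QE exprMn -mulrA addrK.
Qed.

From mathcomp Require Import ring lra polyrcf complex.
From mathcomp Require Import all_classical all_reals all_analysis measurable_realfun.

Import Order.TTheory GRing.Theory Num.Theory.
Import numFieldNormedType.Exports.

Local Open Scope classical_set_scope.
Local Open Scope ring_scope.

(** * Free cumulants of a moment sequence *)

Section NoncrossingBlocks.
Variable n : nat.
Implicit Types P : {set {set 'I_n.+1}}.

Lemma NC_is_ncpart P : P \in NC n.+1 -> is_ncpart [set: 'I_n.+1]%SET P.
Proof. by move=> PNC; apply/ncpartP. Qed.

Lemma one_block_NC : [set [set: 'I_n.+1]]%SET \in NC n.+1.
Proof.
suff : [set [set: 'I_n.+1]]%SET \in ncpart [set: 'I_n.+1] by [].
apply/ncpartP; split.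
- move=> V /set1P ->; split; last exact: finset.subsetT.
  by apply/set0Pn; exists ord0; rewrite inE.
- by move=> y _; exists [set: 'I_n.+1]%SET; rewrite inE.
- by move=> V W y /set1P-> /set1P->.
- by move=> V W a b c d /set1P-> /set1P->.
Qed.

Lemma NC_blockT P : P \in NC n.+1 -> [set: 'I_n.+1]%SET \in P ->
  P = [set [set: 'I_n.+1]]%SET.
Proof.
move=> /NC_is_ncpart[ne _ tr _] TP; apply/setP => V; rewrite !inE.
apply/idP/eqP => [VP|->//]; have [/set0Pn[y yV] _] := ne _ VP.
by apply: (tr _ _ y) => //; rewrite inE.
Qed.

Lemma NC_block_card P V : P \in NC n.+1 -> P != [set [set: 'I_n.+1]]%SET -> V \in P ->
  (0 < #|V| < n.+1)%N.
Proof.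
move=> PNC P1 VP; have [ne _ _ _] := NC_is_ncpart PNC.
rewrite card_gt0 (ne _ VP).1 /= ltn_neqAle -[X in (_ <= X)%N](card_ord n.+1) max_card andbT.
apply: contraNneq P1 => cV; apply/eqP/(NC_blockT PNC).
suff <- : V = [set: 'I_n.+1]%SET by [].
by apply/eqP; rewrite eqEcard finset.subsetT cardsT card_ord cV leqnn.
Qed.

Lemma NC_card_gt1 P : P \in NC n.+1 -> P != [set [set: 'I_n.+1]]%SET -> (1 < #|P|)%N.
Proof.
move=> PNC; apply: contraNT; rewrite -leqNgt => cP.
have [_ cov _ _] := NC_is_ncpart PNC.
have [|V VP yV] := cov ord0; first by rewrite inE.
apply/eqP/(NC_blockT PNC); suff <- : V = [set: 'I_n.+1]%SET by [].
apply/setP => y; rewrite inE.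
have [|W WP yW] := cov y; first by rewrite inE.
have /cards1P[U PU] : #|P| == 1%N by rewrite eqn_leq cP /= card_gt0; apply/set0Pn; exists V.
by move: VP WP; rewrite PU !inE => /eqP-> /eqP<-.
Qed.

Lemma NC_sum_card P : P \in NC n.+1 -> (\sum_(V in P) #|V| = n.+1)%N.
Proof.
by rewrite inE => /andP[/card_partition + _]; rewrite cardsT card_ord => <-.
Qed.
End NoncrossingBlocks.

Section BigCvg.
Variables (R : realType) (T I : Type) (F : set_system T).
Context {FF : Filter F}.
Variables (r : seq I) (P : pred I) (f : I -> T -> R) (l : I -> R).
Hypothesis fl : forall i, P i -> f i t @[t --> F] --> l i.

Lemma cvg_sum_cond :
  \sum_(i <- r | P i) f i t @[t --> F] --> \sum_(i <- r | P i) l i.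
Proof. by apply: (@cvg_big R I) => //; exact: add_continuous. Qed.

Lemma cvg_prod_cond :
  \prod_(i <- r | P i) f i t @[t --> F] --> \prod_(i <- r | P i) l i.
Proof. by apply: (@cvg_big R I) => //; exact: mul_continuous. Qed.

End BigCvg.

Section FreeCumulants.
Variable R : realType.
Implicit Types (m : nat -> R) (c : R).

(** Cumulants of an arbitrary sequence, not only of the moments of a measure: scaling and limits can
    then be treated on sequences. [free_cumulant mu] is the case [m = moment mu] by definition. *)
Definition cumulants m n : R := (cumulant_seq m n)`_n.-1.

Let size_s m n : size (cumulant_seq m n) = n.
Proof. by elim: n => //= n IHn; rewrite size_rcons IHn. Qed.

Let nth_s m n i : (0 < i <= n)%N -> (cumulant_seq m n)`_i.-1 = cumulants m i.
Proof.
elim: n => [|n IHn]; first by case: i.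
move=> /andP[i0]; rewrite leq_eqVlt => /predU1P[->//|]; rewrite ltnS => le_in.
by rewrite -IHn ?i0//= nth_rcons size_s prednK// le_in.
Qed.

Lemma cumulantsS m n : cumulants m n.+1 = m n.+1 -
  \sum_(P in NC n.+1 | P != [set [set: 'I_n.+1]]%SET) \prod_(V in P) cumulants m #|V|.
Proof.
rewrite {1}/cumulants /= nth_rcons size_s ltnn eqxx; congr (_ - _).
apply: eq_bigr => P /andP[PNC P1]; apply: eq_bigr => V VP.
have /andP[V0 Vn] := NC_block_card PNC P1 VP.
by rewrite nth_s // V0 -ltnS.
Qed.

Lemma moment_cumulants m n : m n.+1 =
  \sum_(P in NC n.+1) \prod_(V in P) cumulants m #|V|.
Proof.
rewrite (bigD1 [set [set: 'I_n.+1]]%SET) ?one_block_NC //= big_set1 cardsT card_ord.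
by rewrite cumulantsS subrK.
Qed.

Lemma NC_prod_scale n (P : {set {set 'I_n.+1}}) c (k : nat -> R) : P \in NC n.+1 ->
  \prod_(V in P) (c ^+ #|V| * k #|V|) = c ^+ n.+1 * \prod_(V in P) k #|V|.
Proof. by move=> PNC; rewrite big_split /= -expr_sum NC_sum_card. Qed.

Lemma cumulants_scale m c n :
  cumulants (fun i => c ^+ i * m i) n.+1 = c ^+ n.+1 * cumulants m n.+1.
Proof.
elim/ltn_ind: n => n IHn; rewrite !cumulantsS mulrBr big_distrr /=; congr (_ - _).
apply: eq_bigr => P /andP[PNC P1]; rewrite -NC_prod_scale //.
apply: eq_bigr => V VP; have /andP[V0 Vn] := NC_block_card PNC P1 VP.
by rewrite -(prednK V0) IHn //; lia.
Qed.

Lemma eq_cumulants m m' n : (forall i, (0 < i)%N -> m i = m' i) ->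
  cumulants m n = cumulants m' n.
Proof.
move=> mm'; case: n => // n; elim/ltn_ind: n => n IHn; rewrite !cumulantsS mm' //.
congr (_ - _); apply: eq_bigr => P /andP[PNC P1].
apply: eq_bigr => V VP; have /andP[V0 Vn] := NC_block_card PNC P1 VP.
by rewrite -(prednK V0) IHn //; lia.
Qed.

Lemma cvg_cumulants (T : Type) (F : set_system T) (FF : Filter F)
    (m : T -> nat -> R) (m' : nat -> R) n :
  (forall i, m t i @[t --> F] --> m' i) ->
  cumulants (m t) n.+1 @[t --> F] --> cumulants m' n.+1.
Proof.
move=> cm; elim/ltn_ind: n => n IHn; rewrite cumulantsS.
under eq_fun do rewrite cumulantsS.
apply: cvgB => //; apply: cvg_sum_cond => P /andP[PNC P1].
apply: cvg_prod_cond => V VP; have /andP[V0 Vn] := NC_block_card PNC P1 VP.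
by rewrite -(prednK V0); apply: IHn; lia.
Qed.

(* One-block partitions dominate: the other terms have order at least [e ^+ 2]. *)
Lemma cvg_small_cumulants (T : Type) (F : set_system T) (FF : Filter F)
    (k : nat -> R) (e : T -> R) n : (\forall t \near F, e t != 0) ->
  e t @[t --> F] --> 0 ->
  (e t)^-1 * (\sum_(P in NC n.+1) \prod_(V in P) (e t * k #|V|)) @[t --> F] --> k n.+1.
Proof.
move=> en0 e0.
pose S t := \sum_(P in NC n.+1 | P != [set [set: 'I_n.+1]]%SET) 
   (e t ^+ #|P|.-1 * \prod_(V in P) k #|V|).
have : k n.+1 + S t @[t --> F] --> k n.+1 + 0.
  apply: cvgD; first exact: cvg_cst.
  have -> : 0 = \sum_(P in NC n.+1 | P != [set [set: 'I_n.+1]]%SET) (0 : R).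
    by rewrite big1.
  apply: cvg_sum_cond => P /andP[PNC P1]; rewrite -[0](mul0r (\prod_(V in P) k #|V|)).
  apply: cvgM; last exact: cvg_cst.
  have := NC_card_gt1 PNC P1; case: #|P| => [//|[//|p]] _ /=.
  rewrite -[0](mul0r (0 ^+ p)); under eq_fun do rewrite exprS.
  apply: cvgM => //; elim: p => [|p IHp]; first by rewrite expr0; exact: cvg_cst.
  by under eq_fun do rewrite exprS; rewrite exprS; apply: cvgM.
rewrite addr0; apply: cvg_trans; apply: near_eq_cvg; near=> t.
have et : e t != 0 by near: t.
rewrite (bigD1 [set [set: 'I_n.+1]]%SET) ?one_block_NC //= big_set1 cardsT card_ord.
rewrite mulrDr mulKf //; congr (_ + _); rewrite /S big_distrr /=.
apply: eq_bigr => P /andP[PNC P1]; rewrite big_split /= prodr_const.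
have := NC_card_gt1 PNC P1; case: #|P| => [//|p] _ /=.
by rewrite exprS -mulrA mulKf.
Unshelve. all: by end_near. Qed.

End FreeCumulants.

(** * Determinants: continuity, Hankel scaling, positivity *)

Lemma cvg_det (R : realType) (T : Type) (F : set_system T) (FF : Filter F) N
    (A : T -> 'M[R]_N) (B : 'M[R]_N) :
  (forall i j, A t i j @[t --> F] --> B i j) -> \det (A t) @[t --> F] --> \det B.
Proof.
move=> cA; rewrite /determinant; apply: cvg_sum_cond => s _; apply: cvgM; first exact: cvg_cst.
by apply: cvg_prod_cond => i _; apply: cA.
Qed.

(** The scaling is [A |-> D A D] with [D = diag(c, ..., c^(N+1))]. The determinant of [D] enters
    twice, and [2 (1 + ... + (N+1)) = (N+1)(N+2)]. *)
Lemma det_hankel_scale (R : realType) N (A : 'M[R]_N.+1) (c : R) :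
  \det (\matrix_(i < N.+1, j < N.+1) (c ^+ (i + j + 2) * A i j)) =
  c ^+ (N.+1 * N.+2) * \det A.
Proof.
pose D : 'M[R]_N.+1 := diag_mx (\row_j (c ^+ j.+1)).
have -> : \matrix_(i < N.+1, j < N.+1) (c ^+ (i + j + 2) * A i j) = D *m A *m D.
  rewrite mul_mx_diag mul_diag_mx; apply/matrixP => i j; rewrite !mxE.
  by rewrite mulrAC -exprD; congr (_ ^+ _ * _); lia.
rewrite !det_mulmx mulrAC det_diag; congr (_ * _).
under eq_bigr do rewrite mxE; rewrite -expr_sum -exprD; congr (_ ^+ _).
rewrite addnn -muln2 -(big_mkord xpredT S); elim: N {A D} => [|N IHN]; first by rewrite big_nat1.
by rewrite big_nat_recr //= mulnDl IHN; lia.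
Qed.

(* If [\det A < 0] then [x |-> \det (A + x I)], which is positive for large [x],
   vanishes at some [x > 0], and [- x] is an eigenvalue of [A]. *)
Lemma det_psd_ge0 (R : rcfType) N (A : 'M[R]_N.+1) :
  (forall v : 'rV[R]_N.+1, 0 <= \sum_i \sum_j v 0 i * A i j * v 0 j) -> 0 <= \det A.
Proof.
move=> psd; rewrite leNgt; apply/negP => detA.
pose p := char_poly (- A).
have p0 : p.[0] = \det A.
  have NA : - A = -1 *: A by rewrite scaleN1r.
  by rewrite horner_coef0 char_poly_det NA detZ mulrA -exprMn mulrNN mulr1 expr1n mul1r.
have [x x0 px] : exists2 x, 0 < x & root p x.
  have [b b0 pb] : exists2 b, 0 < b & 0 < p.[b].
    have : 0 < lead_coef p by rewrite (monicP (char_poly_monic _)).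
    move=> /poly_pinfty_gt_lc[n hn]; exists (Num.max n 1); first by rewrite lt_max ltr01 orbT.
    apply: lt_le_trans (hn _ _); last by rewrite le_max lexx.
    by rewrite (monicP (char_poly_monic _)).
  have [|x /andP[x0 _] rx] := @poly_ivt _ p 0 b (ltW b0); first by rewrite p0 !ltW.
  exists x => //; rewrite lt_neqAle x0 andbT; apply: contraTneq rx => <-.
  by rewrite /root p0 lt_eqF.
have /eigenvalueP[v vA v0] : eigenvalue (- A) x by rewrite eigenvalue_root_char.
have := psd v; suff -> : \sum_i \sum_j v 0 i * A i j * v 0 j = - x * \sum_j v 0 j ^+ 2.
  have : 0 < \sum_j v 0 j ^+ 2.
    have /rV0Pn[j vj] := v0.
    rewrite (bigD1 j) //= ltr_pwDl ?exprn_even_gt0 ?orbT // sumr_ge0 // => i _.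
    exact: sqr_ge0.
  nra.
rewrite exchange_big big_distrr /=; apply: eq_bigr => j _.
have := congr1 (fun w : 'rV_N.+1 => w 0 j) vA; rewrite mulmxN !mxE => /eqP.
rewrite eqr_oppLR => /eqP E.
by rewrite -big_distrl /= E mulNr mulNr expr2 mulrA.
Qed.

(** * Asymptotic expansions and moments *)

Section RealIntegrals.
Context d (T : measurableType d) (R : realType) (mu : {measure set T -> \bar R}).
Implicit Types f g : T -> R.

Definition Rintegrable f := mu.-integrable setT (EFin \o f).

Lemma Rintegrable_measurable f : Rintegrable f -> measurable_fun setT f.
Proof. by move=> /measurable_int/measurable_EFinP. Qed.

Lemma le_Rintegrable f g : measurable_fun setT f -> (forall x, `|f x| <= g x) ->
  Rintegrable g -> Rintegrable f.
Proof.
move=> mf fg; apply: le_integrable => //; first exact/measurable_EFinP.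
by move=> x _; rewrite !lee_fin (le_trans (fg x)) // ler_norm.
Qed.

Lemma RintegrableD f g : Rintegrable f -> Rintegrable g -> Rintegrable (f \+ g).
Proof. by move=> fi gi; apply: eq_integrable (integrableD measurableT fi gi). Qed.

Lemma RintegrableB f g : Rintegrable f -> Rintegrable g -> Rintegrable (f \- g).
Proof. by move=> fi gi; apply: eq_integrable (integrableB measurableT fi gi). Qed.

Lemma RintegrableZ c f : Rintegrable f -> Rintegrable (fun x => c * f x).
Proof. by move=> fi; apply: eq_integrable (integrableZl measurableT c fi). Qed.

Lemma Rintegrable_norm f : Rintegrable f -> Rintegrable (fun x => `|f x|).
Proof. by move=> fi; apply: eq_integrable (integrable_norm fi). Qed.

Lemma Rintegrable_sum (I : Type) (r : seq I) (P : pred I) (f : I -> T -> R) :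
  (forall i, P i -> Rintegrable (f i)) -> Rintegrable (fun x => \sum_(i <- r | P i) f i x).
Proof.
move=> fi; apply: eq_integrable (integrable_sum measurableT r fi) => //.
by move=> x _ /=; rewrite sumEFin.
Qed.

Lemma Rintegral_sum (I : Type) (r : seq I) (f : I -> T -> R) :
  (forall i, Rintegrable (f i)) ->
  \int[mu]_x (\sum_(i <- r) f i x) = \sum_(i <- r) \int[mu]_x f i x.
Proof.
move=> fi; elim: r => [|i r IHr].
  rewrite big_nil (_ : (fun x => _) = cst 0) ?Rintegral_cst ?mul0r //.
  by apply/funext => x; rewrite big_nil.
rewrite big_cons -IHr -RintegralD //; [|exact: fi|exact: Rintegrable_sum].
by congr (\int[mu]_x _); apply/funext => x; rewrite big_cons.
Qed.

Lemma Rdominated_cvg (f_ : nat -> T -> R) f g :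
  (forall n, measurable_fun setT (f_ n)) -> 
  (forall x, f_ n x @[n --> \oo] --> f x) ->
  Rintegrable g -> (forall n x, `|f_ n x| <= g x) ->
  \int[mu]_x f_ n x @[n --> \oo] --> \int[mu]_x f x.
Proof.
move=> mf cf ig fg.
have mfl : measurable_fun setT f.
  by apply: (measurable_fun_cvg mf) => x _; exact: cf.
have [fi _ h] : [/\ mu.-integrable setT (EFin \o f),
  [sequence \int[mu]_(x in setT) `|(f_ n x)%:E - (f x)%:E|]_n @ \oo --> 0 &
  [sequence \int[mu]_(x in setT) (f_ n x)%:E]_n @ \oo --> \int[mu]_(x in setT) (f x)%:E]%E.
  apply: (@dominated_convergence _ _ _ _ _ _ _ _ (EFin \o g)) => //.
  - by move=> n; apply/measurable_EFinP.
  - exact/measurable_EFinP.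
  - by apply: aeW => x _; apply: cvg_EFin; [exact: nearW|exact: cf].
  - by apply: aeW => x n _; rewrite lee_fin.
by apply: fine_cvg; rewrite fineK ?integrable_fin_num.
Qed.

Lemma measurable_funV_ge0 f : measurable_fun setT f -> (forall x, 0 <= f x) ->
  measurable_fun setT (fun x => (f x)^-1).
Proof.
move=> mf f0; apply: eq_measurable_fun (measurableT_comp (measurable_powR (-1)) mf).
by move=> x _ /=; rewrite powR_inv1.
Qed.

End RealIntegrals.

Section HamburgerNevanlinna.
Variables (R : realType) (nu : Rprobability R).
Implicit Types (f : R -> R) (b c : nat -> R).

(** At [z = i y] one has [z / (z - x) = K - i x K / y] and [z^-2 = t]. Integrals against [K] are
    thus the real and imaginary parts of [z G(z)], up to the factor [- y^-1] for the latter. *)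
Let y n : R := n.+1%:R.
Let t n : R := - (y n) ^- 2.
Let K n x : R := y n ^+ 2 / (x ^+ 2 + y n ^+ 2).

Let y_gt0 n : 0 < y n. Proof. by rewrite /y ltr0n. Qed.
Let den_gt0 n x : 0 < x ^+ 2 + y n ^+ 2.
Proof. by rewrite ltr_wpDl ?sqr_ge0 // exprn_gt0. Qed.
Let K_ge0 n x : 0 <= K n x.
Proof. by rewrite divr_ge0 ?sqr_ge0 // ltW. Qed.
Let K_le1 n x : K n x <= 1.
Proof. by rewrite ler_pdivrMr // mul1r lerDr sqr_ge0. Qed.

Let K_le m n x : (m <= n)%N -> K m x <= K n x.
Proof.
move=> mn; rewrite ler_pdivrMr // mulrAC ler_pdivlMr // !mulrDr.
have ymn : y m <= y n by rewrite ler_nat ltnS.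
have : (y m) ^+ 2 <= y n ^+ 2 by apply: lerXn2r; rewrite ?nnegrE // ltW.
by move=> h; apply: lerD; [rewrite ler_wpM2r ?sqr_ge0|rewrite mulrC].
Qed.

(** This identity drives the induction on moments: the damped integral of [x^2 f] is [y^2] times the
    defect of the damped integral of [f]. *)
Let K_split n x : x ^+ 2 * K n x = y n ^+ 2 * (1 - K n x).
Proof.
rewrite /K; have := lt0r_neq0 (den_gt0 n x); move: (y n) => Y dn0.
by field.
Qed.

Let cvg_t : t n @[n --> \oo] --> 0.
Proof.
have h : (y n)^-1 @[n --> \oo] --> (0 : R) by exact: cvg_harmonic.
have -> : t = (fun n => - ((y n)^-1 * (y n)^-1)).
  by apply/funext => n; rewrite -invfM.
by have := cvgN (cvgM h h); rewrite mulr0 oppr0; apply.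
Qed.

Let cvg_K x : K n x @[n --> \oo] --> (1 : R).
Proof.
have -> : (fun n => K n x) = (fun n => (1 - x ^+ 2 * t n)^-1).
  apply/funext => n; rewrite /K -invf_div; congr (_ ^-1).
  by rewrite /t; field; rewrite lt0r_neq0.
rewrite -[X in _ --> X]invr1; apply: cvgV; first exact: oner_neq0.
rewrite -[1 in X in _ --> X]subr0 -[0 in X in _ --> X](mulr0 (x ^+ 2)).
by apply: cvgB; [exact: cvg_cst|apply: cvgM => //; exact: cvg_cst].
Qed.

Let mK n : measurable_fun [set: measurableTypeR R] (K n).
Proof.
apply: measurable_funM => //; apply: measurable_funV_ge0 => [|x].
  by apply: measurable_funD => //; exact: measurable_funX.
exact: ltW.
Qed.

Let E f n := \int[nu]_x (f x * K n x).

Let E_integrable f n : Rintegrable nu f -> Rintegrable nu (fun x => f x * K n x).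
Proof.
move=> fi; have mf := Rintegrable_measurable fi.
apply: le_Rintegrable (Rintegrable_norm fi); first exact: measurable_funM.
by move=> x; rewrite normrM ler_piMr // ger0_norm.
Qed.

Let cvg_E f : Rintegrable nu f -> E f n @[n --> \oo] --> \int[nu]_x f x.
Proof.
move=> fi; have mf := Rintegrable_measurable fi.
apply: (Rdominated_cvg _ _ (Rintegrable_norm fi)).
- by move=> n; exact: measurable_funM.
- move=> x; rewrite -[X in _ --> X]mulr1.
  by apply: cvgM; [exact: cvg_cst|exact: cvg_K].
- by move=> n x; rewrite normrM ler_piMr // ger0_norm.
Qed.

(* [\int f(x) y^2 / (x^2 + y^2) d nu] has the asymptotic expansion
   [\sum_j c_j (- y^-2)^j] as [y -> oo] along the integers. *)
Definition stieltjes_expansion f c := forall J : nat, exists C : R,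
  \forall n \near \oo,
    `|E f n - \sum_(j < J) c j * t n ^+ j| <= C * `|t n| ^+ J.

Lemma stieltjes_expansion0 f c : Rintegrable nu f -> stieltjes_expansion f c ->
  \int[nu]_x f x = c 0%N.
Proof.
move=> fi /(_ 1%N)[C EC].
have : E f n @[n --> \oo] --> c 0%N.
  apply/cvgrPdist_le => e e0; near=> n.
  rewrite distrC; apply: (@le_trans _ _ (C * `|t n| ^+ 1)).
    by near: n; apply: filterS EC => n; rewrite big_ord1 expr0 mulr1.
  near: n.
  have : C * `|t n| ^+ 1 @[n --> \oo] --> C * 0.
    apply: cvgM; first exact: cvg_cst.
    by under eq_fun do rewrite expr1; have := cvg_norm cvg_t; rewrite normr0; apply.
  by rewrite mulr0 => /cvgr_le; apply.
by move=> /(cvg_unique _ (cvg_E fi)); apply.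
Unshelve. all: by end_near. Qed.

Let E_sqr f n : Rintegrable nu f ->
  E (fun x => x ^+ 2 * f x) n = y n ^+ 2 * (\int[nu]_x f x - E f n).
Proof.
move=> fi; rewrite /E -RintegralB //; last exact: E_integrable.
rewrite -RintegralZl //; last by apply: RintegrableB => //; exact: E_integrable.
congr (\int[nu]_x _); apply/funext => x /=.
by rewrite mulrAC K_split -mulrA mulrBl mul1r (mulrC (K n x)).
Qed.

(** The integral of [f] cancels the leading coefficient [c 0], and the factor [y^2 = - 1 / t] lowers
    each remaining power of [t] by one, so the coefficients are shifted. The damped integrals of
    [x^2 f] exist even before [x^2 f] is known to be integrable. *)
Lemma stieltjes_expansion_sqr f c : Rintegrable nu f -> stieltjes_expansion f c ->
  stieltjes_expansion (fun x => x ^+ 2 * f x) (fun j => c j.+1).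
Proof.
move=> fi fc J; have [C EC] := fc J.+1; exists C; near=> n.
rewrite E_sqr // (stieltjes_expansion0 fi fc).
have y2t : y n ^+ 2 * t n = -1 by rewrite mulrN divff // expf_neq0 // lt0r_neq0.
rewrite (_ : _ - _ = - (y n ^+ 2 * (E f n - \sum_(j < J.+1) c j * t n ^+ j))).
  rewrite normrN normrM ger0_norm ?sqr_ge0 //.
  apply: (@le_trans _ _ (y n ^+ 2 * (C * `|t n| ^+ J.+1))).
    by rewrite ler_wpM2l ?sqr_ge0 //; near: n.
  have Yt : y n ^+ 2 * `|t n| = 1.
    by rewrite -[y n ^+ 2]ger0_norm ?sqr_ge0 // -normrM y2t normrN1.
  by rewrite [`|t n| ^+ _]exprS (mulrCA C) (mulrA (y n ^+ 2)) Yt mul1r.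
rewrite big_ord_recl /= expr0 mulr1.
under [in RHS]eq_bigr do rewrite /bump /= add1n exprS mulrCA.
rewrite -big_distrr /=; set S := \sum_(_ < _) _.
apply/eqP; rewrite -subr_eq0; apply/eqP.
transitivity (- (1 + y n ^+ 2 * t n) * S); first ring.
by rewrite y2t subrr oppr0 mul0r.
Unshelve. all: by end_near. Qed.

(** The shifted expansion at order 0 merely says that the damped integrals of [x^2 f] stay bounded.
    As [K n x] increases to 1, monotone convergence passes the bound to the undamped integral. *)
Lemma stieltjes_expansion_integrable f c : measurable_fun setT f -> (forall x, 0 <= f x) ->
  Rintegrable nu f -> stieltjes_expansion f c -> Rintegrable nu (fun x => x ^+ 2 * f x).
Proof.
move=> mf f0 fi fc; pose g x := x ^+ 2 * f x.
have g0 x : 0 <= g x by rewrite mulr_ge0 ?sqr_ge0.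
have mg : measurable_fun setT g by apply: measurable_funM => //; exact: measurable_funX.
have [C EC] := stieltjes_expansion_sqr fi fc 0.
apply/integrableP; split; first exact/measurable_EFinP.
have gK_int n : Rintegrable nu (fun x => g x * K n x).
  have : Rintegrable nu (fun x => y n ^+ 2 * (f x - f x * K n x)).
    by apply: RintegrableZ; apply: RintegrableB => //; exact: E_integrable.
  apply: eq_integrable => // x _ /=; congr EFin; rewrite /g.
  by rewrite [RHS]mulrAC K_split; ring.
apply: (@le_lt_trans _ _ C%:E); last by rewrite ltry.
rewrite (eq_integral (fun x : measurableTypeR R => (g x)%:E)); last first.
  by move=> x _ /=; rewrite ger0_norm // g0.
have mono : (\int[nu]_x (g x * K n x)%:E @[n --> \oo] --> \int[nu]_x (g x)%:E)%E.
  rewrite (_ : (fun x => (g x)%:E) = (fun x => limn (fun n => (g x * K n x)%:E))).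
    apply: cvg_monotone_convergence => //.
    - by move=> n; apply/measurable_EFinP; apply: measurable_funM.
    - by move=> n x _; rewrite lee_fin mulr_ge0.
    - by move=> x _ m n mn; rewrite lee_fin ler_wpM2l // K_le.
  apply/funext => x; apply/esym/cvg_lim => //.
  apply: cvg_EFin; first exact: nearW.
  rewrite -[X in _ --> X]mulr1.
  by apply: cvgM; [exact: cvg_cst|exact: cvg_K].
rewrite -(cvg_lim _ mono) //; apply: lime_le.
  by apply/cvg_ex; eexists; exact: mono.
near=> n.
have h : `|E g n| <= C.
  by near: n; apply: filterS EC => n; rewrite big_ord0 subr0 expr0 mulr1.
rewrite -[leLHS]fineK; last exact: (integrable_fin_num measurableT (gK_int n)).
by rewrite lee_fin (le_trans (ler_norm _) h).
Unshelve. all: by end_near. Qed.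

Let sqr_pow f k : (fun x => x ^+ 2 * (x ^+ k.*2 * f x)) = (fun x => x ^+ k.+1.*2 * f x).
Proof. by apply/funext => x; rewrite mulrA -exprD doubleS add2n. Qed.

Let pow0 f : (fun x => x ^+ 0.*2 * f x) = f.
Proof. by apply/funext => x; rewrite double0 expr0 mul1r. Qed.

(** Integrability is a hypothesis here so that the lemma also serves [f = id], which changes sign;
    for nonnegative [f] it is derived from the expansion in the next lemma. *)
Lemma stieltjes_expansion_pow f c : (forall k, Rintegrable nu (fun x => x ^+ k.*2 * f x)) ->
  stieltjes_expansion f c -> forall k, \int[nu]_x (x ^+ k.*2 * f x) = c k.
Proof.
move=> fi fc k; rewrite -[in RHS](addn0 k).
apply: (stieltjes_expansion0 (c := fun j => c (k + j)%N)) => //.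
elim: k => [|k IHk]; first by rewrite pow0.
rewrite -sqr_pow (_ : (fun j => _) = (fun j => c (k + j.+1)%N)).
  exact: stieltjes_expansion_sqr IHk.
by apply/funext => j; rewrite addSnnS.
Qed.

Lemma stieltjes_expansion_pow_integrable f c : measurable_fun setT f ->
  (forall x, 0 <= f x) -> Rintegrable nu f -> stieltjes_expansion f c ->
  forall k, Rintegrable nu (fun x => x ^+ k.*2 * f x).
Proof.
move=> mf f0 fi fc k.
suff [] : Rintegrable nu (fun x => x ^+ k.*2 * f x) /\
  stieltjes_expansion (fun x => x ^+ k.*2 * f x) (fun j => c (k + j)%N) by [].
elim: k => [|k [IHi IHc]]; first by rewrite pow0.
rewrite -sqr_pow; split; last first.
  rewrite (_ : (fun j => _) = (fun j => c (k + j.+1)%N)).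
    exact: stieltjes_expansion_sqr IHc.
  by apply/funext => j; rewrite addSnnS.
apply: stieltjes_expansion_integrable IHi IHc.
  by apply: measurable_funM => //; exact: measurable_funX.
by move=> x; rewrite mulr_ge0 // -mul2n exprM exprn_ge0 ?sqr_ge0.
Qed.

(* The Hamburger-Nevanlinna theorem; the two expansions are the imaginary and the
   real part of that of the Cauchy transform along the imaginary axis. *)
Theorem moments_of_expansion b :
  stieltjes_expansion (fun=> 1) (fun j => b j.*2) ->
  stieltjes_expansion id (fun j => b j.*2.+1) ->
  forall n, Rintegrable nu (fun x => x ^+ n) /\ \int[nu]_x x ^+ n = b n.
Proof.
move=> e1 ex; have i1 : Rintegrable nu (fun=> 1) by exact: finite_measure_integrable_cst.
have m1 : measurable_fun setT (fun _ : measurableTypeR R => 1 : R) by exact: measurable_cst.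
have int_even k : Rintegrable nu (fun x => x ^+ k.*2 * 1).
  by apply: (stieltjes_expansion_pow_integrable _ _ i1 e1) => // x; exact: ler01.
have eE k : (fun x : measurableTypeR R => (x : R) ^+ k.*2 * 1) = (fun x => x ^+ k.*2).
  by apply/funext => x; rewrite mulr1.
have oE k : (fun x : measurableTypeR R => (x : R) ^+ k.*2 * id x) = (fun x => x ^+ k.*2.+1).
  by apply/funext => x; rewrite -exprSr.
(* Odd powers change sign, out of reach of monotone convergence; they are dominated by
   [x^(2k) + x^(2k+2)]. *)
have int_odd k : Rintegrable nu (fun x => x ^+ k.*2 * id x).
  apply: le_Rintegrable (RintegrableD (int_even k) (int_even k.+1)) => [|x].
    by apply: measurable_funM => //; exact: measurable_funX.
  rewrite /= !mulr1 doubleS -addn2 exprD normrM.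
  have A0 : 0 <= x ^+ k.*2 by rewrite -mul2n exprM exprn_ge0 ?sqr_ge0.
  rewrite ger0_norm // -[X in X + _]mulr1 -mulrDr ler_wpM2l // -[x ^+ 2]real_normK ?num_real //.
  by have := sqr_ge0 (`|x| - 1); have := normr_ge0 x; nra.
move=> n; rewrite -(odd_double_half n); case: odd.
  by rewrite add1n -oE; split => //; exact: stieltjes_expansion_pow ex _.
rewrite add0n -eE; split => //; exact: stieltjes_expansion_pow e1 _.
Qed.

(** The quadratic form is the integral of the square of [\sum_i v_i x^(i+1)]; the shift of the
    exponent by one produces the index [i + j + 2]. *)
Lemma hankel_moments_psd N (v : 'I_N -> R) : (forall n, Rintegrable nu (fun x => x ^+ n)) ->
  0 <= \sum_(i < N) \sum_(j < N) v i * \int[nu]_x (x ^+ (i + j + 2)) * v j.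
Proof.
move=> xi.
have -> : \sum_(i < N) \sum_(j < N) v i * \int[nu]_x (x ^+ (i + j + 2)) * v j =
    \int[nu]_x (\sum_(i < N) v i * x ^+ i.+1) ^+ 2.
  transitivity (\int[nu]_x \sum_(i < N) \sum_(j < N) (v i * v j) * x ^+ (i + j + 2)).
    rewrite Rintegral_sum; last first.
      by move=> i; apply: Rintegrable_sum => j _; exact: RintegrableZ.
    apply: eq_bigr => i _; rewrite Rintegral_sum; last by move=> j; exact: RintegrableZ.
    by apply: eq_bigr => j _; rewrite RintegralZl //; [rewrite mulrAC|exact: xi].
  congr (\int[nu]_x _); apply/funext => x; rewrite expr2 big_distrlr /=.
  apply: eq_bigr => i _; apply: eq_bigr => j _.
  by rewrite mulrACA -exprD; congr (_ * _ ^+ _); lia.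
by apply: Rintegral_ge0 => x _; exact: sqr_ge0.
Qed.

End HamburgerNevanlinna.

(** * Beta and gamma moments *)

(** The density is only known through the values of [m] on measurable sets. Seen as a finite
    measure, [m] is dominated by Lebesgue measure, and its Radon-Nikodym derivative equals [f]
    almost everywhere because both have the same integrals on all measurable sets. *)
Lemma ge0_integral_density (R : realType) (m : Rmeasure R) (f g : R -> R) :
  (forall x, 0 <= f x) -> measurable_fun [set: measurableTypeR R] f -> m setT = 1%E ->
  (forall A, measurable A -> m A = \int[lebesgue_measure]_(x in A) (f x)%:E)%E ->
  (forall x, 0 <= g x) -> measurable_fun [set: measurableTypeR R] g ->
  (\int[m]_x (g x)%:E = \int[lebesgue_measure]_x (g x * f x)%:E)%E.
Proof.
move=> f0 mf m1 mE g0 mg.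
have moo : (m setT < +oo)%E by rewrite m1 ltry.
pose nu := mfrestr measurableT moo.
have nuE A : measurable A -> nu A = m A by rewrite /nu /= /mfrestr /mrestr setIT.
have numu : nu `<< (@lebesgue_measure R).
  apply/null_content_dominatesP => A mA A0; rewrite nuE // mE //.
  by apply: null_set_integral => //; apply/measurable_funTS/measurable_EFinP.
have mgE := proj2 (measurable_EFinP _ _) mg; have mfE := proj2 (measurable_EFinP _ _) mf.
rewrite (eq_measure_integral nu) => [|A mA _]; last exact/esym/nuE.
rewrite -(Radon_Nikodym_SigmaFinite.change_of_variables numu) //.
have id := Radon_Nikodym_SigmaFinite.f_integrable numu.
under [RHS]eq_integral do rewrite EFinM.
apply: ae_eq_integral => //.
- by apply: emeasurable_funM => //; exact: measurable_int id.
- exact: emeasurable_funM.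
- apply: ae_eqe_mul2l; apply: integral_ae_eq => // A _ mA.
  transitivity (nu A); last by rewrite nuE // mE.
  exact/esym/Radon_Nikodym_SigmaFinite.f_integral.
Qed.

Section EulerIntegrals.
Variable R : realType.
Local Notation leb := (@lebesgue_measure R).

(** Integration by parts on the exhausting segments [[l n, r n]], followed by monotone convergence.
    The equality is in the extended reals, so it can later transfer finiteness from one Euler
    integral to another. *)
Lemma integral_parts_vanishing (D : set R) (l r : nat -> R) (F g1 g2 : R -> R) :
  D = \bigcup_n `[l n, r n]%classic -> (forall n, l n < r n) ->
  (forall m n, (m <= n)%N -> l n <= l m /\ r m <= r n) ->
  (forall x, D x -> [/\ 0 <= g1 x, 0 <= g2 x, {for x, continuous g1} &
    {for x, continuous g2}]) ->
  (forall x, D x -> is_derive x (1:R) F (g1 x - g2 x)) ->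
  F (l n) @[n --> \oo] --> (0 : R) -> F (r n) @[n --> \oo] --> (0 : R) ->
  (\int[leb]_(x in D) (g1 x)%:E = \int[leb]_(x in D) (g2 x)%:E)%E.
Proof.
move=> DE lr mono gD FD Fl Fr.
have sub n x : `[l n, r n]%classic x -> D x by move=> xn; rewrite DE; exists n.
have cg n : {within `[l n, r n], continuous g1} /\ {within `[l n, r n], continuous g2}.
  by split; apply: continuous_in_subspaceT => x /set_mem/sub/gD[].
have int n : leb.-integrable `[l n, r n] (EFin \o g1) /\
    leb.-integrable `[l n, r n] (EFin \o g2).
  by split; (apply: continuous_compact_integrable; [exact: segment_compact|case: (cg n)]).
have lim g : g = g1 \/ g = g2 ->
    (\int[leb]_(x in `[l n, r n]) (g x)%:E @[n --> \oo] --> \int[leb]_(x in D) (g x)%:E)%E.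
  move=> gE; rewrite DE; apply: ge0_nondecreasing_set_cvg_integral => //.
  - move=> m n /mono[lmn rmn]; apply/subsetPset => x /=; rewrite !in_itv /=.
    by move=> /andP[lx xr]; rewrite (le_trans lmn lx) (le_trans xr rmn).
  - move=> n; have [i1 i2] := int n.
    by case: gE => ->; [exact: measurable_int i1|exact: measurable_int i2].
  - by move=> n x /sub/gD[? ? _ _]; rewrite lee_fin; case: gE => ->.
have FTC n : (\int[leb]_(x in `[l n, r n]) (g1 x)%:E =
    \int[leb]_(x in `[l n, r n]) (g2 x)%:E + (F (r n) - F (l n))%:E)%E.
  have [i1 i2] := int n; have [c1 c2] := cg n.
  have Fc x : D x -> {for x, continuous F}.
    move=> /FD dF; apply: differentiable_continuous; apply/derivable1_diffP.
    by apply: ex_derive.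
  have : (\int[leb]_(x in `[l n, r n]) (g1 x - g2 x)%:E = (F (r n))%:E - (F (l n))%:E)%E.
    apply: continuous_FTC2 => //.
  - by apply: continuous_in_subspaceT => x /set_mem/sub/gD[_ _ ? ?]; apply: cvgB.
  - split.
    + move=> x xlr; have Dx : D x by apply: (sub n); exact: subset_itv_oo_cc.
      by have dF := FD x Dx; exact: ex_derive.
    + apply: cvg_at_right_filter; apply: Fc; apply: (sub n).
      by rewrite /= in_itv /= lexx ltW.
    + apply: cvg_at_left_filter; apply: Fc; apply: (sub n).
      by rewrite /= in_itv /= lexx ltW.
  - move=> x xlr; have Dx : D x by apply: (sub n); exact: subset_itv_oo_cc.
    by have dF := FD x Dx; rewrite derive1E; exact: derive_val.
  rewrite EFinB => <-; rewrite (integralB_EFin _ i1 i2) //.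
  by rewrite addeC subeK // integrable_fin_num.
apply: (cvg_unique _ (lim g1 _)) => //; first by left.
rewrite (_ : (fun n => _) = (fun n => \int[leb]_(x in `[l n, r n]) (g2 x)%:E +
    (F (r n) - F (l n))%:E)%E); last by apply/funext.
rewrite -[(\int[leb]_(x in D) (g2 x)%:E)%E]adde0; apply: cvgeD => //.
  by rewrite fin_num_adde_defl.
  by apply: lim; right.
by apply: cvg_EFin; [exact: nearW|have := cvgB Fr Fl; rewrite subr0; apply].
Qed.

Lemma integral_pos_neq0 (D : set R) (w : R -> R) : measurable D -> leb D != 0%E ->
  measurable_fun D w -> (forall x, D x -> 0 < w x) ->
  (\int[leb]_(x in D) (w x)%:E != 0)%E.
Proof.
move=> mD D0 mw w0; apply/negP => /eqP Iw.
have mwE : measurable_fun D (EFin \o w) by exact/measurable_EFinP.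
have /(ae_eq_integral_abs leb mD mwE)[N [mN N0 wN]] :
    (\int[leb]_(x in D) `|(EFin \o w) x| = 0)%E.
  rewrite -[RHS]Iw; apply: eq_integral => x /set_mem/w0 wx.
  by rewrite /= gtr0_norm.
move: D0; apply/negP; rewrite negbK; apply/eqP.
apply: (@subset_measure0 _ _ _ leb D N) => // x Dx; apply: wN => /= /(_ Dx) [] wx.
by have := w0 x Dx; rewrite wx ltxx.
Qed.

(** * Moments of a normalized weight on a subset of the half-line *)

Section WeightedMoments.
Variables (D : set R) (w : R -> R) (m : Rmeasure R).
Local Notation c := (\int[leb]_(x in D) w x).
Local Notation f := ((fun x => w x / c) \_ D).
Hypothesis mD : measurable D.
Hypothesis D0 : leb D != 0%E.
Hypothesis Dge0 : forall x, D x -> 0 <= x.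
Hypothesis mw : measurable_fun setT w.
Hypothesis w0 : forall x, D x -> 0 < w x.
Hypothesis wfin : forall n, (\int[leb]_(x in D) (x ^+ n * w x)%:E < +oo)%E.
Hypothesis mE : (forall A, measurable A -> m A = \int[leb]_(x in A) (f x)%:E)%E.

Let cE : (\int[leb]_(x in D) (w x)%:E)%E = c%:E.
Proof.
rewrite fineK // ge0_fin_numE; last by apply: integral_ge0 => x Dx; rewrite lee_fin ltW // w0.
apply: le_lt_trans (wfin 0); rewrite le_eqVlt; apply/orP; left; apply/eqP.
by apply: eq_integral => x _; rewrite expr0 mul1r.
Qed.

Let c_gt0 : 0 < c.
Proof.
rewrite lt_def Rintegral_ge0 ?andbT => [|x Dx]; last by rewrite ltW // w0.
rewrite -[_ != _]/(c != 0) -eqe -cE; apply: integral_pos_neq0 => //.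
exact: measurable_funTS.
Qed.

Let f_ge0 x : 0 <= f x.
Proof. by apply: restrict_ge0 => y Dy; rewrite divr_ge0 // ltW ?w0. Qed.

Let mf : measurable_fun [set: measurableTypeR R] f.
Proof.
by apply/measurable_restrict => //; apply: measurable_funTS; exact: measurable_funM.
Qed.

Let integral_f (g : R -> R) : (forall x, 0 <= g x) -> measurable_fun setT g ->
  (\int[leb]_x (g x * f x)%:E = c^-1%:E * \int[leb]_(x in D) (g x * w x)%:E)%E.
Proof.
move=> g0 mg; rewrite -ge0_integralZl //.
- rewrite [RHS]integral_mkcond; apply: eq_integral => x _; rewrite /patch.
  case: ifP => _; last by rewrite mulr0.
  by rewrite -EFinM; congr EFin; ring.
- by apply/measurable_funTS/measurable_EFinP; exact: measurable_funM.
- by move=> x Dx; rewrite lee_fin mulr_ge0 // ltW // w0.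
- by rewrite lee_fin invr_ge0 ltW.
Qed.

Lemma density_total_mass : m setT = 1%E.
Proof.
rewrite mE //; have := @integral_f (fun=> 1) (fun=> ler01) (measurable_cst _).
under eq_integral do rewrite mul1r.
under [in RHS]eq_integral do rewrite mul1r.
by move=> ->; rewrite cE -EFinM mulVf // gt_eqF.
Qed.

Let norm_pow n (x : R) : D x -> `|x ^+ n| = x ^+ n.
Proof. by move=> Dx; rewrite ger0_norm // exprn_ge0 // Dge0. Qed.

Let m_pow n : (\int[m]_x (`|x ^+ n|)%:E = c^-1%:E * \int[leb]_(x in D) (x ^+ n * w x)%:E)%E.
Proof.
have mn : measurable_fun [set: measurableTypeR R] (fun x : R => `|x ^+ n|).
  by apply: measurableT_comp => //; exact: measurable_funX.
rewrite (ge0_integral_density f_ge0 mf density_total_mass mE) // integral_f //.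
by congr (_ * _)%E; apply: eq_integral => x /set_mem Dx; rewrite norm_pow.
Qed.

Lemma density_Rintegrable n : Rintegrable m (fun x => x ^+ n).
Proof.
apply/integrableP; split; first by apply/measurable_EFinP; exact: measurable_funX.
rewrite -[X in (X < _)%E]/(\int[m]_x (`|x ^+ n|)%:E)%E m_pow.
by rewrite lte_mul_pinfty ?lee_fin ?invr_ge0 ?ltW.
Qed.

Lemma density_moment n :
  moment m n = fine (\int[leb]_(x in D) (x ^+ n * w x)%:E)%E / c.
Proof.
have xn := density_Rintegrable n; have xa := Rintegrable_norm xn.
(* The density formula covers nonnegative integrands only, hence [|x^n|]. It agrees with [x^n] on
   [D], outside which the density vanishes. *)
have -> : moment m n = \int[m]_x `|x ^+ n| - \int[m]_x (`|x ^+ n| - x ^+ n).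
  by rewrite [X in _ - X]RintegralB // subKr.
have -> : \int[m]_x (`|x ^+ n| - x ^+ n) = 0.
  have mg := Rintegrable_measurable (RintegrableB xa xn).
  rewrite /Rintegral (ge0_integral_density f_ge0 mf density_total_mass mE) //.
    rewrite integral0_eq // => x _; rewrite /patch; case: ifPn => [/set_mem Dx|_].
      by rewrite norm_pow // subrr mul0r.
    by rewrite mulr0.
  by move=> x; rewrite subr_ge0 ler_norm.
rewrite subr0 /Rintegral m_pow mulrC fineM // ge0_fin_numE //.
apply: integral_ge0 => x Dx; have x0 := Dge0 Dx.
by rewrite lee_fin mulr_ge0 ?exprn_ge0 // ltW // w0.
Qed.

End WeightedMoments.

End EulerIntegrals.

Section EulerGamma.
Variable R : realType.
Local Notation leb := (@lebesgue_measure R).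

Lemma continuous_powR (p x : R) : 0 < x -> {for x, continuous (fun t => t `^ p)}.
Proof.
move=> x0; apply: differentiable_continuous; apply/derivable1_diffP.
have dx := is_derive1_powR p x0; exact: ex_derive.
Qed.

Lemma continuous_expRN (x : R) : {for x, continuous (fun t => expR (- t))}.
Proof.
apply: differentiable_continuous; apply/derivable1_diffP; exact: ex_derive.
Qed.

Definition gamma_weight (p : R) : R -> R := fun x => x `^ (p - 1) * expR (- x).
Definition gammaE (p : R) := (\int[leb]_(x in `]0%R, +oo[) (gamma_weight p x)%:E)%E.

Lemma measurable_gamma_weight p : measurable_fun [set: R] (gamma_weight p).
Proof. by apply: measurable_funM => //; exact: measurableT_comp. Qed.

Lemma gamma_weight_gt0 p x : 0 < x -> 0 < gamma_weight p x.
Proof. by move=> x0; rewrite mulr_gt0 ?powR_gt0 ?expR_gt0. Qed.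

Lemma continuous_gamma_weight p x : 0 < x -> {for x, continuous (gamma_weight p)}.
Proof. by move=> x0; apply: cvgM; [exact: continuous_powR|exact: continuous_expRN]. Qed.

Lemma cvg_powR_seq0 (u : nat -> R) (p : R) : 0 < p -> (forall n, 0 < u n) ->
  u n @[n --> \oo] --> 0 -> u n `^ p @[n --> \oo] --> 0.
Proof. by move=> p0 u0 ul; apply: (proj1 (cvg_at_rightP _ _ _) (powR_cvg0 p0)). Qed.

Lemma cvg_powR_expRN (p : R) : n.+2%:R `^ p * expR (- n.+2%:R) @[n --> \oo] --> (0 : R).
Proof.
have [k pk] : exists k, p <= k%:R 
  by exists (Num.bound `|p|); rewrite (le_trans (ler_norm _)) // ltW // archi_boundP.
apply: (@squeeze_cvgr _ _ _ _ (fun=> 0) (fun n => k.+1`!%:R * harmonic n)).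
- near=> n; rewrite mulr_ge0 ?powR_ge0 ?expR_ge0 //=.
  have n0 : 0 < n.+2%:R :> R by rewrite ltr0n.
  rewrite expRN -[_ / _]/(_ * _) ler_pdivrMr ?expR_gt0 //.
  (* From [e^x >= x^(k+1) / (k+1)!] at [x = n + 2], the product is at most
     [x^k e^-x <= (k+1)! / x]. *)
  have E := expR_ge1Dxn k (ltW n0).
  apply: (@le_trans _ _ (n.+2%:R ^+ k)).
    by rewrite -(powR_mulrn k (ltW n0)) ler_powR // ler1n.
  apply: (@le_trans _ _ (k.+1`!%:R * n.+1%:R^-1 * (n.+2%:R ^+ k.+1 / k.+1`!%:R))).
    have -> : k.+1`!%:R * n.+1%:R^-1 * (n.+2%:R ^+ k.+1 / k.+1`!%:R) =
        n.+2%:R ^+ k * (n.+2%:R / n.+1%:R) :> R.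
      have F0 : k.+1`!%:R != 0 :> R by rewrite pnatr_eq0 -lt0n fact_gt0.
      by rewrite exprSr [LHS]mulrC -!mulrA mulKf.
    rewrite ler_peMr ?exprn_ge0 // ?(ltW n0) // ler_pdivlMr ?ltr0n // mul1r ler_nat //.
  rewrite ler_wpM2l ?mulr_ge0 ?invr_ge0 ?ler0n //.
  by apply: le_trans E; rewrite lerDr.
- exact: cvg_cst.
- by rewrite -[X in _ --> X](mulr0 k.+1`!%:R); apply: cvgM; [exact: cvg_cst|exact: cvg_harmonic].
Unshelve. all: by end_near. Qed.

Lemma gammaE_rec (p : R) : 0 < p -> (p%:E * gammaE p = gammaE (p + 1))%E.
Proof.
move=> p0; rewrite /gammaE -ge0_integralZl //; last 3 first.
- by apply/measurable_funTS/measurable_EFinP; exact: measurable_gamma_weight.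
- by move=> x /=; rewrite in_itv /= andbT => x0; rewrite lee_fin ltW // gamma_weight_gt0.
- by rewrite lee_fin ltW.
under eq_integral do rewrite -EFinM.
(* The segments are [[1/(n+2), n+2]]; the shift by 2 makes them nondegenerate from [n = 0] on. *)
apply: (@integral_parts_vanishing R _ (fun n => n.+2%:R^-1) (fun n => n.+2%:R)
  (fun x => x `^ p * expR (- x)) (fun x => p * gamma_weight p x) (gamma_weight (p + 1))).
- apply/seteqP; split => x /=.
    rewrite in_itv /= andbT => x0.
    exists (maxn (Num.bound x) (Num.bound x^-1)) => //=; rewrite in_itv /=.
    have xa : x < (Num.bound x)%:R by rewrite archi_boundP // ltW.
    have xb : x^-1 < (Num.bound x^-1)%:R by rewrite archi_boundP // invr_ge0 ltW.
    apply/andP; split.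
      rewrite invf_ple ?posrE ?ltr0n //; apply: le_trans (ltW xb) _; rewrite ler_nat; lia.
    by apply: le_trans (ltW xa) _; rewrite ler_nat; lia.
  move=> [n _] /=; rewrite !in_itv /= andbT => /andP[nx _].
  by apply: lt_le_trans nx; rewrite invr_gt0 ltr0n.
- by move=> n; apply: (@lt_trans _ _ 1); [rewrite invf_lt1 ?ltr0n ?ltr1n|rewrite ltr1n].
- move=> a b ab; split; last by rewrite ler_nat.
  by rewrite lef_pV2 ?posrE ?ltr0n // ler_nat.
- move=> x /=; rewrite in_itv /= andbT => x0; split.
  + by rewrite mulr_ge0 ?(ltW p0) // ltW // gamma_weight_gt0.
  + by rewrite ltW // gamma_weight_gt0.
  + by apply: cvgM; [exact: cvg_cst|exact: continuous_gamma_weight].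
  + exact: continuous_gamma_weight.
- move=> x /=; rewrite in_itv /= andbT => x0.
  have dp := is_derive1_powR p x0.
  apply: is_derive_eq; rewrite /gamma_weight addrK /GRing.scale /=.
  ring.
- apply: (@squeeze_cvgr _ _ _ _ (fun=> 0) (fun n => n.+2%:R^-1 `^ p)).
  + near=> n; rewrite mulr_ge0 ?powR_ge0 ?expR_ge0 //= ler_piMr ?powR_ge0 //.
  + exact: cvg_cst.
  + apply: cvg_powR_seq0 => //.
    by have := @cvg_harmonic R; rewrite -(cvg_shiftS (@harmonic R)); apply.
- exact: cvg_powR_expRN.
Unshelve. all: by end_near. Qed.

Lemma gammaE1 : gammaE 1 = 1%E.
Proof.
have -> : (gammaE 1 = \int[leb]_(x in `]0%R, +oo[) (expR (- x))%:E)%E.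
  by apply: eq_integral => x _; rewrite /gamma_weight subrr powRr0 mul1r.
rewrite integral_itv_obnd_cbnd; last first.
  by apply/measurable_funTS/measurable_EFinP; exact: measurableT_comp.
rewrite (@ge0_continuous_FTC2y _ _ (fun x => - expR (- x)) _ 0) //.
- by rewrite oppr0 expR0 EFinN oppeK add0e.
- by apply: continuous_in_subspaceT => x _; exact: continuous_expRN.
- by rewrite -oppr0; apply: cvgN; exact: cvgr_expR.
- by apply: cvgN; apply: cvg_at_right_filter; exact: continuous_expRN.
- by move=> x _; rewrite derive1E derive_val /GRing.scale /= mulrN1 opprK.
Qed.

Lemma gammaE_natS n : gammaE n.+1%:R = n`!%:R%:E.
Proof.
elim: n => [|n IHn]; first by rewrite gammaE1.
by rewrite -addn1 natrD -gammaE_rec ?ltr0n // IHn factS natrM EFinM.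
Qed.

Lemma gammaE_ge0 (p : R) : (0 <= gammaE p)%E.
Proof.
apply: integral_ge0 => x /=; rewrite in_itv /= andbT => x0.
by rewrite lee_fin ltW // gamma_weight_gt0.
Qed.

(** The recursion moves the problem to exponent [p], where [x^p <= 1 + x^k] for an integer [k >= p]
    bounds the integral by two factorials. *)
Lemma gammaE_lty (p : R) : 0 < p -> (gammaE p < +oo)%E.
Proof.
move=> p0; suff : (gammaE (p + 1) < +oo)%E.
  rewrite -gammaE_rec //; have := gammaE_ge0 p.
  by case: (gammaE p) => [r _ _||//]; rewrite ?ltry // gt0_muley ?lte_fin.
pose k := Num.bound p; have pk : p <= k%:R by rewrite ltW // archi_boundP // ltW.
apply: (@le_lt_trans _ _ (gammaE 1 + gammaE k.+1%:R)%E); last first.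
  by rewrite gammaE1 gammaE_natS -EFinD ltry.
rewrite /gammaE -ge0_integralD //=; first last.
- by apply/measurable_funTS/measurable_EFinP; exact: measurable_gamma_weight.
- by move=> x; rewrite in_itv /= andbT => x0; rewrite lee_fin ltW // gamma_weight_gt0.
- by apply/measurable_funTS/measurable_EFinP; exact: measurable_gamma_weight.
- by move=> x; rewrite in_itv /= andbT => x0; rewrite lee_fin ltW // gamma_weight_gt0.
apply: ge0_le_integral => //=.
- by move=> x; rewrite in_itv /= andbT => x0; rewrite lee_fin ltW // gamma_weight_gt0.
- by apply/measurable_funTS/measurable_EFinP; exact: measurable_gamma_weight.
- apply/measurable_funTS; apply: emeasurable_funD;
    apply/measurable_EFinP; exact: measurable_gamma_weight.
move=> x; rewrite in_itv /= andbT => x0; rewrite -EFinD lee_fin /gamma_weight -mulrDl.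
rewrite ler_wpM2r ?expR_ge0 // subrr powRr0 addrK -addn1 natrD addrK.
have [x1|x1] := leP 1 x.
  by apply: (@le_trans _ _ (x `^ k%:R)); [exact: ler_powR|rewrite lerDr].
apply: (@le_trans _ _ 1); last by rewrite lerDl powR_ge0.
have : x `^ p <= 1 `^ p.
  by apply: (ge0_ler_powR (ltW p0)); rewrite ?nnegrE ?(ltW x0) ?(ltW x1).
by rewrite powR1.
Qed.

Lemma gammaE_addn (p : R) n : 0 < p ->
  gammaE (p + n%:R) = ((\prod_(i < n) (p + i%:R))%:E * gammaE p)%E.
Proof.
move=> p0; elim: n => [|n IHn]; first by rewrite addr0 big_ord0 mul1e.
rewrite -addn1 natrD addrA -gammaE_rec ?ltr_wpDr // IHn addn1 big_ord_recr /= muleA -EFinM.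
by rewrite [(p + n%:R) * _]mulrC.
Qed.

Let gpos (x : R) : `]0%R, +oo[%classic x -> 0 < x.
Proof. by rewrite /= in_itv /= andbT. Qed.

Let gamma_pow (p : R) n (x : R) : 0 < p -> 0 < x ->
  x ^+ n * gamma_weight p x = gamma_weight (p + n%:R) x.
Proof.
move=> p0 x0; rewrite /gamma_weight mulrA; congr (_ * _).
rewrite -(powR_mulrn n (ltW x0)) -powRD; last by apply/implyP => _; rewrite gt_eqF.
by congr (x `^ _); ring.
Qed.

Lemma gamma_dist_moments (p : R) : 0 < p ->
  forall n, moment (gamma_dist p) n = \prod_(i < n) (p + i%:R).
Proof.
move=> p0 n; have wI j : (\int[leb]_(x in `]0%R, +oo[) (x ^+ j * gamma_weight p x)%:E =
    gammaE (p + j%:R))%E.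
  by apply: eq_integral => x /set_mem/gpos x0; rewrite gamma_pow.
have L0 : leb `]0%R, +oo[ != 0%E by rewrite lebesgue_measure_itv /= ltry.
rewrite (@density_moment R `]0%R, +oo[ (gamma_weight p)) //.
- rewrite wI gammaE_addn //.
  have gf : gammaE p \is a fin_num by rewrite ge0_fin_numE ?gammaE_ge0 ?gammaE_lty.
  rewrite fineM // mulfK //; apply/eqP => g0.
  have := integral_pos_neq0 _ L0 (measurable_funTS (measurable_gamma_weight p))
     (fun x Dx => gamma_weight_gt0 p (gpos Dx)).
  rewrite -/(gammaE p) -[gammaE p]fineK //.
  by move=> /(_ _)/negP; apply => //; rewrite [fine _]g0.
- by move=> x /gpos/ltW.
- exact: measurable_gamma_weight.
- by move=> x /gpos; exact: gamma_weight_gt0.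
- by move=> j; rewrite wI gammaE_lty // ltr_wpDr.
Qed.

End EulerGamma.

Section EulerBeta.
Variable R : realType.
Local Notation leb := (@lebesgue_measure R).

Definition beta_weight (p q : R) : R -> R := fun x => x `^ (p - 1) * (1 - x) `^ (q - 1).
Definition betaE (p q : R) := (\int[leb]_(x in `]0%R, 1%R[) (beta_weight p q x)%:E)%E.

Let in01 (x : R) : `]0%R, 1%R[%classic x -> 0 < x /\ 0 < 1 - x.
Proof. by rewrite /= in_itv /= subr_gt0 => /andP. Qed.

Lemma measurable_beta_weight p q : measurable_fun [set: R] (beta_weight p q).
Proof.
apply: measurable_funM => //; apply: (measurableT_comp (measurable_powR (q - 1))).
exact: measurable_funB.
Qed.

Lemma beta_weight_gt0 p q x : 0 < x -> 0 < 1 - x -> 0 < beta_weight p q x.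
Proof. by move=> x0 x1; rewrite mulr_gt0 ?powR_gt0. Qed.

Lemma is_derive_powR_onem (q x : R) : 0 < 1 - x ->
  is_derive x (1:R) (fun t => (1 - t) `^ q) (- (q * (1 - x) `^ (q - 1))).
Proof.
move=> x1; have dq := is_derive1_powR q x1.
have d1 : is_derive x (1:R) (fun t : R => 1 - t) (-1).
  by apply: is_derive_eq; rewrite add0r mul1r.
have := @is_derive1_comp _ (fun t : R => t `^ q) (fun t : R => 1 - t) x _ _ dq d1.
by rewrite mulrN1.
Qed.

Lemma continuous_beta_weight p q x : 0 < x -> 0 < 1 - x ->
  {for x, continuous (beta_weight p q)}.
Proof.
move=> x0 x1; apply: cvgM; first exact: continuous_powR.
suff : {for x, continuous (fun t : R => (1 - t) `^ (q - 1))} by [].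
apply: differentiable_continuous; apply/derivable1_diffP.
have dx := is_derive_powR_onem (q - 1) x1; exact: ex_derive.
Qed.

Lemma betaE_ge0 p q : (0 <= betaE p q)%E.
Proof.
by apply: integral_ge0 => x /in01[x0 x1]; rewrite lee_fin ltW // beta_weight_gt0.
Qed.

Let mbE p q : measurable_fun (`]0%R, 1%R[%classic : set R) (EFin \o beta_weight p q).
Proof. by apply/measurable_funTS/measurable_EFinP; exact: measurable_beta_weight. Qed.

Let cvg3 : n.+3%:R^-1 @[n --> \oo] --> (0 : R).
Proof.
have := @cvg_harmonic R; rewrite -(cvg_shiftS (@harmonic R)).
by rewrite -(cvg_shiftS (fun n => @harmonic R n.+1)); apply.
Qed.

Let powR_le1 (x s : R) : 0 <= x -> x <= 1 -> 0 <= s -> x `^ s <= 1.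
Proof.
move=> x0 x1 s0; have : x `^ s <= 1 `^ s by apply: (ge0_ler_powR s0); rewrite ?nnegrE.
by rewrite powR1.
Qed.

Let betaEZ (c p q : R) : 0 <= c ->
  (c%:E * betaE p q = \int[leb]_(x in `]0%R, 1%R[) (c * beta_weight p q x)%:E)%E.
Proof.
move=> c0; rewrite /betaE -ge0_integralZl //; first exact: mbE.
by move=> x /in01[x0 x1]; rewrite lee_fin ltW // beta_weight_gt0.
Qed.

Lemma beta_parts (p q : R) : 0 < p -> 0 < q ->
  (p%:E * betaE p (q + 1) = q%:E * betaE (p + 1) q)%E.
Proof.
move=> p0 q0; rewrite !betaEZ ?(ltW p0) ?(ltW q0) //.
(* The shift by 3 keeps [1/(n+3)] below [1/2], so that the left end precedes the right one. *)
apply: (@integral_parts_vanishing R _ (fun n => n.+3%:R^-1) (fun n => 1 - n.+3%:R^-1)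
  (fun x => x `^ p * (1 - x) `^ q) (fun x => p * beta_weight p (q + 1) x)
  (fun x => q * beta_weight (p + 1) q x)).
- apply/seteqP; split => x /=.
    move=> /in01[x0 x1].
    exists (maxn (Num.bound x^-1) (Num.bound (1 - x)^-1)) => //=; rewrite in_itv /=.
    have xa : x^-1 < (Num.bound x^-1)%:R by rewrite archi_boundP // invr_ge0 ltW.
    have xb : (1 - x)^-1 < (Num.bound (1 - x)^-1)%:R by rewrite archi_boundP // invr_ge0 ltW.
    apply/andP; split.
      rewrite invf_ple ?posrE ?ltr0n //; apply: le_trans (ltW xa) _; rewrite ler_nat; lia.
    rewrite lerBrDl -lerBrDr.
    rewrite invf_ple ?posrE ?ltr0n //; apply: le_trans (ltW xb) _; rewrite ler_nat; lia.
  move=> [n _] /=; rewrite !in_itv /= => /andP[nx xn].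
  have n0 : 0 < n.+3%:R^-1 :> R by rewrite invr_gt0 ltr0n.
  by rewrite (lt_le_trans n0 nx) (le_lt_trans xn) // gtrBl.
- move=> n; have : n.+3%:R^-1 < 2^-1 :> R by rewrite ltf_pV2 ?posrE ?ltr0n // ltr_nat.
  by move: (_ ^-1) => y; lra.
- move=> a b ab; have ba : b.+3%:R^-1 <= a.+3%:R^-1 :> R.
    by rewrite lef_pV2 ?posrE ?ltr0n // ler_nat.
  by split; rewrite // lerB.
- move=> x /in01[x0 x1]; split.
  + by rewrite mulr_ge0 ?(ltW p0) // ltW // beta_weight_gt0.
  + by rewrite mulr_ge0 ?(ltW q0) // ltW // beta_weight_gt0.
  + by apply: cvgM; [exact: cvg_cst|exact: continuous_beta_weight].
  + by apply: cvgM; [exact: cvg_cst|exact: continuous_beta_weight].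
- move=> x /in01[x0 x1].
  have dp := is_derive1_powR p x0; have dq := is_derive_powR_onem q x1.
  apply: is_derive_eq; rewrite /beta_weight !addrK /GRing.scale /=.
  ring.
- apply: (@squeeze_cvgr _ _ _ _ (fun=> 0) (fun n => n.+3%:R^-1 `^ p)).
  + near=> n; rewrite mulr_ge0 ?powR_ge0 //= ler_piMr ?powR_ge0 //.
    apply: powR_le1 (ltW q0); last by rewrite gerBl invr_ge0.
    by rewrite subr_ge0 invf_le1 ?ltr0n // ler1n.
  + exact: cvg_cst.
  + apply: cvg_powR_seq0 => //; exact: cvg3.
- apply: (@squeeze_cvgr _ _ _ _ (fun=> 0) (fun n => n.+3%:R^-1 `^ q)).
  + near=> n; rewrite mulr_ge0 ?powR_ge0 //= subKr ler_piMl ?powR_ge0 //.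
    apply: powR_le1 (ltW p0); last by rewrite gerBl invr_ge0.
    by rewrite subr_ge0 invf_le1 ?ltr0n // ler1n.
  + exact: cvg_cst.
  + apply: cvg_powR_seq0 => //; exact: cvg3.
Unshelve. all: by end_near. Qed.

(** Writing [1 = (1 - x) + x] splits [B(p, q)] into [B(p, q+1) + B(p+1, q)], and integration by
    parts turns the first summand into a multiple of the second. *)
Lemma betaE_rec (p q : R) : 0 < p -> 0 < q ->
  (p%:E * betaE p q = (p + q)%:E * betaE (p + 1) q)%E.
Proof.
move=> p0 q0.
have -> : (betaE p q = betaE p (q + 1) + betaE (p + 1) q)%E.
  have w0 s t : forall x : R, `]0%R, 1%R[%classic x -> (0 <= (beta_weight s t x)%:E)%E.
    by move=> x /in01[x0 x1]; rewrite lee_fin ltW // beta_weight_gt0.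
  rewrite /betaE -ge0_integralD //; [|exact: w0|exact: mbE|exact: w0|exact: mbE].
  apply: eq_integral => x /set_mem/in01[x0 x1]; rewrite -EFinD; congr EFin.
  rewrite /beta_weight !addrK -(mulr_powRB1 (ltW x0) p0) -(mulr_powRB1 (ltW x1) q0).
  ring.
rewrite ge0_muleDr ?betaE_ge0 // beta_parts // addeC EFinD ge0_muleDl ?lee_fin ?ltW //.
Qed.

(** For [q >= 1] the weight with exponents [p] and [q - 1] is at most 1, and the recursion comes
    back from [p + 1] to [p]. The range [q >= 1] suffices for the limit in [q]. *)
Lemma betaE_lty (p q : R) : 0 < p -> 1 <= q -> (betaE p q < +oo)%E.
Proof.
move=> p0 q1; have q0 : 0 < q := lt_le_trans ltr01 q1.
suff : (betaE (p + 1) q < +oo)%E.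
  have pq0 : 0 < p + q by rewrite addr_gt0.
  move=> h; have : (p%:E * betaE p q < +oo)%E.
    by rewrite betaE_rec // lte_mul_pinfty ?lee_fin ?(ltW pq0).
  have := betaE_ge0 p q.
  by case: (betaE p q) => [r _ _||//]; rewrite ?ltry // gt0_muley ?lte_fin.
apply: (@le_lt_trans _ _ (\int[leb]_(x in `]0%R, 1%R[) (cst 1%E x))%E).
  apply: ge0_le_integral => //.
  - by move=> x /in01[x0 x1]; rewrite lee_fin ltW // beta_weight_gt0.
  - exact: mbE.
  - move=> x /in01[x0 x1]; rewrite lee_fin /beta_weight addrK.
    by rewrite mulr_ile1 ?powR_ge0 ?powR_le1 //; move: x0 x1 p0 q1; lra.
by rewrite integral_cst //= lebesgue_measure_itv /= lte01 sube0 mule1 ltry.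
Qed.

Lemma betaE_addn (p q : R) n : 0 < p -> 0 < q ->
  betaE (p + n%:R) q = ((\prod_(i < n) ((p + i%:R) / (p + q + i%:R)))%:E * betaE p q)%E.
Proof.
move=> p0 q0; elim: n => [|n IHn]; first by rewrite addr0 big_ord0 mul1e.
have pn : 0 < p + n%:R by rewrite ltr_wpDr.
have pqn : 0 < p + q + n%:R by rewrite ltr_wpDr // addr_gt0.
have := betaE_rec pn q0; rewrite IHn -addrA -natr1 addrA => E.
rewrite big_ord_recr /= mulrC EFinM -muleA.
rewrite [((p + n%:R) / _)]mulrC EFinM -muleA -[in RHS]/(betaE p q) E.
rewrite muleA -EFinM addrAC mulVf ?mul1e; last by rewrite gt_eqF.
by rewrite addrA.
Qed.

Let beta_pow (p q : R) n (x : R) : 0 < x ->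
  x ^+ n * beta_weight p q x = beta_weight (p + n%:R) q x.
Proof.
move=> x0; rewrite /beta_weight mulrA; congr (_ * _).
rewrite -(powR_mulrn n (ltW x0)) -powRD; last by apply/implyP => _; rewrite gt_eqF.
by congr (x `^ _); ring.
Qed.

Let wI (p q : R) j : (\int[leb]_(x in `]0%R, 1%R[) (x ^+ j * beta_weight p q x)%:E =
    betaE (p + j%:R) q)%E.
Proof. by apply: eq_integral => x /set_mem/in01[x0 _]; rewrite beta_pow. Qed.

Let L0 : leb `]0%R, 1%R[ != 0%E.
Proof. by rewrite lebesgue_measure_itv /= lte01 sube0 onee_neq0. Qed.

Let wfin (p q : R) : 0 < p -> 1 <= q -> forall n,
  (\int[leb]_(x in `]0%R, 1%R[) (x ^+ n * beta_weight p q x)%:E < +oo)%E.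
Proof. by move=> p0 q1 n; rewrite wI betaE_lty // ltr_wpDr. Qed.

Lemma beta_dist_moments (p q : R) : 0 < p -> 1 <= q ->
  forall n, moment (beta_dist p q) n = \prod_(i < n) ((p + i%:R) / (p + q + i%:R)).
Proof.
move=> p0 q1 n; have q0 : 0 < q := lt_le_trans ltr01 q1.
rewrite (@density_moment R `]0%R, 1%R[ (beta_weight p q)) //.
- rewrite wI betaE_addn //.
  have gf : betaE p q \is a fin_num by rewrite ge0_fin_numE ?betaE_ge0 ?betaE_lty.
  rewrite fineM // mulfK //; apply/eqP => g0.
  have := integral_pos_neq0 _ L0 (measurable_funTS (measurable_beta_weight p q))
     (fun x Dx => beta_weight_gt0 p q (in01 Dx).1 (in01 Dx).2).
  rewrite -/(betaE p q) -[betaE p q]fineK //.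
  by move=> /(_ _)/negP; apply => //; rewrite [fine _]g0.
- by move=> x /in01[/ltW].
- exact: measurable_beta_weight.
- by move=> x /in01[]; exact: beta_weight_gt0.
- exact: wfin.
Qed.

Lemma beta_dist_total_mass (p q : R) : 0 < p -> 1 <= q ->
  (beta_dist p q : Rmeasure R) setT = 1%E.
Proof.
move=> p0 q1; apply: (@density_total_mass R `]0%R, 1%R[ (beta_weight p q)) => //.
- exact: measurable_beta_weight.
- by move=> x /in01[]; exact: beta_weight_gt0.
- exact: wfin.
Qed.

Lemma beta_dist_Rintegrable (p q : R) : 0 < p -> 1 <= q ->
  forall n, Rintegrable (beta_dist p q) (fun x => x ^+ n).
Proof.
move=> p0 q1; apply: (@density_Rintegrable R `]0%R, 1%R[ (beta_weight p q)) => //.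
- by move=> x /in01[/ltW].
- exact: measurable_beta_weight.
- by move=> x /in01[]; exact: beta_weight_gt0.
- exact: wfin.
Qed.

End EulerBeta.

(** * Cauchy and Voiculescu transforms *)

Local Open Scope complex_scope.
Import ComplexField.Normc.
Local Notation Re := complex.Re.
Local Notation Im := complex.Im.

Section ComplexModulus.
Variable R : realType.
Implicit Types z w : R[i].

Lemma normc_ge0 z : 0 <= normc z. Proof. by case: z => a b; exact: sqrtr_ge0. Qed.

Lemma normc_sqr z : normc z ^+ 2 = Re z ^+ 2 + Im z ^+ 2.
Proof. by case: z => a b /=; rewrite sqr_sqrtr // addr_ge0 ?sqr_ge0. Qed.

Lemma le_Re_normc z : `|Re z| <= normc z.
Proof.
rewrite -(@ler_pXn2r _ 2) ?nnegrE ?normc_ge0 // normc_sqr real_normK ?num_real //.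
by rewrite lerDl sqr_ge0.
Qed.

Lemma le_Im_normc z : `|Im z| <= normc z.
Proof.
rewrite -(@ler_pXn2r _ 2) ?nnegrE ?normc_ge0 // normc_sqr real_normK ?num_real //.
by rewrite lerDr sqr_ge0.
Qed.

Lemma normc_le z : normc z <= `|Re z| + `|Im z|.
Proof.
rewrite -(@ler_pXn2r _ 2) ?nnegrE ?normc_ge0 ?addr_ge0 // normc_sqr.
rewrite sqrrD !real_normK ?num_real // mulr2n.
have := mulr_ge0 (normr_ge0 (Re z)) (normr_ge0 (Im z)); lra.
Qed.

Lemma normcD z w : normc (z + w) <= normc z + normc w.
Proof. exact: le_normcD. Qed.

Lemma normcB z w : normc (z - w) <= normc z + normc w.
Proof. by rewrite -[normc w]normcN; exact: normcD. Qed.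

Lemma normc_gt0 z : (0 < normc z) = (z != 0).
Proof.
rewrite lt_def normc_ge0 andbT; congr negb; apply/eqP/eqP => [|->].
  exact: eq0_normc.
exact: normc0.
Qed.

Lemma normcX z n : normc (z ^+ n) = normc z ^+ n.
Proof.
elim: n => [|n IHn]; first by rewrite !expr0 normc1.
by rewrite !exprS normcM IHn.
Qed.

Lemma normc_real (x : R) : normc x%:C = `|x|.
Proof. by rewrite /= expr0n /= addr0 sqrtr_sqr. Qed.

End ComplexModulus.

Section CauchyTransform.
Variables (R : realType) (mu : Rmeasure R).
Hypothesis mu1 : mu setT = 1%E.
Implicit Types z w : R[i].

Let finmu : (mu setT < +oo)%E. Proof. by rewrite mu1 ltry. Qed.

Lemma bounded_Rintegrable (f : R -> R) (M : R) : measurable_fun [set: measurableTypeR R] f ->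
  (forall x, `|f x| <= M) -> Rintegrable mu f.
Proof.
move=> mf fM; apply: measurable_bounded_integrable => //.
by exists M; split; rewrite ?num_real // => y My x _; exact: le_trans (fM x) (ltW My).
Qed.

Definition Cintegrable (f : R -> R[i]) :=
  Rintegrable mu (fun x => Re (f x)) /\ Rintegrable mu (fun x => Im (f x)).

Definition Cintegral (f : R -> R[i]) : R[i] :=
  (\int[mu]_x Re (f x)) +i* (\int[mu]_x Im (f x)).

Lemma CintegralD f g : Cintegrable f -> Cintegrable g ->
  Cintegral (fun x => f x + g x) = Cintegral f + Cintegral g.
Proof.
move=> [rf If] [rg ig]; rewrite /Cintegral; simpc.
by congr (_ +i* _); rewrite -RintegralD //; apply: eq_Rintegral => x _; rewrite raddfD.
Qed.

Lemma CintegralZ (c : R[i]) f : Cintegrable f ->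
  Cintegral (fun x => c * f x) = c * Cintegral f.
Proof.
case: c => a b [rf If]; rewrite /Cintegral; simpc.
have -> : \int[mu]_x Re ((a +i* b) * f x) =
    a * \int[mu]_x Re (f x) - b * \int[mu]_x Im (f x).
  rewrite -!RintegralZl // -RintegralB //; try exact: RintegrableZ.
  by apply: eq_Rintegral => x _; case: (f x).
have -> // : \int[mu]_x Im ((a +i* b) * f x) =
    a * \int[mu]_x Im (f x) + b * \int[mu]_x Re (f x).
rewrite -!RintegralZl // -RintegralD //; try exact: RintegrableZ.
by apply: eq_Rintegral => x _; case: (f x).
Qed.

Lemma CintegrableD f g : Cintegrable f -> Cintegrable g ->
  Cintegrable (fun x => f x + g x).
Proof.
move=> [rf If] [rg ig]; split.
  by rewrite (_ : (fun x => _) = (fun x => Re (f x)) \+ (fun x => Re (g x)));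
    [exact: RintegrableD|apply/funext => x; rewrite raddfD].
by rewrite (_ : (fun x => _) = (fun x => Im (f x)) \+ (fun x => Im (g x)));
  [exact: RintegrableD|apply/funext => x; rewrite raddfD].
Qed.

Lemma CintegrableZ (c : R[i]) f : Cintegrable f -> Cintegrable (fun x => c * f x).
Proof.
case: c => a b [rf If]; split.
  rewrite (_ : (fun x => _) = (fun x => a * Re (f x)) \- (fun x => b * Im (f x))).
    by apply: RintegrableB; exact: RintegrableZ.
  by apply/funext => x /=; case: (f x).
rewrite (_ : (fun x => _) = (fun x => a * Im (f x)) \+ (fun x => b * Re (f x))).
  by apply: RintegrableD; exact: RintegrableZ.
by apply/funext => x /=; case: (f x).
Qed.

Lemma Cintegrable_real (f : R -> R) : Rintegrable mu f -> Cintegrable (fun x => (f x)%:C).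
Proof.
move=> fi; split => //; apply: (@bounded_Rintegrable _ 0) => [|x /=].
  exact: measurable_cst.
by rewrite normr0.
Qed.

Lemma Cintegral_real (f : R -> R) : Rintegrable mu f ->
  Cintegral (fun x => (f x)%:C) = (\int[mu]_x f x)%:C.
Proof. by move=> fi; rewrite /Cintegral /= Rintegral_cst // mul0r. Qed.

(** The factor 2 comes from estimating real and imaginary parts separately. *)
Lemma normc_Cintegral_le f (g : R -> R) : Cintegrable f -> Rintegrable mu g ->
  (forall x, normc (f x) <= g x) -> normc (Cintegral f) <= 2 * \int[mu]_x g x.
Proof.
move=> [rf If] ig fg; apply: le_trans (normc_le _) _ => /=.
rewrite mulr_natl mulr2n; apply: lerD; apply: le_trans (le_normr_Rintegral _ _) _ => //;
  apply: le_Rintegral => //; try exact: Rintegrable_norm.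
  by move=> x _; rewrite (le_trans (le_Re_normc _)).
by move=> x _; rewrite (le_trans (le_Im_normc _)).
Qed.

Lemma complex_ReV z : Re z^-1 = Re z / (Re z ^+ 2 + Im z ^+ 2).
Proof. by case: z. Qed.

Lemma complex_ImV z : Im z^-1 = - Im z / (Re z ^+ 2 + Im z ^+ 2).
Proof. by case: z => a b /=; rewrite mulNr. Qed.

Lemma sub_real_neq0 z (x : R) : 0 < Im z -> z - x%:C != 0.
Proof.
case: z => a b /= b0; apply/negP => /eqP; simpc => -[_ /eqP].
by rewrite gt_eqF.
Qed.

Lemma Im_le_normc z (x : R) : 0 < Im z -> Im z <= normc (z - x%:C).
Proof.
move=> z0; apply: le_trans (le_Im_normc _).
by rewrite raddfB /= subr0 ler_norm.
Qed.

Lemma normc_kernel_le z (x : R) : 0 < Im z -> normc (z - x%:C)^-1 <= (Im z)^-1.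
Proof.
move=> z0; rewrite normcV lef_pV2 ?posrE //; first exact: Im_le_normc.
by rewrite normc_gt0 sub_real_neq0.
Qed.

Lemma measurable_Re_kernel z : measurable_fun [set: measurableTypeR R]
  (fun x => Re (z - x%:C)^-1).
Proof.
under eq_fun do rewrite complex_ReV !raddfB /= subr0.
apply: measurable_funM; first exact: measurable_funB.
apply: measurable_funV_ge0 => [|x]; last by rewrite addr_ge0 ?sqr_ge0.
by apply: measurable_funD => //; apply: measurable_funX; exact: measurable_funB.
Qed.

Lemma measurable_Im_kernel z : measurable_fun [set: measurableTypeR R]
  (fun x => Im (z - x%:C)^-1).
Proof.
under eq_fun do rewrite complex_ImV !raddfB /= subr0.
apply: measurable_funM => //.
apply: measurable_funV_ge0 => [|x]; last by rewrite addr_ge0 ?sqr_ge0.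
by apply: measurable_funD => //; apply: measurable_funX; exact: measurable_funB.
Qed.

Lemma Cintegrable_kernel z (f : R -> R) : 0 < Im z -> Rintegrable mu f ->
  Cintegrable (fun x => (f x)%:C * (z - x%:C)^-1).
Proof.
move=> z0 fi; have mf := Rintegrable_measurable fi.
have fZ : Rintegrable mu (fun x => (Im z)^-1 * `|f x|).
  by apply: RintegrableZ; exact: Rintegrable_norm.
have Re_c (a : R) w : Re (a%:C * w) = a * Re w by case: w => c d /=; rewrite mul0r subr0.
have Im_c (a : R) w : Im (a%:C * w) = a * Im w by case: w => c d /=; rewrite mul0r addr0.
split; (apply: le_Rintegrable fZ => [|x]).
- under eq_fun do rewrite Re_c; apply: measurable_funM => //.
  exact: measurable_Re_kernel.
- rewrite Re_c normrM mulrC ler_wpM2r // (le_trans (le_Re_normc _)) //.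
  exact: normc_kernel_le.
- under eq_fun do rewrite Im_c; apply: measurable_funM => //.
  exact: measurable_Im_kernel.
- rewrite Im_c normrM mulrC ler_wpM2r // (le_trans (le_Im_normc _)) //.
  exact: normc_kernel_le.
Qed.

Local Notation G := (cauchy_transform mu).

Lemma cauchy_transformE z : G z = Cintegral (fun x => (1:R)%:C * (z - x%:C)^-1).
Proof. by rewrite /cauchy_transform /Cintegral; congr (_ +i* _);
  apply: eq_Rintegral => x _; rewrite mul1r. Qed.

Let int1 : Rintegrable mu (fun=> 1).
Proof. by apply: (@bounded_Rintegrable _ 1) => // x; rewrite normr1. Qed.

(** This is the finite geometric expansion of [1 / (z - x)] in powers of [x / z], integrated with
    its exact remainder. *)
Lemma cauchy_expansion K z : 0 < Im z ->
  (forall n, Rintegrable mu (fun x => x ^+ n)) ->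
  G z - \sum_(k < K) (moment mu k)%:C * z^-1 ^+ k.+1 =
  z^-1 ^+ K * Cintegral (fun x => (x ^+ K)%:C * (z - x%:C)^-1).
Proof.
move=> z0 mom; have zn0 : z != 0 by have := sub_real_neq0 0 z0; rewrite subr0.
elim: K => [|K IHK].
  rewrite big_ord0 subr0 expr0 mul1r cauchy_transformE; congr Cintegral.
rewrite big_ord_recr /= opprD addrA IHK.
have -> : Cintegral (fun x => (x ^+ K.+1)%:C * (z - x%:C)^-1) =
    z * Cintegral (fun x => (x ^+ K)%:C * (z - x%:C)^-1) - (moment mu K)%:C.
  have iK := Cintegrable_kernel z0 (mom K).
  rewrite -CintegralZ // -mulN1r -[(moment mu K)%:C]Cintegral_real //.
  rewrite -CintegralZ; last exact: Cintegrable_real.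
  rewrite -CintegralD; last exact: CintegrableZ (Cintegrable_real (mom K)).
    congr Cintegral; apply/funext => x; have zx := sub_real_neq0 x z0.
    rewrite exprS rmorphM; field; exact: zx.
  exact: CintegrableZ.
by rewrite mulrBr exprSr -mulrA mulKf // [X in _ - X]mulrC.
Qed.

Lemma cauchy_remainder_le K z : 0 < Im z ->
  (forall n, Rintegrable mu (fun x => x ^+ n)) ->
  normc (G z - \sum_(k < K) (moment mu k)%:C * z^-1 ^+ k.+1) <=
  2 * (\int[mu]_x `|x ^+ K|) * (Im z)^-1 * (normc z)^-1 ^+ K.
Proof.
move=> z0 mom; rewrite cauchy_expansion // normcM normcX normcV mulrC.
rewrite ler_wpM2r ?exprn_ge0 ?invr_ge0 ?normc_ge0 // -mulrA -RintegralZr //; last first.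
  exact: Rintegrable_norm.
apply: normc_Cintegral_le; first exact: Cintegrable_kernel.
  have := RintegrableZ (Im z)^-1 (Rintegrable_norm (mom K)).
  by apply: eq_integrable => // x _; rewrite /= mulrC.
move=> x; rewrite normcM normc_real ler_wpM2l //.
exact: normc_kernel_le.
Qed.

(* The modulus of [x / (z - x)] is at most [|x| / Im z], and it is bounded on the cone. *)
Lemma cauchy_asymptotics (a e : R) : 0 < a -> 0 < e ->
  exists2 h, 0 < h & forall z, `|Re z| < a * Im z -> h < Im z ->
    normc (z * G z - 1) <= e.
Proof.
(* On the cone [|z| <= (1 + a) Im z] and [Im z <= |z - x|], so [x / (z - x) = z / (z - x) - 1] has
   modulus at most [2 + a]. The minimum [g n] tends to 0 pointwise and is bounded, so its integral
   tends to 0. *)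
move=> a0 e0; pose g (n : nat) (x : R) := Num.min (2 + a) (`|x| / n.+1%:R).
have a2 : 0 <= 2 + a by rewrite addr_ge0 // ltW.
have g0 n x : 0 <= g n x by rewrite le_min a2 divr_ge0.
have ga n x : g n x <= 2 + a by rewrite ge_min lexx.
have mg n : measurable_fun [set: measurableTypeR R] (g n).
  apply: measurable_minr; first exact: measurable_cst.
  by apply: measurable_funM => //; exact: measurable_cst.
have gi n : Rintegrable mu (g n).
  by apply: (@bounded_Rintegrable _ (2 + a)) => // x; rewrite ger0_norm.
have : \int[mu]_x g n x @[n --> \oo] --> \int[mu]_x (0 : R).
  apply: (@Rdominated_cvg _ _ _ _ _ _ (fun=> 2 + a)) => //.
  - move=> x; apply: (@squeeze_cvgr _ _ _ _ (fun=> 0) (fun n => `|x| * harmonic n)).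
    + by near=> n; rewrite g0 ge_min lexx orbT.
    + exact: cvg_cst.
    + by rewrite -[X in _ --> X](mulr0 `|x|); apply: cvgM; [exact: cvg_cst|exact: cvg_harmonic].
  - by apply: (@bounded_Rintegrable _ (2 + a)) => // x; rewrite ger0_norm // addr_ge0 ?ltW.
  - by move=> n x; rewrite ger0_norm.
rewrite Rintegral_cst // mul0r => /cvgr_le/(_ (e / 2)) => /(_ ltac:(by rewrite divr_gt0)).
move=> [n _ /(_ n (leqnn n)) /= gn].
exists n.+1%:R; first by rewrite ltr0n.
move=> z za zn; have z0 : 0 < Im z by rewrite (lt_trans _ zn) // ltr0n.
have iz := Cintegrable_kernel z0 int1.
have i1 := Cintegrable_real int1.
have hE : (fun x => x%:C * (z - x%:C)^-1) =
    (fun x => z * ((1 : R)%:C * (z - x%:C)^-1) + (-1) * (1 : R)%:C).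
  by apply/funext => x; have zx := sub_real_neq0 x z0; field.
have ih : Cintegrable (fun x => x%:C * (z - x%:C)^-1).
  by rewrite hE; apply: CintegrableD; exact: CintegrableZ.
have -> : z * G z - 1 = Cintegral (fun x => x%:C * (z - x%:C)^-1).
  rewrite hE CintegralD; try exact: CintegrableZ.
  rewrite (CintegralZ z iz) (CintegralZ (-1) i1) -cauchy_transformE.
  rewrite Cintegral_real // Rintegral_cst //.
  by rewrite mu1 mulr1 mulN1r.
have normz : normc z <= (1 + a) * Im z.
  apply: le_trans (normc_le z) _; rewrite [`|Im z|]gtr0_norm // mulrDl mul1r addrC.
  by rewrite lerD2l ltW.
apply: le_trans (_ : 2 * \int[mu]_x g n x <= e); last first.
  by rewrite mulrC -ler_pdivlMr.
apply: normc_Cintegral_le => // x; rewrite le_min; apply/andP; split.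
  have -> : x%:C * (z - x%:C)^-1 = z * (z - x%:C)^-1 - 1.
    by have zx := sub_real_neq0 x z0; field.
  apply: le_trans (normcB _ _) _; rewrite normc1 (_ : 2 + a = 1 + a + 1); last by ring.
  rewrite lerD2r.
  rewrite normcM normcV ler_pdivrMr; last by rewrite normc_gt0 sub_real_neq0.
  apply: le_trans normz _; rewrite ler_wpM2l ?addr_ge0 ?(ltW a0) //.
  exact: Im_le_normc.
rewrite normcM normc_real ler_wpM2l //.
apply: le_trans (normc_kernel_le x z0) _.
by rewrite lef_pV2 ?posrE ?ltr0n // ltW.
Unshelve. all: by end_near. Qed.

(** [- Im G(z)] is the integral of [Im z / |z - x|^2], and [|z - x|^2 <= 2 |z|^2 + 2 x^2]. The bound
    serves to exclude that the inverse of [F] remains bounded near infinity. *)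
Lemma cauchy_transform_gt0 (b W : R) : 0 < b ->
  exists2 c, 0 < c & forall z, b < Im z -> normc z <= W -> c <= normc (G z).
Proof.
move=> b0; pose f (x : R) := b / (2 * W ^+ 2 + 2 * x ^+ 2 + 1).
have den0 (x : R) : 0 < 2 * W ^+ 2 + 2 * x ^+ 2 + 1.
  by have := sqr_ge0 W; have := sqr_ge0 x; lra.
have f0 x : 0 < f x by rewrite divr_gt0.
have mf : measurable_fun [set: measurableTypeR R] f.
  apply: measurable_funM => //; apply: measurable_funV_ge0 => [|x]; last exact: ltW.
  apply: measurable_funD => //; apply: measurable_funD => //.
  by apply: measurable_funM => //; exact: measurable_funX.
have fi : Rintegrable mu f.
  apply: (@bounded_Rintegrable _ b) => // x; rewrite gtr0_norm //.
  rewrite ler_pdivrMr // ler_peMr ?(ltW b0) //.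
  by have := sqr_ge0 W; have := sqr_ge0 x; lra.
exists (\int[mu]_x f x).
  rewrite lt_def Rintegral_ge0 ?andbT => [|x _]; last exact: ltW.
  apply/eqP => If0; have mfE : measurable_fun [set: measurableTypeR R] (EFin \o f).
    exact/measurable_EFinP.
  have /(ae_eq_integral_abs mu measurableT mfE) : (\int[mu]_x `|(EFin \o f) x| = 0)%E.
    have -> : (fun x : measurableTypeR R => `|(EFin \o f) x|%E) = EFin \o f.
      by apply/funext => x; rewrite /= ger0_norm // ltW.
    by rewrite -[LHS]fineK ?[fine _]If0 // integrable_fin_num.
  move=> [N [mN N0 fN]]; have NT : N = setT.
    apply/seteqP; split => // x _; apply: fN => /= /(_ I) [] f0x.
    by have := f0 x; rewrite f0x ltxx.
  by move: N0; rewrite NT mu1 => -[] /eqP; rewrite oner_eq0.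
move=> z bz zW; have z0 : 0 < Im z := lt_trans b0 bz.
apply: le_trans (le_Im_normc _).
rewrite cauchy_transformE /=.
have [_ iz] := Cintegrable_kernel z0 int1.
rewrite ler_normr; apply/orP; right.
rewrite -mulN1r -RintegralZl //.
apply: le_Rintegral => //; first exact: RintegrableZ.
move=> x _; rewrite mul1r complex_ImV !raddfB /= subr0.
have -> : -1 * ((- Im z - - 0) / ((Re z - x) ^+ 2 + Im z ^+ 2)) =
    Im z / ((Re z - x) ^+ 2 + Im z ^+ 2) by ring.
have D0 : 0 < (Re z - x) ^+ 2 + Im z ^+ 2 by rewrite ltr_wpDl ?sqr_ge0 // exprn_gt0.
apply: ler_pM; rewrite ?invr_ge0; [exact: ltW|exact: ltW|exact: ltW|].
rewrite lef_pV2 ?posrE //.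
have : normc z ^+ 2 <= W ^+ 2.
  by apply: lerXn2r => //; rewrite nnegrE ?normc_ge0 // (le_trans (normc_ge0 z)).
by rewrite normc_sqr; have := sqr_ge0 (Re z + x); nra.
Qed.

End CauchyTransform.

(** * Neighbourhoods of infinity in cones *)

Section ConeFilter.
Variable R : realType.
Implicit Types (z w : R[i]) (P : set R[i]) (h : R[i] -> R[i]).

(* Neighbourhoods of infinity along the positive imaginary axis, with apertures
   tending to [0]. *)
Definition cone_infty : set_system R[i] :=
  [set P | exists a b : R, [/\ 0 < a, 0 < b & truncated_cone a b `<=` P]].

Global Instance cone_infty_filter : Filter cone_infty.
Proof.
split.
- by exists 1, 1; split.
- move=> P Q [a [b [a0 b0 PP]]] [a' [b' [a'0 b'0 QQ]]].
  exists (Num.min a a'), (Num.max b b'); split; first by rewrite lt_min a0.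
    by rewrite lt_max b0.
  move=> z []; rewrite gt_max => /andP[bz b'z] az; have z0 := lt_trans b0 bz.
  by split; [apply: PP|apply: QQ]; split => //; apply: lt_le_trans az _;
    rewrite ler_wpM2r ?(ltW z0) // ge_min lexx ?orbT.
- by move=> P Q PQ [a [b [a0 b0 PP]]]; exists a, b; split => // z /PP/PQ.
Qed.

Lemma near_cone (a b : R) : 0 < a -> 0 < b ->
  \forall z \near cone_infty, truncated_cone a b z.
Proof. by move=> a0 b0; exists a, b; split. Qed.

Lemma near_cone_Im (b : R) : \forall z \near cone_infty, b < Im z.
Proof.
have := @near_cone 1 (Num.max b 1) ltr01 _; rewrite lt_max ltr01 orbT => /(_ isT).
by apply: filterS => z [+ _]; rewrite gt_max => /andP[].
Qed.

Lemma near_cone_normc : \forall z \near cone_infty, normc z <= 2 * Im z.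
Proof.
apply: filterS (near_cone ltr01 ltr01) => z [z0 za].
apply: le_trans (normc_le z) _; rewrite [`|Im z|]gtr0_norm ?(lt_trans ltr01) //.
by rewrite mul1r in za; have := ltW za; lra.
Qed.

(** A perturbation of size [o(z)] can leave a given cone from near its boundary; starting from a
    thinner cone prevents this. *)
Lemma near_cone_asymptotic h :
  (forall e, 0 < e -> \forall z \near cone_infty, normc (h z - z) <= e * normc z) ->
  forall P, cone_infty P -> \forall z \near cone_infty, P (h z).
Proof.
move=> hz P [a [b [a0 b0 PP]]].
pose c := Num.min a 1; have c0 : 0 < c by rewrite lt_min a0 ltr01.
have ca : c <= a by rewrite ge_min lexx.
have c1 : c <= 1 by rewrite ge_min lexx orbT.
near=> z; apply: PP.
(* With [|h z - z| <= c/4 Im z] and [|Re z| < c/4 Im z], one gets [|Re (h z)| < c/2 Im z] and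
   [Im (h z) >= 3/4 Im z > b]. *)
have hzz : normc (h z - z) <= c / 8 * normc z by near: z; apply: hz; rewrite divr_gt0.
have z2 : normc z <= 2 * Im z by near: z; exact: near_cone_normc.
have [bz az] : truncated_cone (c / 4) (2 * b) z.
  by near: z; apply: near_cone; rewrite ?divr_gt0 ?mulr_gt0.
have zh : normc (h z - z) <= c / 4 * Im z.
  have c8 : 0 <= c / 8 by rewrite divr_ge0 // ltW.
  by have := ler_wpM2l c8 z2; lra.
have := le_trans (le_Re_normc _) zh; have := le_trans (le_Im_normc _) zh.
rewrite !raddfB /= => /ler_normlP[I1 I2] /ler_normlP[R1 R2].
have z0 : 0 < Im z by apply: lt_trans bz; rewrite mulr_gt0.
have cz : c * Im z <= Im z by rewrite ler_piMl // ltW.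
have [A1 A2] := ltr_normlP _ _ az.
have acI : c * Im (h z) <= a * Im (h z) by rewrite ler_wpM2r //; nra.
split; first by nra.
by rewrite ltr_norml; apply/andP; split; nra.
Unshelve. all: by end_near. Qed.

End ConeFilter.

Arguments cone_infty R : clear implicits.

Section VoiculescuTransform.
Variables (R : realType) (mu : Rmeasure R).
Hypothesis mu1 : mu setT = 1%E.
Local Notation G := (cauchy_transform mu).
Local Notation F := (F_transform mu).
Implicit Types z w : R[i].

Lemma F_transform_asymptotic e : 0 < e ->
  \forall w \near cone_infty R, normc (F w - w) <= e * normc w.
Proof.
(* As [d <= 1/2], the bound [|w G(w) - 1| <= d] keeps [|w G(w)| >= 1/2]; then
   [d <= e/2 <= e |w G(w)|]. *)
move=> e0; pose d := Num.min e 1 / 2.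
have m0 : 0 < Num.min e 1 by rewrite lt_min e0 ltr01.
have d0 : 0 < d by rewrite divr_gt0.
have [h h0 hG] := cauchy_asymptotics mu1 ltr01 d0.
apply: filterS (near_cone ltr01 h0) => w [hw wa].
have wG := hG w wa hw.
have [me m1] : Num.min e 1 <= e /\ Num.min e 1 <= 1 by rewrite !ge_min !lexx orbT.
have wG2 : 1 / 2 <= normc (w * G w).
  have := normcB (w * G w) (w * G w - 1).
  by rewrite subKr normc1 => h1; move: wG h1; rewrite /d; lra.
have wG0 : w * G w != 0 by rewrite -normc_gt0; lra.
have /andP[w0 G0] : (w != 0) && (G w != 0) by rewrite -negb_or -mulf_eq0.
have -> : F w - w = - (w * (w * G w - 1) / (w * G w)).
  by rewrite /F_transform; field; rewrite ?w0 ?G0.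
rewrite normcN [normc (_ / _)]normcM normcV ler_pdivrMr ?normc_gt0 // normcM.
rewrite [e * _]mulrC -mulrA ler_wpM2l ?normc_ge0 //.
apply: le_trans wG _; rewrite /d; nra.
Qed.

Lemma near_F_transform P : cone_infty R P -> \forall w \near cone_infty R, P (F w).
Proof. by apply: near_cone_asymptotic => e; exact: F_transform_asymptotic. Qed.

Lemma voiculescu_inverse phi : voiculescu_transform mu phi ->
  \forall z \near cone_infty R, F (z + phi z) = z.
Proof.
move=> [a [b [a' [b' [[_ _ a'0 b'0] _ Fz]]]]].
by apply: filterS (near_cone a'0 b'0) => z /Fz[].
Qed.

(** With [w = z + phi z] one has [G(w) = 1/z], hence [w G(w) - 1 = phi z / z], which is small once
    [Im w] is large. If [Im w] stayed bounded, so would [w] in its cone, and [|G(w)|] would be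
    bounded below, against [G(w) = 1/z]. *)
Lemma voiculescu_small phi : voiculescu_transform mu phi -> forall e, 0 < e ->
  \forall z \near cone_infty R, normc (phi z) <= e * normc z.
Proof.
move=> [a [b [a' [b' [[a0 b0 a'0 b'0] _ Fz]]]]] e e0.
have [h h0 hG] := cauchy_asymptotics mu1 a0 e0.
have [c c0 cG] := cauchy_transform_gt0 mu1 ((1 + a) * h) b0.
near=> z.
have [[bw aw] Fw] : truncated_cone a b (z + phi z) /\ F (z + phi z) = z.
  by near: z; apply: filterS (near_cone a'0 b'0); exact: Fz.
have cz : c^-1 < Im z by near: z; exact: near_cone_Im.
have z0 : z != 0.
  by apply/eqP => z0; move: cz; rewrite z0 /= ltNge invr_ge0 ltW.
set w := z + phi z in bw aw Fw.
have Gw : G w = z^-1 by rewrite -[G w]invrK -[(G w)^-1]/(F w) Fw.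
have [wh|hw] := leP (Im w) h; last first.
  have := hG w aw hw; rewrite Gw /w mulrDl divff // addrAC subrr add0r.
  by rewrite normcM normcV ler_pdivrMr // normc_gt0.
have wW : normc w <= (1 + a) * h.
  have w0 := lt_trans b0 bw.
  apply: le_trans (normc_le w) _; rewrite [`|Im w|]gtr0_norm //.
  by have := ltW aw; nra.
have := cG w bw wW; rewrite Gw normcV leNgt => /negP; case.
rewrite invf_plt ?posrE ?normc_gt0 //.
by apply: lt_le_trans cz _; apply: le_trans (ler_norm _) (le_Im_normc z).
Unshelve. all: by end_near. Qed.

Lemma near_voiculescu phi P : voiculescu_transform mu phi -> cone_infty R P ->
  \forall z \near cone_infty R, P (z + phi z).
Proof.
move=> Vphi; apply: near_cone_asymptotic => e e0.
by apply: filterS (voiculescu_small Vphi e0) => z; rewrite addrAC subrr add0r.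
Qed.

(** By definition [z + phi z] is a right inverse of [F]. It is also a left inverse near infinity:
    [w] and [F w + phi (F w)] have the same image under [F] and lie in the cone where [F] is
    injective. *)
Lemma voiculescu_F_transform phi : voiculescu_transform mu phi ->
  \forall w \near cone_infty R, F w + phi (F w) = w.
Proof.
move=> /[dup] Vphi [a [b [a' [b' [[a0 b0 a'0 b'0] injF Fz]]]]].
have cab := near_cone a0 b0; have ca'b' := near_cone a'0 b'0.
have Fab := near_F_transform (near_voiculescu Vphi cab).
have Fa'b' := near_F_transform ca'b'.
near=> w.
have wab : truncated_cone a b w by near: w; exact: cab.
have Fwab : truncated_cone a b (F w + phi (F w)) by near: w; exact: Fab.
have Fw : truncated_cone a' b' (F w) by near: w; exact: Fa'b'.
by apply: injF; rewrite ?inE //; have [] := Fz _ Fw.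
Unshelve. all: by end_near. Qed.

(** A left inverse built from [phi] is applied to a right inverse built from [psi]. The result
    identifies the transforms that successive convolutions introduce independently. *)
Lemma voiculescu_unique phi psi : voiculescu_transform mu phi ->
  voiculescu_transform mu psi -> \forall z \near cone_infty R, phi z = psi z.
Proof.
move=> Vphi Vpsi; have := near_voiculescu Vpsi (voiculescu_F_transform Vphi).
move=> H; near=> z; apply: (addrI z).
have Fz : F (z + psi z) = z by near: z; exact: voiculescu_inverse.
by rewrite -{1 2}Fz; near: z.
Unshelve. all: by end_near. Qed.

End VoiculescuTransform.

Lemma voiculescu_dirac0 (R : realType) (mu : Rmeasure R) phi :
  (forall A, measurable A -> mu A = \d_(0 : measurableTypeR R) A) ->
  voiculescu_transform mu phi -> \forall z \near cone_infty R, phi z = 0.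
Proof.
move=> mu0 Vphi.
have F0 w : F_transform mu w = w.
  rewrite /F_transform /cauchy_transform -[RHS]invrK; congr (_ ^-1).
  have mE (f : R -> R) : measurable_fun [set: measurableTypeR R] f -> \int[mu]_x f x = f 0.
    move=> mf; rewrite /Rintegral (eq_measure_integral (\d_(0 : measurableTypeR R))).
      rewrite integral_dirac //; last exact/measurable_EFinP.
      by rewrite diracT mul1e.
    by move=> A mA _; exact: mu0.
  rewrite !mE; [|exact: measurable_Im_kernel|exact: measurable_Re_kernel].
  by rewrite subr0; case: (w^-1).
apply: filterS (voiculescu_inverse Vphi) => z; rewrite F0 => /eqP.
by rewrite -subr_eq0 addrAC subrr add0r => /eqP.
Qed.

Lemma free_convolution_power_voiculescu (R : realType) (nu : Rprobability R) n
    (rho : Rmeasure R) phi psi : rho setT = 1%E ->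
  free_convolution_power nu n rho -> voiculescu_transform rho phi ->
  voiculescu_transform nu psi -> \forall z \near cone_infty R, phi z = n%:R * psi z.
Proof.
move=> rho1 + + Vpsi; elim: n rho rho1 phi => [|n IHn] rho rho1 phi /=.
  by move=> rho0 Vphi; apply: filterS (voiculescu_dirac0 rho0 Vphi) => z; rewrite mul0r.
move=> [sigma sn [phi' [psi' [Vphi' Vpsi' Vsum]]]] Vphi.
have s1 : (sigma : Rmeasure R) setT = 1%E := probability_setT sigma.
have nu1 : (nu : Rmeasure R) setT = 1%E := probability_setT nu.
near=> z.
have -> : phi z = phi' z + psi' z by near: z; exact: voiculescu_unique Vphi Vsum.
have -> : psi' z = psi z by near: z; exact: voiculescu_unique Vpsi' Vpsi.
have -> : phi' z = n%:R * psi z by near: z; exact: (IHn sigma s1 phi' sn Vphi').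
by rewrite -addn1 natrD mulrDl mul1r.
Unshelve. all: by end_near. Qed.

(* With [z = F_nu w], the Voiculescu transform of [nu] at [z] is [w - z]. *)
Lemma free_convolution_root (R : realType) (nu : Rprobability R) n (mu : Rmeasure R) :
  mu setT = 1%E -> free_convolution_power nu n.+1 mu ->
  \forall w \near cone_infty R,
    F_transform mu (F_transform nu w + n.+1%:R * (w - F_transform nu w)) = F_transform nu w.
Proof.
move=> mu1 /[dup] pmu [sigma _ [phi' [psi [_ Vpsi Vsum]]]].
have nu1 : (nu : Rmeasure R) setT = 1%E := probability_setT nu.
set phi := fun z => _ in Vsum.
have E := free_convolution_power_voiculescu mu1 pmu Vsum Vpsi.
have E' := near_F_transform nu1 E.
have I' := near_F_transform nu1 (voiculescu_inverse Vsum).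
have K := voiculescu_F_transform nu1 Vpsi.
near=> w.
have Kw : F_transform nu w + psi (F_transform nu w) = w by near: w; exact: K.
have -> : w - F_transform nu w = psi (F_transform nu w).
  by rewrite -{1}Kw addrAC subrr add0r.
have <- : phi (F_transform nu w) = n.+1%:R * psi (F_transform nu w) by near: w; exact: E'.
by near: w; exact: I'.
Unshelve. all: by end_near. Qed.

(** * Expansion of the Cauchy transform of a free convolution root *)

Section PolynomialBounds.
Variable R : realType.
Implicit Types (p : {poly R[i]}).

Lemma poly_normc_bounded p : exists2 B : R, 0 <= B &
  forall x, normc x <= 1 -> normc p.[x] <= B.
Proof.
elim/poly_ind: p => [|p c [B B0 pB]].
  by exists 0 => // x _; rewrite horner0 normc0.
exists (B + normc c) => [|x x1]; first by rewrite addr_ge0 ?normc_ge0.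
rewrite hornerMXaddC; apply: le_trans (normcD _ _) _; rewrite lerD2r normcM.
by rewrite -[B]mulr1 ler_pM ?normc_ge0 ?pB.
Qed.

Lemma poly_normc_lipschitz p : exists2 L : R, 0 <= L &
  forall x y, normc x <= 1 -> normc y <= 1 -> normc (p.[x] - p.[y]) <= L * normc (x - y).
Proof.
elim/poly_ind: p => [|p c [L L0 pL]].
  by exists 0 => // x y _ _; rewrite !horner0 subrr normc0 mul0r.
have [B B0 pB] := poly_normc_bounded p.
exists (L + B) => [|x y x1 y1]; first by rewrite addr_ge0.
rewrite !hornerMXaddC.
have -> : p.[x] * x + c - (p.[y] * y + c) = (p.[x] - p.[y]) * x + p.[y] * (x - y) by ring.
apply: le_trans (normcD _ _) _; rewrite !normcM mulrDl; apply: lerD; last first.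
  by rewrite ler_wpM2r ?normc_ge0 ?pB.
apply: le_trans (_ : normc (p.[x] - p.[y]) * 1 <= _); last by rewrite mulr1 pL.
by rewrite ler_wpM2l ?normc_ge0.
Qed.

End PolynomialBounds.

Section CumulantSeries.
Variable R : realType.
Implicit Types (k : nat -> R) (x : R[i]).

Definition nc_moment k n : R := \sum_(P in NC n) \prod_(V in P) k #|V|.

Definition moment_series K k : {poly R[i]} := \poly_(n < K) (nc_moment k n)%:C.

(** For [k 0 = 1] this is a truncation of [1 + g R(g)], with [R] the R-transform, and [C(g) / g] is
    the formal inverse of the Cauchy transform. *)
Definition cumulant_series K k : {poly R[i]} := \poly_(s < K) (k s)%:C.

Lemma moment_cumulant_series_bound K k : k 0%N = 1 ->
  exists2 B : R, 0 <= B & forall x, normc x <= 1 ->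
    normc ((cumulant_series K k).[x * (moment_series K k).[x]] - (moment_series K k).[x])
      <= B * normc x ^+ K.
Proof.
move=> k0; have kC0 : ((k 0%N)%:C : R[i]) = 1 by rewrite k0.
have [Q] := @moment_cumulant_series R[i] (fun s => (k s)%:C) K kC0.
have -> : \poly_(n < K) \sum_(P in NC n) \prod_(V in P) (k #|V|)%:C = moment_series K k.
  apply/polyP => n; rewrite !coef_poly; case: ifP => // _.
  by rewrite rmorph_sum; apply: eq_bigr => P _; rewrite rmorph_prod.
move=> QE; have [B B0 QB] := poly_normc_bounded Q; exists B => // x x1.
have -> : (cumulant_series K k).[x * (moment_series K k).[x]] =
   (moment_series K k).[x] + x ^+ K * Q.[x].
  have -> : (moment_series K k).[x] + x ^+ K * Q.[x] = (moment_series K k + 'X^K * Q).[x].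
    by rewrite hornerD hornerM hornerXn.
  rewrite -QE horner_poly horner_sum; apply: eq_bigr => s _.
  by rewrite hornerZ horner_exp hornerM hornerX.
rewrite addrAC subrr add0r normcM normcX mulrC ler_wpM2r ?exprn_ge0 ?normc_ge0 //.
exact: QB.
Qed.

Lemma small_moment_series K k : exists2 r : R, 0 < r <= 1 &
  forall x, normc x <= r -> normc (x * (moment_series K k).[x]) <= 1.
Proof.
have [B B0 MB] := poly_normc_bounded (moment_series K k).
have B1 : 1 <= 1 + B by rewrite lerDl.
have B1_gt0 : 0 < 1 + B := lt_le_trans ltr01 B1.
exists (1 + B)^-1 => [|x xr]; first by rewrite invr_gt0 B1_gt0 invf_le1.
have x1 : normc x <= 1 by apply: le_trans xr _; rewrite invf_le1.
rewrite normcM -(mulVf (lt0r_neq0 B1_gt0)).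
by apply: ler_pM; rewrite ?normc_ge0 // (le_trans (MB _ x1)) // lerDr.
Qed.

(** Meant for [t = 1/v] and [g = G(v)]: the moment expansion of [G] becomes [v G(v) = C(G(v))] up to
    an error. Indeed [C(t M(t)) = M(t)] modulo [t^K], and [C] is Lipschitz on the unit disc. *)
Lemma cumulant_of_moment_expansion K k (A : R) : k 0%N = 1 -> 0 <= A ->
  exists r B : R, [/\ 0 < r, 0 <= B & forall g t, t != 0 -> normc t <= r -> normc g <= 1 ->
    normc (g - t * (moment_series K k).[t]) <= A * normc t ^+ K.+1 ->
    normc (g / t - (cumulant_series K k).[g]) <= B * normc t ^+ K].
Proof.
move=> k0 A0; set M := moment_series K k; set C := cumulant_series K k.
have [r /andP[r0 r1] Mr] := small_moment_series K k.
have [Q Q0 CQ] := moment_cumulant_series_bound K k0.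
have [L L0 CL] := poly_normc_lipschitz C.
exists r, (A + L * A + Q); split=> [//||g t tn0 tr g1 gM].
  by rewrite !addr_ge0 ?mulr_ge0.
have t1 := le_trans tr r1.
have -> : g / t - C.[g] = (g - t * M.[t]) / t - (C.[g] - C.[t * M.[t]]) - (C.[t * M.[t]] - M.[t]).
  by field.
apply: le_trans (normcB _ _) _; rewrite [X in _ <= X]mulrDl; apply: lerD; last exact: CQ.
apply: le_trans (normcB _ _) _; rewrite [X in _ <= X]mulrDl; apply: lerD.
  by rewrite normcM normcV ler_pdivrMr ?normc_gt0 // -mulrA -exprSr.
apply: le_trans (CL _ _ g1 (Mr _ tr)) _; rewrite -mulrA ler_wpM2l //.
apply: le_trans gM _; rewrite ler_wpM2l // exprS ler_piMl //.
by rewrite exprn_ge0 ?normc_ge0.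
Qed.

(* For small [s] the map [g |-> s C(g)] is a contraction, and [s M(s)] is a fixed
   point of it up to an error of order [s ^+ K.+1]. *)
Lemma moment_of_cumulant_expansion K k (A : R) : k 0%N = 1 ->
  exists r B : R, [/\ 0 < r, 0 <= B & forall g s, normc s <= r -> normc g <= 1 ->
    normc (g - s * (cumulant_series K k).[g]) <= A * normc s ^+ K.+1 ->
    normc (g - s * (moment_series K k).[s]) <= 2 * (A + B) * normc s ^+ K.+1].
Proof.
move=> k0; set M := moment_series K k; set C := cumulant_series K k.
have [r /andP[r0 r1] Mr] := small_moment_series K k.
have [Q Q0 CQ] := moment_cumulant_series_bound K k0.
have [L L0 CL] := poly_normc_lipschitz C.
have L1_gt0 : 0 < 2 * (1 + L) by rewrite mulr_gt0 // ltr_wpDr.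
(* For [|s|] at most [1 / (2 (1 + L))] the contraction constant is at most [1/2], whence the factor
   2 in the final bound. *)
exists (Num.min r (2 * (1 + L))^-1), Q; split=> [|//|g s].
  by rewrite lt_min r0 invr_gt0.
rewrite le_min => /andP[sr sL] g1 gC; have s1 := le_trans sr r1.
have s0 := normc_ge0 s.
have hs : normc (s * M.[s] - s * C.[s * M.[s]]) <= Q * normc s ^+ K.+1.
  rewrite -mulrBr normcM -(normcN (M.[s] - _)) opprB exprS mulrCA ler_wpM2l //.
  exact: CQ.
have : normc (g - s * M.[s]) <= normc (g - s * C.[g]) +
    normc (s * M.[s] - s * C.[s * M.[s]]) + normc s * (L * normc (g - s * M.[s])).
  have {1}-> : g - s * M.[s] = g - s * C.[g] - (s * M.[s] - s * C.[s * M.[s]])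
      + s * (C.[g] - C.[s * M.[s]]) by ring.
  apply: le_trans (normcD _ _) _; apply: lerD; first exact: normcB.
  by rewrite normcM ler_wpM2l // CL // Mr.
move: (normc (g - _)) (normc_ge0 (g - s * M.[s])) => X X0.
have sLX : 2 * (normc s * (L * X)) <= X.
  have : normc s * (2 * (1 + L)) <= 1 by rewrite -ler_pdivlMr // div1r.
  move: X0 s0 L0 {sr sL s1 gC hs}; move: (normc s) => u X0 u0 L0 uL.
  have -> : 2 * (u * (L * X)) = (2 * L * u) * X by ring.
  by rewrite ler_piMl //; lra.
by move: gC hs sLX; lra.
Qed.

End CumulantSeries.

Section RootExpansion.
Variables (R : realType) (mu : Rmeasure R) (nu : Rprobability R) (n K : nat).
Variable k : nat -> R.
Hypothesis mu1 : mu setT = 1%E.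
Hypothesis mom : forall j, Rintegrable mu (fun x => x ^+ j).
Hypothesis k0 : k 0%N = 1.
Hypothesis kmu : forall j, moment mu j = nc_moment k j.
Hypothesis K0 : (0 < K)%N.
Hypothesis pow : free_convolution_power nu n.+1 mu.

(** Index 0 is not divided: it holds the constant term 1 of the cumulant series. *)
Definition root_cumulant j : R := if j is 0 then 1 else k j / n.+1%:R.

Local Notation C := (cumulant_series K k).
Local Notation M := (moment_series K k).
Local Notation Cn := (cumulant_series K root_cumulant).
Local Notation Mn := (moment_series K root_cumulant).
Let N : R := n.+1%:R.

Lemma cumulant_series_root x : C.[x] = 1 + n.+1%:R * (Cn.[x] - 1).
Proof.
rewrite !horner_poly; case: K K0 => // K' _; rewrite !big_ord_recl /= !expr0 !mulr1 k0.
rewrite [X in _ * X]addrAC subrr add0r big_distrr /=; congr (_ + _); apply: eq_bigr => i _.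
rewrite mulrA; congr (_ * _); rewrite rmorphM fmorphV rmorph_nat mulrCA divff ?mulr1 //.
Qed.

(** Let [z = F_nu(w)] and [v = z + (n+1)(w - z)]. Then [g = 1/z] is both [G_nu(w)] and [G_mu(v)].
    The expansion of [G_mu] at [v] gives [g v = C(g)] up to an error; both sides minus 1 are [n+1]
    times their analogues for [nu], so [g w = Cn(g)] up to an error, which is inverted into a moment
    expansion. *)
Lemma cauchy_root_expansion : exists B : R, \forall w \near cone_infty R,
  normc (cauchy_transform nu w - w^-1 * Mn.[w^-1]) <= B * normc w^-1 ^+ K.+1.
Proof.
have nu1 : (nu : Rmeasure R) setT = 1%E := probability_setT nu.
have N1 : 1 <= N by rewrite ler1n.
have N0 : 0 < N by rewrite ltr0n.
pose F := F_transform nu; pose u w := F w + n.+1%:R * (w - F w).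
have uw e : 0 < e -> \forall w \near cone_infty R, normc (u w - w) <= e * normc w.
  move=> e0; have e1 : 0 < e / N by rewrite divr_gt0.
  apply: filterS (F_transform_asymptotic nu1 e1) => w Fw.
  have -> : u w - w = n%:R * (w - F w) by rewrite /u -addn1 natrD; ring.
  have -> : n%:R = (n%:R : R)%:C :> R[i] by rewrite rmorph_nat.
  rewrite normcM -(normcN (w - F w)) opprB normc_real normr_nat.
  apply: (@le_trans _ _ (N * (e / N * normc w))).
    by apply: ler_pM => //; [exact: normc_ge0|rewrite ler_nat].
  by rewrite mulrA mulrCA divff ?mulr1 // lt0r_neq0.
have uP P : cone_infty R P -> \forall w \near cone_infty R, P (u w).
  exact: near_cone_asymptotic.
(* In [4 * A], one factor 2 comes from the complex integral bound and one from [|v| <= 2 Im v]. The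
   factor [2 ^+ K] in [A'] comes from [|1/v| <= 2 |1/w|]. *)
pose A := \int[mu]_x `|x ^+ K|.
have A0 : 0 <= 4 * A by rewrite mulr_ge0 // Rintegral_ge0.
have [r1 [B1 [r1_gt0 B1_ge0 C_of_M]]] := @cumulant_of_moment_expansion R K k (4 * A) k0 A0.
pose A' := B1 * 2 ^+ K.
have [r2 [B2 [r2_gt0 B2_ge0 M_of_C]]] := @moment_of_cumulant_expansion R K root_cumulant A' erefl.
(* Halved because [1/v] and [1/z] are only controlled by [2 |1/w|]. *)
pose r := Num.min (Num.min r1 r2) 1 / 2.
have m0 : 0 < Num.min (Num.min r1 r2) 1 by rewrite !lt_min r1_gt0 r2_gt0 ltr01.
have r0 : 0 < r by rewrite divr_gt0.
have [rr1 rr2 rr3] : [/\ 2 * r <= r1, 2 * r <= r2 & 2 * r <= 1].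
  by rewrite /r mulrCA divff // mulr1 !ge_min !lexx !orbT.
have h0 : 0 < 1 / 2 :> R by rewrite divr_gt0.
exists (2 * (A' + B2)); near=> w.
have w1 : r^-1 < Im w by near: w; exact: near_cone_Im.
have w2 : normc (u w - w) <= 1 / 2 * normc w by near: w; exact: (uw _ h0).
have w3 : normc (F w - w) <= 1 / 2 * normc w.
  by near: w; exact: (F_transform_asymptotic nu1 h0).
have w4 : normc (u w) <= 2 * Im (u w) by near: w; exact: (uP _ (near_cone_normc R)).
have w5 : F_transform mu (u w) = F w by near: w; exact: (free_convolution_root mu1 pow).
have half_normc v : normc (v - w) <= 1 / 2 * normc w -> normc w / 2 <= normc v.
  by have := normcB v (v - w); rewrite subKr; lra.
have W0 : 0 < normc w.
  rewrite (lt_le_trans _ (le_trans (ler_norm _) (le_Im_normc w))) //.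
  by rewrite (lt_trans _ w1) ?invr_gt0.
have W2 : 0 < normc w / 2 by rewrite divr_gt0.
have {w2} v2 := half_normc _ w2; have {w3} z2 := half_normc _ w3.
set v := u w in w4 w5 v2; set z := F w in w5 z2.
have small y : normc w / 2 <= normc y -> normc y^-1 <= 2 * normc w^-1.
  move=> wy; rewrite !normcV -[2]invrK -invfM lef_pV2 ?posrE //.
  - by rewrite mulrC.
  - exact: lt_le_trans wy.
  - by rewrite mulrC.
have wn0 : w != 0 by rewrite -normc_gt0.
have vn0 : v != 0 by rewrite -normc_gt0 (lt_le_trans W2).
have zn0 : z != 0 by rewrite -normc_gt0 (lt_le_trans W2).
have Iv0 : 0 < Im v by have := lt_le_trans W2 (le_trans v2 w4); rewrite pmulr_rgt0.
have Gm : cauchy_transform mu v = z^-1 by rewrite -w5 /F_transform invrK.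
have -> : cauchy_transform nu w = z^-1 by rewrite /z /F /F_transform invrK.
have sr : normc w^-1 <= r.
  rewrite normcV invf_ple ?posrE // (le_trans (ltW w1)) //.
  exact: le_trans (ler_norm _) (le_Im_normc w).
have sr2 y : normc w / 2 <= normc y -> normc y^-1 <= 2 * r.
  by move=> /small h; apply: le_trans h _; rewrite ler_wpM2l.
have g1 : normc z^-1 <= 1 := le_trans (sr2 _ z2) rr3.
have r_r2 : r <= r2 by apply: le_trans rr2; rewrite ler_peMl ?(ltW r0) // ler1n.
apply: M_of_C => //; first exact: le_trans sr r_r2.
have gv : normc (z^-1 * v - C.[z^-1]) <= B1 * normc v^-1 ^+ K.
  rewrite -[v in z^-1 * v]invrK; apply: C_of_M => //.
  - by rewrite invr_eq0.
  - exact: le_trans (sr2 _ v2) rr1.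
  have -> : v^-1 * M.[v^-1] = \sum_(j < K) (moment mu j)%:C * v^-1 ^+ j.+1.
    rewrite horner_poly big_distrr /=; apply: eq_bigr => j _.
    by rewrite kmu exprS mulrCA.
  rewrite -Gm; apply: le_trans (cauchy_remainder_le mu1 K Iv0 mom) _.
  rewrite -normcV -/A exprS mulrA ler_wpM2r ?exprn_ge0 ?normc_ge0 //.
  have -> : 4 * A * normc v^-1 = 2 * A * (2 * normc v^-1) by ring.
  rewrite ler_wpM2l ?mulr_ge0 ?Rintegral_ge0 // normcV.
  rewrite -[2]invrK -invfM lef_pV2 ?posrE //; first by rewrite ler_pdivrMl.
  by rewrite mulr_gt0 ?invr_gt0 ?normc_gt0.
have gw : normc (z^-1 * w - Cn.[z^-1]) <= A' * normc w^-1 ^+ K.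
  have E : z^-1 * v - C.[z^-1] = N%:C * (z^-1 * w - Cn.[z^-1]).
    by rewrite cumulant_series_root /N rmorph_nat /v /u -/z; field.
  have : N * normc (z^-1 * w - Cn.[z^-1]) <= B1 * (2 * normc w^-1) ^+ K.
    rewrite -[N]gtr0_norm // -normc_real -normcM -E; apply: le_trans gv _.
    by rewrite ler_wpM2l // lerXn2r ?nnegrE ?mulr_ge0 ?normc_ge0 // small.
  by rewrite exprMn mulrA; apply: le_trans; rewrite ler_peMl ?normc_ge0.
have -> : z^-1 - w^-1 * Cn.[z^-1] = w^-1 * (z^-1 * w - Cn.[z^-1]).
  by rewrite mulrBr mulrCA mulVf ?mulr1.
by rewrite normcM exprS mulrCA ler_wpM2l ?normc_ge0.
Unshelve. all: by end_near. Qed.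

End RootExpansion.

Lemma complex_eta (R : realType) (z : R[i]) : z = Re z +i* Im z.
Proof. by case: z. Qed.

(** * Restriction of the expansion to the imaginary axis *)

Section ImaginaryAxis.
Variables (R : realType) (nu : Rprobability R).
Let y n : R := n.+1%:R.
Let t n : R := - (y n) ^- 2.

Let y_gt0 n : 0 < y n. Proof. by rewrite /y ltr0n. Qed.

Let tE n : `|t n| = (y n)^-1 ^+ 2.
Proof. by rewrite normrN exprVn ger0_norm // invr_ge0 exprn_ge0 // ltW. Qed.

Lemma near_imaginary_axis (P : set R[i]) : cone_infty R P ->
  \forall n \near \oo, P (0 +i* y n).
Proof.
move=> [a [b [a0 b0 PP]]].
have : \forall n \near \oo, b < n%:R by exact: nbhs_infty_gtr.
apply: filterS => n bn; apply: PP; split => /=; last by rewrite normr0 mulr_gt0.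
by apply: lt_le_trans bn _; rewrite ler_nat.
Qed.

Let inv_iy n : (0 +i* y n)^-1 = 0 +i* (- (y n)^-1).
Proof.
have := y_gt0 n; rewrite /y; move: (n.+1%:R) => Y Y0.
rewrite [LHS]complex_eta complex_ReV complex_ImV /= mul0r expr0n add0r; congr (_ +i* _).
by field; rewrite gt_eqF.
Qed.

Let normc_iy n : normc (0 +i* y n)^-1 = (y n)^-1.
Proof. by rewrite inv_iy /= expr0n add0r sqrtr_sqr normrN ger0_norm // invr_ge0 ltW. Qed.

Let sqr_inv_iy n : (0 +i* y n)^-1 ^+ 2 = (t n)%:C.
Proof.
rewrite inv_iy expr2; simpc; rewrite /t -exprVn expr2; congr (_ +i* _); ring.
Qed.

(* Powers [(i y)^-k] are real for even [k] and imaginary for odd [k]. *)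
Let moment_series_iy (b : nat -> R) J n : let s := (0 +i* y n)^-1 in
  \sum_(k < J.*2) (b k)%:C * s ^+ k = (\sum_(j < J) b j.*2 * t n ^+ j)
    -i* ((y n)^-1 * \sum_(j < J) b j.*2.+1 * t n ^+ j).
Proof.
rewrite /=; elim: J => [|J IHJ]; first by rewrite !big_ord0 mulr0 oppr0.
rewrite doubleS !big_ord_recr /= IHJ exprSr -mul2n exprM sqr_inv_iy inv_iy.
rewrite -(rmorphXn (real_complex R)) mul2n; simpc.
by congr (_ +i* _); ring.
Qed.

Let cauchy_iy n : let w := 0 +i* y n in
  w * cauchy_transform nu w = (\int[nu]_x (1 * (y n ^+ 2 / (x ^+ 2 + y n ^+ 2))))
    -i* ((y n)^-1 * \int[nu]_x (x * (y n ^+ 2 / (x ^+ 2 + y n ^+ 2)))).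
Proof.
move=> w; have nu1 : (nu : Rmeasure R) setT = 1%E := probability_setT nu.
have i1 : Rintegrable nu (fun=> 1) by exact: finite_measure_integrable_cst.
have [rI iI] := Cintegrable_kernel (y_gt0 n : 0 < Im w) i1.
have D0 x : x ^+ 2 + y n ^+ 2 != 0.
  by rewrite gt_eqF // ltr_wpDl ?sqr_ge0 // exprn_gt0.
rewrite cauchy_transformE /Cintegral /w; simpc.
have -> : (fun x : R => 1 * (y n ^+ 2 / (x ^+ 2 + y n ^+ 2))) =
    (fun x => - y n * Im ((1:R)%:C * (w - x%:C)^-1)).
  apply/funext => x; rewrite !mul1r complex_ImV !raddfB /= subr0 sub0r sqrrN.
  by ring.
have -> : (fun x : R => x * (y n ^+ 2 / (x ^+ 2 + y n ^+ 2))) =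
    (fun x => - y n ^+ 2 * Re ((1:R)%:C * (w - x%:C)^-1)).
  apply/funext => x; rewrite !mul1r complex_ReV !raddfB /= subr0 sub0r sqrrN.
  by ring.
rewrite !RintegralZl // mulNr; congr (_ +i* _).
by rewrite mulNr mulrN opprK expr2 !mulrA mulVf ?mul1r // gt_eqF.
Qed.

Lemma stieltjes_expansion_of_cauchy (b : nat -> R) :
  (forall K, (0 < K)%N -> exists B : R, \forall w \near cone_infty R,
     normc (cauchy_transform nu w - w^-1 * \sum_(k < K) (b k)%:C * w^-1 ^+ k) <=
       B * normc w^-1 ^+ K.+1) ->
  stieltjes_expansion nu (fun=> 1) (fun j => b j.*2) /\
  stieltjes_expansion nu id (fun j => b j.*2.+1).
Proof.
move=> H.
(* One more term than claimed is kept, because dividing the imaginary part by [y^-1] costs a factor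
   [y]. That term has the order [|t|^J] of the error and is absorbed in its constant. *)
suff main J : exists B : R, \forall n \near \oo,
    `|\int[nu]_x (1 * (y n ^+ 2 / (x ^+ 2 + y n ^+ 2))) - 
      \sum_(j < J.+1) b j.*2 * t n ^+ j| <= B * `|t n| ^+ J /\
    `|\int[nu]_x (x * (y n ^+ 2 / (x ^+ 2 + y n ^+ 2))) - 
      \sum_(j < J.+1) b j.*2.+1 * t n ^+ j| <= B * `|t n| ^+ J.
  split=> J; have [B] := main J.
    move=> HB; exists (B + `|b J.*2|); apply: filterS HB => n [+ _].
    rewrite big_ord_recr /= opprD addrA => h; rewrite -/(y n) -/(t n).
    set X := _ - \sum_(j < J) _ in h *.
    rewrite mulrDl -normrX -normrM.
    rewrite -normrX in h.
    by have := ler_normD (X - b J.*2 * t n ^+ J) (b J.*2 * t n ^+ J); rewrite subrK; lra.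
  move=> HB; exists (B + `|b J.*2.+1|); apply: filterS HB => n [_ +].
  rewrite big_ord_recr /= opprD addrA => h; rewrite -/(y n) -/(t n).
  set X := _ - \sum_(j < J) _ in h *.
  rewrite mulrDl -normrX -normrM.
  rewrite -normrX in h.
  by have := ler_normD (X - b J.*2.+1 * t n ^+ J) (b J.*2.+1 * t n ^+ J); rewrite subrK; lra.
have [B HB] := H J.+1.*2 isT; exists B.
apply: filterS (near_imaginary_axis HB) => n.
set w := 0 +i* y n => h.
have w0 : 0 < normc w by rewrite -invr_gt0 -normcV normc_iy invr_gt0.
have wn0 : w != 0 by rewrite -normc_gt0.
have : normc (w * cauchy_transform nu w - \sum_(k < J.+1.*2) (b k)%:C * w^-1 ^+ k) <=
    B * (y n)^-1 ^+ J.+1.*2.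
  rewrite -normc_iy -/w.
  have -> : w * cauchy_transform nu w - \sum_(k < J.+1.*2) (b k)%:C * w^-1 ^+ k =
     w * (cauchy_transform nu w - w^-1 * \sum_(k < J.+1.*2) (b k)%:C * w^-1 ^+ k).
    by rewrite mulrBr mulrA divff // mul1r.
  rewrite normcM; apply: le_trans (ler_wpM2l (ltW w0) h) _.
  have ww : normc w * normc w^-1 = 1 by rewrite -normcM divff // normc1.
  by rewrite [normc w^-1 ^+ J.+1.*2.+1]exprS mulrCA (mulrA (normc w)) ww mul1r.
rewrite moment_series_iy cauchy_iy.
set I1 := \int[nu]_x _; set I2 := \int[nu]_x _; set S1 := \sum_(_ < _) _; set S2 := \sum_(_ < _) _.
rewrite doubleS !exprS -mul2n exprM -tE => hB.
have y1 : (y n)^-1 <= 1 by rewrite invf_le1 // ler1n.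
have yi0 : 0 < (y n)^-1 by rewrite invr_gt0.
have T0 : 0 < `|t n| ^+ J by rewrite tE !exprn_gt0.
have B0 : 0 <= B * ((y n)^-1 * ((y n)^-1 * `|t n| ^+ J)) := le_trans (normc_ge0 _) hB.
have B1 : 0 <= B by move: B0; rewrite pmulr_lge0 // !mulr_gt0.
split.
  have := le_trans (le_Re_normc _) hB; rewrite /= => /le_trans; apply.
  by rewrite ler_wpM2l // mulrA ler_piMl ?(ltW T0) // mulr_ile1 // ltW.
have := le_trans (le_Im_normc _) hB; rewrite /= => hI.
have E : - ((y n)^-1 * I2) - - ((y n)^-1 * S2) = - ((y n)^-1 * (I2 - S2)) by ring.
move: hI; rewrite E normrN normrM gtr0_norm // mulrCA ler_pM2l // => /le_trans; apply.
by rewrite ler_wpM2l // ler_piMl // ltW.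
Qed.

End ImaginaryAxis.

(** * Free infinite divisibility makes Hankel determinants nonnegative *)

Section FreeInfiniteDivisibility.
Variables (R : realType) (mu : Rmeasure R).
Hypothesis mu1 : mu setT = 1%E.
Hypothesis mom : forall j, Rintegrable mu (fun x => x ^+ j).

(** [free_cumulant mu 0] is a default value, 0, whereas the cumulant series must have constant term
    1. *)
Let k j : R := if j is 0 then 1 else free_cumulant mu j.

Lemma eq_nc_moment (f g : nat -> R) n : (forall j, (0 < j)%N -> f j = g j) ->
  nc_moment f n.+1 = nc_moment g n.+1.
Proof.
move=> fg; apply: eq_bigr => P /NC_is_ncpart[ne _ _ _]; apply: eq_bigr => V VP.
by rewrite fg // card_gt0 (ne _ VP).1.
Qed.

Let kmu j : moment mu j = nc_moment k j.
Proof.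
case: j => [|j].
  rewrite /moment /nc_moment -nc_sumE // nc_sum0 //.
  by rewrite -[LHS]/(\int[mu]_x (cst 1 x)) Rintegral_cst // mu1 mulr1.
rewrite moment_cumulants; apply: eq_nc_moment => -[//|i] _.
by [].
Qed.

Lemma free_root_moments (nu : Rprobability R) n : free_convolution_power nu n.+1 mu ->
  forall j, Rintegrable nu (fun x => x ^+ j) /\
    \int[nu]_x x ^+ j = nc_moment (root_cumulant n k) j.
Proof.
move=> pow.
have [|e1 ex] := @stieltjes_expansion_of_cauchy R nu (nc_moment (root_cumulant n k)).
  move=> K K0; have [B HB] := cauchy_root_expansion mu1 mom (erefl : k 0%N = 1) kmu K0 pow.
  by exists B; apply: filterS HB => w; rewrite horner_poly.
exact: moments_of_expansion e1 ex.
Qed.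

Lemma fid_hankel_det_ge0 N : freely_infinitely_divisible mu -> 0 <= hankel_det mu N.
Proof.
move=> fid; apply: det_psd_ge0 => v.
pose e n : R := n.+1%:R^-1.
have e0 : e n @[n --> \oo] --> (0 : R) by exact: cvg_harmonic.
have ev : \forall n \near \oo, e n != 0.
  by apply: nearW => n; rewrite invr_eq0 pnatr_eq0.
have ck j : (e n)^-1 * nc_moment (fun l => e n * k l) j.+1 @[n --> \oo] --> k j.+1.
  exact: cvg_small_cumulants.
have cS : \sum_(i < N.+1) \sum_(j < N.+1)
      v 0 i * ((e n)^-1 * nc_moment (fun l => e n * k l) (i + j).+2) * v 0 j @[n --> \oo] -->
    \sum_i \sum_j v 0 i * hankel mu N i j * v 0 j.
  apply: cvg_sum_cond => i _; apply: cvg_sum_cond => j _.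
  apply: cvgM; last exact: cvg_cst.
  apply: cvgM; first exact: cvg_cst.
  have -> : hankel mu N i j = k (i + j).+2 by rewrite mxE addn2.
  exact: ck.
rewrite -(cvg_lim _ cS) //; apply: limr_ge; first by apply/cvg_ex; eexists; exact: cS.
apply: nearW => n; have [nu pow] := fid n.+1 isT.
have rm := free_root_moments pow.
have -> : \sum_(i < N.+1) \sum_(j < N.+1)
      v 0 i * ((e n)^-1 * nc_moment (fun l => e n * k l) (i + j).+2) * v 0 j =
   (e n)^-1 * \sum_(i < N.+1) \sum_(j < N.+1) v 0 i * \int[nu]_x (x ^+ (i + j + 2)) * v 0 j.
  rewrite big_distrr /=; apply: eq_bigr => i _; rewrite big_distrr /=.
  apply: eq_bigr => j _; rewrite (rm (i + j + 2)%N).2 addn2.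
  (* The two sequences may differ at index 0, which is never the size of a block. *)
  rewrite (@eq_nc_moment _ (fun j => e n * k j)) => [|[//|l] _]; last by rewrite mulrC.
  by rewrite mulrCA !mulrA.
rewrite mulr_ge0 ?invr_ge0 //; apply: hankel_moments_psd => j; exact: (rm j).1.
Qed.

End FreeInfiniteDivisibility.

(** Moving the power of [c] into the moments serves both the homogeneity, with [c] the dilation
    factor, and the limit, with [c = q]: each becomes a statement on the sequences [c^n m_n]. *)
Lemma hankel_det_cumulants (R : realType) (mu : Rmeasure R) (c : R) N :
  c ^+ (N.+1 * N.+2) * hankel_det mu N =
  \det (\matrix_(i < N.+1, j < N.+1) cumulants (fun n => c ^+ n * moment mu n) (i + j).+2).
Proof.
rewrite -det_hankel_scale; congr (\det _); apply/matrixP => i j.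
by rewrite !mxE cumulants_scale addn2.
Qed.

Lemma moment_dilation (R : realType) (mu : Rprobability R) (c : R) n :
  finite_moments mu -> moment (dilation c mu) n = c ^+ n * moment mu n.
Proof.
move=> mom; have cn : Rintegrable mu (fun x => c ^+ n * x ^+ n) := RintegrableZ _ (mom n).
rewrite /moment -RintegralZl //; last exact: mom.
have mX : measurable_fun [set: measurableTypeR R] (fun x : R => (x ^+ n)%:E).
  by apply/measurable_EFinP; exact: measurable_funX.
rewrite /Rintegral /dilation /distribution integral_pushforward //.
  by congr fine; apply: eq_integral => x _; rewrite /= /homothety exprMn.
by apply: eq_integrable cn => // x _; rewrite /= /homothety exprMn.
Qed.

Lemma cvg_beta_moments (R : realType) (p : R) n : 0 < p ->
  q ^+ n * moment (beta_dist p q) n @[q --> +oo] --> moment (gamma_dist p) n.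
Proof.
move=> p0; rewrite gamma_dist_moments //.
have h : \prod_(i < n) ((p + i%:R) * (1 + (p + i%:R) * q^-1)^-1) @[q --> +oo] -->
    \prod_(i < n) (p + i%:R).
  apply: cvg_prod_cond => i _; rewrite -[X in _ --> X]mulr1; apply: cvgM; first exact: cvg_cst.
  rewrite -[X in _ --> X]invr1; apply: cvgV; first exact: oner_neq0.
  rewrite -[X in _ --> X]addr0; apply: cvgD; first exact: cvg_cst.
  rewrite -[X in _ --> X](mulr0 (p + i%:R)); apply: cvgM; first exact: cvg_cst.
  by apply/gtr0_cvgV0; [exact: nbhs_pinfty_gt|exact: cvg_id].
apply: cvg_trans h; apply: near_eq_cvg; near=> q.
have q1 : 1 < q by near: q; exact: nbhs_pinfty_gt.
have q0 : 0 < q := lt_trans ltr01 q1.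
rewrite beta_dist_moments ?(ltW q1) //.
rewrite -[n in q ^+ n]card_ord -prodr_const -big_split /=; apply: eq_bigr => i _.
have pi0 : 0 <= i%:R :> R by [].
field; rewrite ?gt_eqF //; lra.
Unshelve. all: by end_near. Qed.

Theorem lemmaB1 (R : realType) :
  (forall (mu : Rprobability R) (c : R), finite_moments mu ->
     forall N : nat,
       hankel_det (dilation c mu) N
         = c ^+ (N.+1 * N.+2) * hankel_det mu N) /\
  (forall (p : R) (N : nat), 0 < p ->
     ((q ^+ (N.+1 * N.+2) * hankel_det (beta_dist p q) N) @[q --> +oo]
        --> hankel_det (gamma_dist p) N) /\
     (hankel_det (gamma_dist p) N < 0 ->
        \forall q \near +oo, ~ freely_infinitely_divisible (beta_dist p q))).
Proof.
split=> [mu c mom N|p N p0].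
  (* The factor [1 ^+ (N.+1 * N.+2)] brings the left side into the same form, with [c = 1], so that
     only moments remain to be compared. *)
  rewrite hankel_det_cumulants -[LHS]mul1r -[X in X * _](expr1n _ (N.+1 * N.+2)).
  rewrite hankel_det_cumulants; congr (\det _); apply/matrixP => i j; rewrite !mxE.
  by apply: eq_cumulants => n _; rewrite expr1n mul1r moment_dilation.
have cvgD : q ^+ (N.+1 * N.+2) * hankel_det (beta_dist p q) N @[q --> +oo]
    --> hankel_det (gamma_dist p) N.
  under eq_fun do rewrite hankel_det_cumulants.
  apply: cvg_det => i j; rewrite !mxE addn2.
  under eq_fun do rewrite mxE.
  by apply: cvg_cumulants => n; exact: cvg_beta_moments.
split=> // neg; near=> q => fid.
have q1 : 1 < q by near: q; exact: nbhs_pinfty_gt.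
have q0 : 0 < q := lt_trans ltr01 q1.
have : q ^+ (N.+1 * N.+2) * hankel_det (beta_dist p q) N < 0.
  by near: q; exact: (cvgr_lt _ cvgD).
apply/negP; rewrite -leNgt mulr_ge0 ?exprn_ge0 ?(ltW q0) //.
apply: fid_hankel_det_ge0 fid.
- exact: beta_dist_total_mass p0 (ltW q1).
- exact: beta_dist_Rintegrable p0 (ltW q1).
Unshelve. all: by end_near. Qed.
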